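(* Let $\mathcal H$ and $\mathcal U$ be Hilbert spaces, let $A$ be a maximal dissipative operator in $\mathcal H$, and let $B\in L(\mathcal U,\mathcal H)$. Let $\mathcal H_A$ denote $\operatorname{dom}A$ equipped with the graph norm $\|\cdot\|_A$. Then there exists a linear operator $$\mathcal R:\mathcal H\times L^2_{\rm loc}(\mathbb R_0^+,\mathcal U)\to L^2_{\rm loc}(\mathbb R_0^+,\mathcal H_A)$$ with the following properties. (1) For all $x_0\in\mathcal H$, $u\in L^2_{\rm loc}(\mathbb R_0^+,\mathcal U)$ and $T>0$, with the associated mild solution $x(t)=x_u(t;x_0)$ and output $y(t)=B^*x(t)$, $$\tfrac12\|x(T)\|^2-\tfrac12\|x_0\|^2=\int_0^T\operatorname{Re}\langle u(t),y(t)\rangle\,dt-\int_0^T\|\mathcal R(x_0,u)(t)\|_A^2\,dt.$$ (2) For every $T>0$: if $u_1,u_2\in L^2_{\rm loc}(\mathbb R_0^+,\mathcal U)$ satisfy $u_1=u_2$ (a.e.) on $[0,T]$, then $\mathcal R(x_0,u_1)=\mathcal R(x_0,u_2)$ (a.e.) on $[0,T]$ for all $x_0\in\mathcal H$; and the resulting restriction operator $\mathcal R_T:\mathcal H\times L^2(0,T;\mathcal U)\to L^2(0,T;\mathcal H_A)$ (given by $\mathcal R_T(x_0,u|_{[0,T]})=\mathcal R(x_0,u)|_{[0,T]}$) is bounded.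
   Context: Hilbert spaces are complex, with inner product $\langle\cdot,\cdot\rangle$ linear in the first argument. $L(\mathcal U,\mathcal H)$ denotes the bounded linear operators from $\mathcal U$ to $\mathcal H$, and $\mathbb R_0^+=[0,\infty)$. A linear operator $A$ in $\mathcal H$ is maximal dissipative if it generates a $C_0$-semigroup of contractions on $\mathcal H$ (equivalently, by Lumer–Phillips, $\operatorname{Re}\langle Ax,x\rangle\le 0$ for all $x\in\operatorname{dom}A$ and $A-I$ is surjective). Let $(S(t))_{t\ge0}$ be this semigroup. The control system considered is $\dot x=Ax+Bu$, $x(0)=x_0$, with output $y=B^*x$. For $x_0\in\mathcal H$ and $u\in L^1_{\rm loc}(\mathbb R_0^+,\mathcal U)$ its mild solution is $$x_u(t;x_0)=S(t)x_0+\int_0^tS(t-s)Bu(s)\,ds,\qquad t\ge0.$$ The graph norm is $\|x\|_A=(\|x\|^2+\|Ax\|^2)^{1/2}$, $x\in\operatorname{dom}A$; since $A$ is closed, $\mathcal H_A=(\operatorname{dom}A,\|\cdot\|_A)$ is a Hilbert space. *)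

(* Defs.v *)
From HB Require Import structures.
From mathcomp Require Import all_boot all_order all_algebra.
From mathcomp Require Import generic_quotient ring_quotient sesquilinear.
From mathcomp Require Import complex.
From mathcomp Require Import all_classical all_reals all_analysis.
From mathcomp Require Import measurable_realfun ring.

Set Implicit Arguments.
Unset Strict Implicit.
Unset Printing Implicit Defensive.

Import Order.TTheory GRing.Theory Num.Theory.
Import numFieldNormedType.Exports.

Local Open Scope classical_set_scope.
Local Open Scope ring_scope.
Local Open Scope complex_scope.
Local Open Scope quotient_scope.

HB.mixin Record NormedModule_hasInner (R : realType) H
    & NormedModule R[i] H := {
  inner : {dot H for @Num.conj R[i]} ;
  inner_normE : forall x : H, `|x| ^+ 2 = inner x x }.

(* [inner] is linear in its first argument and conjugate linear in its second. *)
#[short(type="hilbertType")]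
HB.structure Definition Hilbert (R : realType) :=
  {H of CompleteNormedModule R[i] H & NormedModule_hasInner R H}.

(* Norms of modules over [R[i]] take values in [R[i]]; [rnorm] is the same norm
   as an element of [R]. *)
Definition rnorm {R : realType} {V : normedModType R[i]} (x : V) : R :=
  complex.Re `|x|.

Section rnorm_theory.
Context {R : realType} {V : normedModType R[i]}.
Implicit Types (x y : V).

Lemma rnormE x : `|x| = (rnorm x)%:C.
Proof.
rewrite /rnorm; case: (`|x|) (normr_ge0 x) => a b.
by rewrite lecE /= => /andP[/eqP -> _].
Qed.

Lemma rnorm_ge0 x : 0 <= rnorm x.
Proof. by rewrite -(lecR 0) -rnormE; exact: normr_ge0. Qed.

Lemma rnorm0 : rnorm (0 : V) = 0.
Proof. by rewrite /rnorm normr0. Qed.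

Lemma rnormD x y : rnorm (x + y) <= rnorm x + rnorm y.
Proof. by rewrite -lecR rmorphD/= -!rnormE ler_normD. Qed.

Lemma rnormZ (a : R[i]) x : rnorm (a *: x) = complex.Re `|a| * rnorm x.
Proof.
apply: complexI; rewrite -rnormE normrZ rnormE [RHS]rmorphM/=.
by congr (_ * _); rewrite normc_def.
Qed.

Lemma rnorm_eq0 x : rnorm x = 0 -> x = 0.
Proof. by move=> x0; apply/normr0_eq0; rewrite rnormE x0. Qed.

Lemma cvg_rnorm (f : nat -> V) x : f @ \oo --> x -> rnorm (f n) @[n --> \oo] --> rnorm x.
Proof.
move=> fx; apply/cvgrPdist_lt => e e0.
have eC0 : 0 < e%:C by rewrite ltcR.
move/cvgrPdist_lt : fx => /(_ _ eC0); apply: filterS => n h.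
rewrite -ltcR; apply: le_lt_trans h.
have -> : `|rnorm x - rnorm (f n)|%:C = `| `|x| - `|f n| |.
  by rewrite !rnormE -rmorphB normc_def/= expr0n addr0 sqrtr_sqr.
exact: ler_dist_dist.
Qed.

End rnorm_theory.

Section strong_measurability.
Context d {T : measurableType d} {R : realType} {V : normedModType R[i]}.
Implicit Types (D E : set T) (f g : T -> V).

Definition simple_fun (s : T -> V) : Prop :=
  finite_set (range s) /\ forall v, measurable (s @^-1` [set v]).

(* The simple functions converge at every point of [D]. For functions taken up to
   equality a.e. this is no loss: a function which is an a.e. limit of simple
   functions is a.e. equal to one which is a pointwise limit. *)
Definition strongly_measurable (D : set T) (f : T -> V) : Prop :=
  exists s : nat -> T -> V, (forall n, simple_fun (s n)) /\
    forall t, D t -> s ^~ t @ \oo --> f t.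


Lemma simple_fun_cst v : simple_fun (cst v).
Proof.
split; first by apply: sub_finite_set (finite_set1 v) => _ [x _ <-].
by move=> w; rewrite preimage_cst; case: ifP => _; [exact: measurableT|exact: measurable0].
Qed.

Lemma simple_fun_comp (W : choiceType) (s : T -> W) (g : W -> V) :
  finite_set (range s) -> (forall w, measurable (s @^-1` [set w])) ->
  simple_fun (g \o s).
Proof.
move=> fs ms; split.
  by apply: sub_finite_set (finite_image g fs) => _ [x _ <-]; exists (s x) => //; exists x.
move=> v.
rewrite (_ : _ @^-1` _ =
    \bigcup_(w in range s `&` g @^-1` [set v]) (s @^-1` [set w])).
  apply: fin_bigcup_measurable => [|w _]; last exact: ms.
  by apply: sub_finite_set fs => w [].
apply/seteqP; split => [x gx|x [w [_ <-] /= ->]//].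
by exists (s x) => //; split => //; exists x.
Qed.

Lemma simple_funD s1 s2 :
  simple_fun s1 -> simple_fun s2 -> simple_fun (s1 \+ s2).
Proof.
move=> [f1 m1] [f2 m2].
apply: (@simple_fun_comp _ (fun x => (s1 x, s2 x)) (fun p => p.1 + p.2)).
  apply: sub_finite_set (finite_setX f1 f2) => _ [x _ <-].
  by split; exists x.
move=> [w1 w2]; rewrite (_ : _ @^-1` _ = s1 @^-1` [set w1] `&` s2 @^-1` [set w2]).
  exact: measurableI.
by apply/seteqP; split => x /= [-> ->].
Qed.

Lemma simple_funZ a s : simple_fun s -> simple_fun (fun x => a *: s x).
Proof. by move=> [fs ms]; exact: (@simple_fun_comp _ s (fun v => a *: v)). Qed.

Lemma simple_fun_rnorm D s : simple_fun s -> measurable_fun D (rnorm \o s).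
Proof.
move=> [fs ms] mD B mB; apply: measurableI => //.
rewrite (_ : _ @^-1` _ =
    \bigcup_(w in range s `&` (@rnorm R V) @^-1` B) (s @^-1` [set w])).
  apply: fin_bigcup_measurable => [|w _]; last exact: ms.
  by apply: sub_finite_set fs => w [].
apply/seteqP; split => [x gx|x [w [_ Bw] /= sw]]; last by rewrite sw.
by exists (s x) => //; split => //; exists x.
Qed.

Lemma strongly_measurable0 D : strongly_measurable D 0.
Proof.
exists (fun=> cst 0); split => [n|t _]; first exact: simple_fun_cst.
exact: cvg_cst.
Qed.

Lemma strongly_measurableD D f g : strongly_measurable D f ->
  strongly_measurable D g -> strongly_measurable D (f \+ g).
Proof.
move=> [s [ss sf]] [r [sr rg]]; exists (fun n => s n \+ r n); split=> [n|t Dt].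
  exact: simple_funD.
exact: cvgD (sf _ Dt) (rg _ Dt).
Qed.

Lemma strongly_measurableZ D a f : strongly_measurable D f ->
  strongly_measurable D (a *: f).
Proof.
move=> [s [ss sf]]; exists (fun n x => a *: s n x); split=> [n|t Dt].
  exact: simple_funZ.
exact: cvgZl_tmp (sf _ Dt).
Qed.

Lemma strongly_measurable_sub D E f : E `<=` D ->
  strongly_measurable D f -> strongly_measurable E f.
Proof. by move=> ED [s [ss sf]]; exists s; split => // t /ED; exact: sf. Qed.

Lemma strongly_measurable_rnorm D f : measurable D ->
  strongly_measurable D f -> measurable_fun D (rnorm \o f).
Proof.
move=> mD [s [ss sf]]; apply: (@measurable_fun_cvg _ _ _ _ (fun n => rnorm \o s n)).
  by move=> n; exact: simple_fun_rnorm.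
by move=> x Dx; exact: cvg_rnorm (sf _ Dx).
Qed.

End strong_measurability.

Section L2loc.
Context {R : realType} (I : set R) (V : normedModType R[i]).
Local Notation mu := (@lebesgue_measure R).

(* Strongly measurable and square integrable on the compact subsets of [I]; the
   values outside [I] are unconstrained, and [l2null] identifies functions that
   agree a.e. on [I]. *)
Definition l2loc : {pred R -> V} := fun f =>
  `[< strongly_measurable I f /\
      forall K, compact K -> K `<=` I ->
        (\int[mu]_(t in K) (rnorm (f t) ^+ 2)%:E < +oo)%E >].

Lemma l2loc_submod_closed : submod_closed l2loc.
Proof.
split=> [|a f g].
  apply/asboolP; split=> [|K _ _]; first exact: strongly_measurable0.
  under eq_integral do rewrite rnorm0 expr0n/=.
  by rewrite integral0.
move=> /asboolP[mf intf] /asboolP[mg intg].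
apply/asboolP; split=> [|K cK KI].
  exact/strongly_measurableD/mg/strongly_measurableZ/mf.
have mK := compact_measurable cK.
have mr (h : R -> V) : strongly_measurable I h ->
    measurable_fun K (fun t => rnorm (h t) ^+ 2).
  move=> /(strongly_measurable_sub KI) /(strongly_measurable_rnorm mK) mh.
  exact: measurable_funX.
pose c : R := 2 * complex.Re `|a| ^+ 2.
have c0 : 0 <= c by rewrite mulr_ge0// sqr_ge0.
have m2 (b : R) (h : R -> V) : strongly_measurable I h ->
    measurable_fun K (fun t => (b%:E * (rnorm (h t) ^+ 2)%:E)%E).
  by move=> mh; apply: measurable_funeM; apply/measurable_EFinP; apply: mr.
apply: (@le_lt_trans _ _ (\int[mu]_(t in K)
    (c%:E * (rnorm (f t) ^+ 2)%:E + 2%:E * (rnorm (g t) ^+ 2)%:E)))%E.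
  apply: ge0_le_integral => //.
  - by move=> t _; rewrite lee_fin sqr_ge0.
  - apply/measurable_EFinP; apply: mr.
    exact/strongly_measurableD/mg/strongly_measurableZ/mf.
  - by apply: emeasurable_funD; exact: m2.
  - move=> t _; rewrite -!EFinM -EFinD lee_fin /c.
    have := rnormD (a *: f t) (g t); rewrite rnormZ.
    set x := complex.Re _; set y := rnorm (f t); set z := rnorm (g t).
    move=> h; rewrite -[leLHS]/(rnorm (a *: f t + g t) ^+ 2).
    apply: (@le_trans _ _ ((x * y + z) ^+ 2)).
      rewrite lerXn2r// ?nnegrE ?rnorm_ge0//.
      exact: le_trans (rnorm_ge0 _) h.
    have := sqr_ge0 (x * y - z); rewrite -subr_ge0 => h2.
    by rewrite -subr_ge0; apply: le_trans h2 _; rewrite le_eqVlt; apply/orP/or_introl/eqP; ring.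
have p2 (b : R) (h : R -> V) : 0 <= b ->
    forall t, K t -> (0 <= b%:E * (rnorm (h t) ^+ 2)%:E)%E.
  by move=> b0 t _; rewrite -EFinM lee_fin mulr_ge0// sqr_ge0.
have i2 (b : R) (h : R -> V) : 0 <= b -> strongly_measurable I h ->
    (\int[mu]_(t in K) (rnorm (h t) ^+ 2)%:E < +oo)%E ->
    (\int[mu]_(t in K) (b%:E * (rnorm (h t) ^+ 2)%:E) < +oo)%E.
  move=> b0 mh hoo; rewrite ge0_integralZl_EFin//.
  - by rewrite lte_mul_pinfty// ?lee_fin.
  - by move=> t _; rewrite lee_fin sqr_ge0.
  - by apply/measurable_EFinP; apply: mr.
rewrite ge0_integralD//; [|exact: p2|exact: m2|exact: p2|exact: m2].
by apply: lte_add_pinfty; apply: i2 => //; [exact: intf|exact: intg].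
Qed.

HB.instance Definition _ :=
  GRing.isSubmodClosed.Build R[i] (R -> V) l2loc l2loc_submod_closed.

Record l2fun := L2fun { l2val :> R -> V ; _ : l2val \in l2loc }.
HB.instance Definition _ := [isSub for l2val].
HB.instance Definition _ := [Choice of l2fun by <:].
HB.instance Definition _ := [SubChoice_isSubLmodule of l2fun by <:].

Definition l2null : {pred l2fun} := fun f =>
  `[< (f : R -> V) = cst 0 %[ae mu in I] >].

Lemma l2null_zmod_closed : zmod_closed l2null.
Proof.
split=> [|f g /asboolP f0 /asboolP g0]; first exact/asboolP/aeW.
apply/asboolP; apply: (@filterS2 _ _ (ae_filter_ringOfSetsType mu)) f0 g0.
move=> t f0 g0 It.
by rewrite -[LHS]/(f t - g t) f0// g0// subrr.
Qed.

Lemma l2nullZ a f : f \in l2null -> a *: f \in l2null.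
Proof.
move=> /asboolP f0; apply/asboolP; apply: (@filterS _ _ (ae_filter_ringOfSetsType mu)) f0.
move=> t f0 It.
by rewrite -[LHS]/(a *: f t) f0// scaler0.
Qed.

HB.instance Definition _ :=
  GRing.isZmodClosed.Build l2fun l2null l2null_zmod_closed.

Definition L2loc : Type := Quotient.quot l2null.
HB.instance Definition _ := Choice.on L2loc.
HB.instance Definition _ := GRing.Zmodule.on L2loc.
HB.instance Definition _ : EqQuotient l2fun (Quotient.equiv l2null) L2loc :=
  EqQuotient.on L2loc.

Definition l2scale (a : R[i]) := lift_op1 L2loc ( *:%R a).

Lemma l2scale_pi a : {morph \pi_L2loc : f / a *: f >-> l2scale a f}.
Proof.
move=> f; unlock l2scale; apply/eqP; rewrite piE.
by rewrite Quotient.equivE -scalerBr l2nullZ// Quotient.idealrBE reprK.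
Qed.

Let l2pi_add : {morph \pi_L2loc : f g / f + g}.
Proof. exact: Quotient.pi_add. Qed.

Let l2scaleA a b x : l2scale a (l2scale b x) = l2scale (a * b) x.
Proof. by elim/quotW: x => f; rewrite -!l2scale_pi scalerA. Qed.

Let l2scale1 : left_id 1 l2scale.
Proof. by elim/quotW=> f; rewrite -l2scale_pi scale1r. Qed.

Let l2scaleDr : right_distributive l2scale +%R.
Proof.
move=> a; elim/quotW=> f; elim/quotW=> g.
by rewrite -!l2pi_add -!l2scale_pi -!l2pi_add scalerDr.
Qed.

Let l2scaleDl x : {morph l2scale^~ x : a b / a + b}.
Proof.
by elim/quotW: x => f a b; rewrite -!l2scale_pi -!l2pi_add scalerDl.
Qed.

HB.instance Definition _ := GRing.Zmodule_isLmodule.Build R[i] L2loc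
  l2scaleA l2scale1 l2scaleDr l2scaleDl.

End L2loc.

Definition l2repr {R : realType} {I : set R} {V : normedModType R[i]}
  (u : L2loc I V) : R -> V := repr u.

Lemma subset_itv0T {R : realType} (T : R) :
  `[0, T]%classic `<=` `[0, +oo[%classic.
Proof. by move=> t /=; rewrite !in_itv/= andbT => /andP[]. Qed.

Lemma l2loc_sub {R : realType} (I J : set R) (V : normedModType R[i])
    (f : l2fun I V) : J `<=` I -> (f : R -> V) \in @l2loc R J V.
Proof.
case: f => f /= /asboolP[mf intf] JI; apply/asboolP; split.
  exact: strongly_measurable_sub mf.
by move=> K cK KJ; apply: intf => //; exact: subset_trans JI.
Qed.

(* L^2_loc([0, +oo[; V); and, [`[0, T]] being compact, L^2(0, T; V). *)
Notation L2loc_pos V := (L2loc `[0, +oo[%classic V).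
Notation L2 T V := (L2loc `[0, T]%classic V).

Definition l2restr {R : realType} {V : normedModType R[i]} (T : R)
    (u : L2loc_pos V) : L2 T V :=
  \pi_(L2 T V) (L2fun (l2loc_sub (repr u) (@subset_itv0T R T))).

Definition l2norm {R : realType} {V : normedModType R[i]} (T : R)
    (u : L2 T V) : R :=
  Num.sqrt (\int[lebesgue_measure]_(t in `[0, T]) rnorm (l2repr u t) ^+ 2).

Section bochner.
Local Open Scope ereal_scope.
Context d {T : measurableType d} {R : realType} {V : normedModType R[i]}.
Variables (mu : {measure set T -> \bar R}) (D : set T).

(* For [v = 0] the fiber may have infinite measure ([fine +oo = 0]); the
   summand vanishes in any case. *)
Definition simple_integral (s : T -> V) : V :=
  (\sum_(v \in range s) (fine (mu (D `&` s @^-1` [set v])))%:C *: v)%R.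

(* Measurability of [f] is required since [\int] of a nonmeasurable nonnegative
   function is only a lower integral. *)
Definition is_bochner (f : T -> V) (v : V) : Prop :=
  strongly_measurable D f /\
  exists s : nat -> T -> V, [/\
    forall n, simple_fun (s n),
    forall n w, w != 0%R -> mu (D `&` s n @^-1` [set w]) < +oo,
    \int[mu]_(t in D) (rnorm (f t - s n t))%:E @[n --> \oo] --> 0 &
    simple_integral (s n) @[n --> \oo] --> v].

Definition bochner (f : T -> V) : V := xget 0%R [set v | is_bochner f v].

End bochner.

Section submodule.
Context {K : pzRingType} {H : lmodType K} (D : submodClosed H).

Record submodule := Submodule { submodule_val : H ; _ : submodule_val \in D }.
HB.instance Definition _ := [isSub for submodule_val].
HB.instance Definition _ := [Choice of submodule by <:].
HB.instance Definition _ := [SubChoice_isSubLmodule of submodule by <:].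

End submodule.

(* A linear operator in [H] that need not be everywhere defined nor bounded. *)
Record linop {K : pzRingType} (H : lmodType K) := Linop {
  opdom : submodClosed H ;
  opfun :> {linear submodule opdom -> H} }.

Section graph_space.
Context {R : realType} {H : normedModType R[i]} (A : linop H).

(* The domain of [A] with the graph norm; a separate type so that its norm is not
   mistaken for the one of [H]. *)
Definition graph_space : Type := submodule (opdom A).
HB.instance Definition _ := GRing.Lmodule.on graph_space.

Definition graph_norm (x : graph_space) : R[i] :=
  (Num.sqrt (rnorm (submodule_val x) ^+ 2 + rnorm (A x) ^+ 2))%:C.

Let graph_normE x :
  graph_norm x = `|rnorm (submodule_val x) +i* rnorm (A x)|.
Proof. by rewrite normc_def. Qed.

Let graph_normD x y : graph_norm (x + y) <= graph_norm x + graph_norm y.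
Proof.
apply: (@le_trans _ _ (`|(rnorm (submodule_val x) +i* rnorm (A x)) +
                         (rnorm (submodule_val y) +i* rnorm (A y))|)); last first.
  by rewrite !graph_normE; exact: ler_normD.
rewrite normc_def /graph_norm lecR/= ler_wsqrtr// lerD//.
  by rewrite lerXn2r// ?nnegrE ?addr_ge0 ?rnorm_ge0//; exact: rnormD.
rewrite lerXn2r// ?nnegrE ?addr_ge0 ?rnorm_ge0//.
have -> : A (x + y) = A x + A y by exact: linearD.
exact: rnormD.
Qed.

Let graph_normZ (a : R[i]) x : graph_norm (a *: x) = `|a| * graph_norm x.
Proof.
rewrite /graph_norm; have -> : A (a *: x) = a *: A x by exact: linearZ.
rewrite -[submodule_val (a *: x)]/(a *: submodule_val x).
rewrite !rnormZ !exprMn -mulrDr sqrtrM ?sqr_ge0// sqrtr_sqr rmorphM/=.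
congr (_ * _); rewrite normc_def; case: a => p q /=.
by rewrite ger0_norm ?sqrtr_ge0.
Qed.

Let graph_norm_eq0 x : graph_norm x = 0 -> x = 0.
Proof.
rewrite graph_normE => /normr0_eq0 [/rnorm_eq0 x0 _].
exact: val_inj.
Qed.

HB.instance Definition _ := Lmodule_isNormed.Build R[i] graph_space
  graph_normD graph_normZ graph_norm_eq0.

Lemma rnorm_graphE (x : graph_space) :
  rnorm x = Num.sqrt (rnorm (submodule_val x) ^+ 2 + rnorm (A x) ^+ 2).
Proof. by []. Qed.

End graph_space.

Section semigroup.
Context {R : realType} {H : normedModType R[i]}.
Implicit Types (A : linop H) (S : R -> H -> H).

(* Only the values of [S] at nonnegative times matter. *)
Definition contraction_semigroup S : Prop :=
  [/\ forall t, 0 <= t -> linear (S t),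
      S 0 =1 id,
      forall s t, 0 <= s -> 0 <= t -> S (s + t) =1 S s \o S t,
      forall x, S t x @[t --> 0^'+] --> x &
      forall t x, 0 <= t -> `|S t x| <= `|x|].

Definition generator A S : Prop :=
  (forall x, x \in opdom A <->
     exists y : H, h^-1%:C *: (S h x - x) @[h --> 0^'+] --> y) /\
  (forall x : submodule (opdom A), h^-1%:C *: (S h (\val x) - \val x)
     @[h --> 0^'+] --> A x).

Definition maximal_dissipative A : Prop :=
  exists S, contraction_semigroup S /\ generator A S.

(* For a maximal dissipative [A], the values at nonnegative times are uniquely
   determined. *)
Definition semigroup_of A : R -> H -> H :=
  @xget (R -> H -> H) (fun=> id) [set S | contraction_semigroup S /\ generator A S].

End semigroup.

(* For a bounded operator [B], such a [v] exists (Riesz) and is unique. *)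
Definition adjoint {R : realType} {U H : hilbertType R} (B : U -> H) (h : H) : U :=
  xget 0 [set v | forall u, inner (B u) h = inner u v].

Definition mild_solution {R : realType} {U H : hilbertType R} (A : linop H)
    (B : {linear U -> H}) (x0 : H) (u : R -> U) (t : R) : H :=
  semigroup_of A t x0 +
  bochner lebesgue_measure `[0, t] (fun s => semigroup_of A (t - s) (B (u s))).

(* Main.v *)
(**
On [dom A] with the graph norm the quadratic form [- Re <A x, x>] is bounded and
nonnegative, so it equals [|L x|_A ^ 2] for a bounded operator [L] of
[graph_space A] (square root of a positive operator); formally the operator
sought is [(x0, u) |-> L x], with [x] the mild solution. In general [x] does not
take values in [dom A]. It is regularized by bounded operators [W_n] which
commute with the semigroup, map into [dom A ^ 2] and converge strongly to the
identity (averages of the semigroup over [[0, 1 / n]], applied twice). For any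
such [W] the trajectory [W x] satisfies
  [|W x(T)| ^ 2 / 2 - |W x0| ^ 2 / 2 = \int Re <W B u, W x> + \int Re <A W x, W x>]:
over a short interval the two sides differ by a quantity quadratic in
[\int (1 + |B u|)], and one sums over fine partitions. Applied to [W_m - W_n], the
identity shows that [L W_n x] is a Cauchy sequence in [L^2_loc]; its limit is the
value of the operator, and the energy balance passes to the limit. The balance
also gives the bound, and causality holds because [x] is causal.
*)
Require Import Defs.
From HB Require Import structures.
From mathcomp Require Import all_boot all_order all_algebra finmap.
From mathcomp Require Import sesquilinear complex.
From mathcomp Require Import all_classical all_reals all_analysis.
From mathcomp Require Import measurable_realfun ring lra.

Set Implicit Arguments.
Unset Strict Implicit.
Unset Printing Implicit Defensive.

Import Order.TTheory GRing.Theory Num.Theory.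
Import numFieldNormedType.Exports.

Local Open Scope classical_set_scope.
Local Open Scope ring_scope.
Local Open Scope complex_scope.

(** * Square roots of bounded positive forms *)

(** The obstacle is that [L] is bounded for the graph norm only, so the convergence of [W_n x] to
    [x] in [H] says nothing about [L W_n x]. The square root is taken in the graph inner product, so
    it maps into [dom A]; this is how the graph norm enters the balance. The control being only
    square integrable, trajectories have no usable derivative. The generator therefore enters
    through its integrated form, and two powers of [A] make the error over a short interval
    quadratic: one for the increments of [W x], one for those of [A W x]. Vector integrals are weak
    ones given by Riesz, so that bounded operators pass through them by way of adjoints; they are
    identified with the Bochner integral of the mild solution. Measurability is obtained by
    exhibiting simple approximants. *)

Lemma cvgR_unique {R : realType} {T : Type} {F : set_system T} {FF : ProperFilter F}
  (f : T -> R) (a b : R) : f @ F --> a -> f @ F --> b -> a = b.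
Proof. exact: (@norm_cvg_unique _ R). Qed.

Lemma cvgR0_le {R : realType} {T : Type} {F : set_system T} {FF : Filter F}
    (f g : T -> R) : (\near F, `|f F| <= g F) ->
  g @ F --> (0 : R) -> f @ F --> (0 : R).
Proof.
move=> fg /cvgrPdist_lt g0; apply/cvgrPdist_lt => e /g0; apply: filterS2 fg => t fg.
rewrite !sub0r !normrN; apply: le_lt_trans.
by apply: le_trans fg _; exact: ler_norm.
Qed.

Section real_norm.
Context {R : realType} {V : normedModType R[i]}.
Implicit Types (x y : V).

Lemma rnormN x : rnorm (- x) = rnorm x.
Proof. by rewrite /rnorm normrN. Qed.

Lemma rnormBC x y : rnorm (x - y) = rnorm (y - x).
Proof. by rewrite -opprB rnormN. Qed.

Lemma Re_normC (a : R) : complex.Re `|a%:C| = `|a|.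
Proof. by rewrite normc_def/= expr0n addr0 sqrtr_sqr. Qed.

Lemma rnormZr (a : R) x : rnorm (a%:C *: x) = `|a| * rnorm x.
Proof. by rewrite rnormZ Re_normC. Qed.

Lemma rnormB_le x y : rnorm (x - y) <= rnorm x + rnorm y.
Proof. by rewrite -(rnormN y); exact: rnormD. Qed.

Lemma rnorm_trans y x z : rnorm (x - z) <= rnorm (x - y) + rnorm (y - z).
Proof. by rewrite -[x - z](subrKA y); exact: rnormD. Qed.

Lemma cvg_rnormP {T} {F : set_system T} {FF : Filter F} (f : T -> V) (l : V) :
  f @ F --> l <-> rnorm (f x - l) @[x --> F] --> (0 : R).
Proof.
split=> [/cvgrPdist_lt fl|/cvgrPdist_lt fl].
- apply/cvgrPdist_lt => e e0; have eC0 : 0 < e%:C by rewrite ltcR.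
  apply: filterS (fl _ eC0) => t.
  by rewrite rnormE ltcR sub0r normrN ger0_norm ?rnorm_ge0// rnormBC.
- apply/cvgrPdist_lt => -[e e']; rewrite ltcE/= => /andP[/eqP -> e0].
  apply: filterS (fl _ e0) => t.
  by rewrite rnormE ltcR sub0r normrN ger0_norm ?rnorm_ge0// rnormBC.
Qed.

End real_norm.

Definition seq_complete {R : realType} (V : normedModType R[i]) : Prop :=
  forall u : nat -> V,
    (forall e : R, 0 < e -> exists N, forall m n, (N <= m)%N -> (N <= n)%N ->
       rnorm (u m - u n) <= e) ->
    exists l, rnorm (u n - l) @[n --> \oo] --> (0 : R).

(* Only the real part of the inner product is used; it determines it. *)
Record hilbert_form {R : realType} {V : normedModType R[i]}
    (ip : V -> V -> R) : Prop := HilbertForm {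
  hfD : forall x y z, ip (x + y) z = ip x z + ip y z ;
  hfZ : forall (a : R) x y, ip (a%:C *: x) y = a * ip x y ;
  hfi : forall x y, ip ('i *: x) y = - ip x ('i *: y) ;
  hfC : forall x y, ip x y = ip y x ;
  hf_norm : forall x, ip x x = rnorm x ^+ 2 ;
  hf_complete : seq_complete V }.

Section positive_form.
Context {R : realType} {V : lmodType R[i]} (b : V -> V -> R).
Hypothesis bD : forall x y z, b (x + y) z = b x z + b y z.
Hypothesis bZ : forall (a : R) x y, b (a%:C *: x) y = a * b x y.
Hypothesis bC : forall x y, b x y = b y x.
Hypothesis b_ge0 : forall x, 0 <= b x x.

(** The form may be degenerate: where [b y y = 0], an affine function of [t] that stays nonnegative
    must have slope zero. *)
Lemma form_CauchySchwarz x y : b x y ^+ 2 <= b x x * b y y.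
Proof.
have key (t : R) : 0 <= b x x + 2 * t * b x y + t ^+ 2 * b y y.
  have := b_ge0 (x + t%:C *: y).
  rewrite bD [b x _]bC [b (t%:C *: y) _]bC !bD !bZ ![b _ (t%:C *: y)]bC !bZ (bC y x).
  by congr (_ <= _); ring.
have [y0|y0] := eqVneq (b y y) 0.
  have [->|xy0] := eqVneq (b x y) 0; first by rewrite y0 mulr0 expr0n.
  (* For this [t] the affine function would take the value [-1]. *)
  have := key (- (b x x + 1) / (2 * b x y)).
  rewrite y0 mulr0 addr0.
  have -> : b x x + 2 * (- (b x x + 1) / (2 * b x y)) * b x y = -1 by field.
  by rewrite lerNr oppr0 ler10.
have := key (- b x y / b y y).
have -> : b x x + 2 * (- b x y / b y y) * b x y + (- b x y / b y y) ^+ 2 * b y y =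
  (b x x * b y y - b x y ^+ 2) / b y y by field.
by rewrite pmulr_lge0 ?invr_gt0 ?lt_def ?y0 ?b_ge0// subr_ge0.
Qed.

End positive_form.

Section hilbert_form_theory.
Context {R : realType} {V : normedModType R[i]} {ip : V -> V -> R}.
Hypothesis hV : hilbert_form ip.
Implicit Types (x y z : V).

Lemma hfDr x y z : ip x (y + z) = ip x y + ip x z.
Proof. by rewrite hfC// hfD// !(hfC hV x). Qed.

Lemma hfZr (a : R) x y : ip x (a%:C *: y) = a * ip x y.
Proof. by rewrite hfC// hfZ// (hfC hV x). Qed.

Lemma hfN x y : ip (- x) y = - ip x y.
Proof. by rewrite -scaleN1r -(rmorphN1 (@real_complex R)) hfZ// mulN1r. Qed.

Lemma hfNr x y : ip x (- y) = - ip x y.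
Proof. by rewrite hfC// hfN hfC. Qed.

Lemma hfB x y z : ip (x - y) z = ip x z - ip y z.
Proof. by rewrite hfD// hfN. Qed.

Lemma hfBr x y z : ip x (y - z) = ip x y - ip x z.
Proof. by rewrite hfDr hfNr. Qed.

Lemma hf0 y : ip 0 y = 0.
Proof. by rewrite -(subrr y) hfB subrr. Qed.

Lemma hf_le_norm x y : `|ip x y| <= rnorm x * rnorm y.
Proof.
rewrite -(@ler_pXn2r _ 2)// ?nnegrE ?mulr_ge0 ?rnorm_ge0// real_normK ?num_real//.
rewrite exprMn -!(hf_norm hV).
apply: form_CauchySchwarz; [exact: hfD|exact: hfZ|exact: hfC|].
by move=> z; rewrite hf_norm// sqr_ge0.
Qed.

Lemma hf_eq x y : (forall h, ip x h = ip y h) -> x = y.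
Proof.
move=> xy; apply/eqP; rewrite -subr_eq0; apply/eqP/rnorm_eq0/eqP.
by rewrite -sqrf_eq0 -(hf_norm hV) hfB xy subrr.
Qed.

Lemma hf_normB x y : rnorm (x - y) ^+ 2 = rnorm x ^+ 2 - 2 * ip x y + rnorm y ^+ 2.
Proof.
by rewrite -!(hf_norm hV) hfB !hfBr (hfC hV y x); ring.
Qed.

Lemma hf_normD x y : rnorm (x + y) ^+ 2 = rnorm x ^+ 2 + 2 * ip x y + rnorm y ^+ 2.
Proof.
by rewrite -!(hf_norm hV) hfD// !hfDr (hfC hV y x); ring.
Qed.

Lemma hf_cvg {T} {F : set_system T} {FF : Filter F} (f : T -> V) (l h : V) :
  rnorm (f x - l) @[x --> F] --> (0 : R) -> ip (f x) h @[x --> F] --> ip l h.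
Proof.
move=> /cvgrPdist_lt fl; apply/cvgrPdist_lt => e e0.
have h0 : 0 < rnorm h + 1 by rewrite ltr_wpDl ?rnorm_ge0.
have := fl _ (divr_gt0 e0 h0); apply: filterS => t.
rewrite sub0r normrN ger0_norm ?rnorm_ge0// ltr_pdivlMr// => {}fl.
rewrite -hfB; apply: le_lt_trans (hf_le_norm _ _) _; rewrite rnormBC.
by apply: le_lt_trans fl; rewrite ler_wpM2l ?rnorm_ge0// lerDl.
Qed.

Arguments hf_cvg {T F FF f l} h _.

Lemma hf_cvg_unique (u : nat -> V) (l l' : V) :
  rnorm (u n - l) @[n --> \oo] --> (0 : R) ->
  rnorm (u n - l') @[n --> \oo] --> (0 : R) -> l = l'.
Proof.
move=> ul ul'; apply: hf_eq => h.
by apply: cvgR_unique (hf_cvg h ul) (hf_cvg h ul').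
Qed.

(* The representative minimizes [rnorm v ^+ 2 - 2 * g v]. *)
Lemma riesz (g : V -> R) (C : R) :
  (forall x y, g (x + y) = g x + g y) -> (forall (a : R) x, g (a%:C *: x) = a * g x) ->
  (forall x, `|g x| <= C * rnorm x) -> exists v, forall w, ip v w = g w.
Proof.
move=> gD gZ gC; pose phi v := rnorm v ^+ 2 - 2 * g v.
have phi_lb v : - C ^+ 2 <= phi v.
  have := le_trans (ler_norm _) (gC v); rewrite /phi => h.
  have := sqr_ge0 (rnorm v - C); nra.
have hE : has_inf (range phi).
  by split; [exists (phi 0), 0|exists (- C ^+ 2) => _ [v _ <-]].
pose d := inf (range phi).
have phid v : d <= phi v by apply: ge_inf; [case: hE|exists v].
have /choice[u hu] n : exists v, phi v < d + n.+1%:R^-1.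
  have n0 : 0 < (n.+1%:R^-1 : R) by rewrite invr_gt0.
  have [_ [v _ <-] hv] := inf_adherent n0 hE.
  by exists v.
(* Parallelogram identity: [phi] at the midpoint is at least [d], so a minimizing sequence is
   Cauchy. *)
have par x y : rnorm (x - y) ^+ 2 = 2 * phi x + 2 * phi y - 4 * phi (2^-1%:C *: (x + y)).
  rewrite /phi rnormZr gZ gD hf_normB exprMn hf_normD ger0_norm ?invr_ge0//.
  by field.
have [l ul] : exists l, rnorm (u n - l) @[n --> \oo] --> (0 : R).
  apply: (hf_complete hV) => e e0.
  have e20 : 0 < e ^+ 2 / 4 by rewrite divr_gt0// exprn_gt0.
  have /cvgrPdist_lt /(_ _ e20)[N _ hN] : n.+1%:R^-1 @[n --> \oo] --> (0 : R).
    exact: (@cvg_harmonic R).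
  exists N => m n Nm Nn.
  rewrite -(@ler_pXn2r _ 2)// ?nnegrE ?rnorm_ge0 ?(ltW e0)// par.
  have hsmall k : (N <= k)%N -> phi (u k) <= d + e ^+ 2 / 4.
    move=> Nk; apply/ltW/(lt_trans (hu k)); rewrite ltrD2l.
    by have := hN k Nk; rewrite sub0r normrN ger0_norm ?invr_ge0.
  have := hsmall _ Nm; have := hsmall _ Nn; have := phid (2^-1%:C *: (u m + u n)).
  nra.
exists l => w; apply/eqP; rewrite -subr_eq0.
(* First variation at the minimizer [l] in the direction [w]; the slack [1 / (n + 1)] of [u n]
   vanishes in the limit. *)
have key t : 0 <= 2 * t * (ip l w - g w) + t ^+ 2 * rnorm w ^+ 2.
  have cv : (2 * t * (ip (u n) w - g w) + t ^+ 2 * rnorm w ^+ 2 + n.+1%:R^-1)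
     @[n --> \oo] --> 2 * t * (ip l w - g w) + t ^+ 2 * rnorm w ^+ 2 + 0.
    apply: cvgD; last exact: (@cvg_harmonic R).
    apply: cvgD; last exact: cvg_cst.
    apply: cvgM; first exact: cvg_cst.
    by apply: cvgB; [exact: hf_cvg|exact: cvg_cst].
  rewrite -[leRHS]addr0.
  apply: (@cvgr_to_ge _ _ _ _ _ _ _ cv); apply: nearW => n.
  have := phid (u n + t%:C *: w); have := hu n.
  rewrite /phi hf_normD rnormZr hfZr gD gZ exprMn real_normK ?num_real//.
  clearbody d; move: (n.+1%:R^-1) (rnorm (u n) ^+ 2) (rnorm w ^+ 2) (ip (u n) w) => i a b c; lra.
set c := ip l w - g w in key *; set N := rnorm w ^+ 2 in key.
have N0 : 0 <= N by exact: sqr_ge0.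
(* The optimal [t] is [- c / N], but [N] vanishes for [w = 0]; with [N + 1] the value is still a
   negative multiple of [c ^ 2]. *)
have := key (- c / (N + 1)).
have N1 : N + 1 != 0 by rewrite gt_eqF// ltr_wpDl.
have -> : 2 * (- c / (N + 1)) * c + (- c / (N + 1)) ^+ 2 * N =
   - (c ^+ 2 * ((N + 2) / (N + 1) ^+ 2)) by field.
rewrite oppr_ge0 => h; rewrite -sqrf_eq0 eq_le sqr_ge0 andbT.
by rewrite pmulr_lle0 in h; last by rewrite divr_gt0 ?exprn_gt0 ?ltr_wpDl.
Qed.

(** This adjoint is what moves [W] across a weak integral. *)
Lemma riesz_adjoint (W : V -> V) (C : R) :
  (forall x y, W (x + y) = W x + W y) -> (forall (a : R) x, W (a%:C *: x) = a%:C *: W x) ->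
  (forall x, rnorm (W x) <= C * rnorm x) ->
  forall h, exists h', forall x, ip (W x) h = ip x h'.
Proof.
move=> WD WZ WC h.
have [|||h' hh'] := @riesz (fun x => ip (W x) h) (C * rnorm h).
- by move=> x y; rewrite WD hfD.
- by move=> a x; rewrite WZ hfZ.
- move=> x; apply: le_trans (hf_le_norm _ _) _.
  by rewrite mulrAC ler_wpM2r ?rnorm_ge0.
by exists h' => x; rewrite -hh' hfC.
Qed.

Section square_root.
Variable P : V -> V.
Hypothesis P_linear : linear P.
Hypothesis PC : forall x y, ip (P x) y = ip x (P y).
Hypothesis P1 : forall x, rnorm (P x) <= rnorm x.

(* [y = (p + y ^ 2) / 2] is solved by [y = 1 - sqrt (1 - p)]; the scalar iteration
   for [p = 1] dominates the operator iteration. *)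
Fixpoint sqrt_iter n : V -> V :=
  if n is m.+1 then fun x => 2^-1%:C *: (P x + sqrt_iter m (sqrt_iter m x)) else fun=> 0.

Fixpoint sqrt_bound n : R := if n is m.+1 then 2^-1 * (1 + sqrt_bound m ^+ 2) else 0.

Lemma sqrt_iter_linear n : linear (sqrt_iter n).
Proof.
elim: n => [|n IH] a x y /=; first by rewrite scaler0 addr0.
by rewrite P_linear !IH addrACA -scalerDr [LHS]scalerDr !scalerA mulrC.
Qed.

Lemma sqrt_iterB n x y : sqrt_iter n (x - y) = sqrt_iter n x - sqrt_iter n y.
Proof.
by rewrite addrC -scaleN1r sqrt_iter_linear scaleN1r addrC.
Qed.

Lemma sqrt_iterC n x y : ip (sqrt_iter n x) y = ip x (sqrt_iter n y).
Proof.
elim: n x y => [|n IH] x y /=; first by rewrite hf0 hfC// hf0.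
by rewrite hfZ// hfZr hfD// hfDr PC !IH.
Qed.

Lemma sqrt_bound01 n : 0 <= sqrt_bound n <= 1.
Proof.
elim: n => [|n /andP[h0 h1]] /=; first by rewrite lexx ler01.
by apply/andP; split; nra.
Qed.

Lemma sqrt_boundS n : sqrt_bound n <= sqrt_bound n.+1.
Proof. by rewrite /=; have := sqr_ge0 (sqrt_bound n - 1); lra. Qed.

Lemma sqrt_iter_norm n x : rnorm (sqrt_iter n x) <= sqrt_bound n * rnorm x.
Proof.
elim: n x => [|n IH] x /=; first by rewrite rnorm0 mul0r.
rewrite rnormZr ger0_norm ?invr_ge0// -mulrA ler_wpM2l ?invr_ge0//.
apply: le_trans (rnormD _ _) _; rewrite mulrDl mul1r lerD// expr2 -mulrA.
apply: le_trans (IH _) _; rewrite ler_wpM2l//.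
by have /andP[] := sqrt_bound01 n.
Qed.

(** For consecutive iterates [y], [z] the next difference is half of
    [z z - y y = z (z - y) + (z - y) y], a splitting that holds without commutation. Its norm bounds
    reproduce the scalar recursion of [sqrt_bound]. *)
Lemma sqrt_iterS_dist n x :
  rnorm (sqrt_iter n.+1 x - sqrt_iter n x) <=
  (sqrt_bound n.+1 - sqrt_bound n) * rnorm x.
Proof.
elim: n x => [|n IH] x.
  rewrite /= !subr0 addr0 expr0n/= addr0 mulr1 rnormZr ger0_norm ?invr_ge0//.
  by rewrite ler_wpM2l ?invr_ge0.
set y := sqrt_iter n; set z := sqrt_iter n.+1.
have -> : sqrt_iter n.+2 x - z x = 2^-1%:C *: (z (z x - y x) + (z (y x) - y (y x))).
  rewrite {1}/z /= -/z -scalerBr opprD addrACA subrr add0r.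
  by congr (_ *: _); rewrite /z sqrt_iterB -/z addrA subrK.
rewrite rnormZr ger0_norm ?invr_ge0//.
have /andP[z0 z1] := sqrt_bound01 n.+1; have /andP[y0 y1] := sqrt_bound01 n.
have h1 : rnorm (z (z x - y x)) <=
    sqrt_bound n.+1 * ((sqrt_bound n.+1 - sqrt_bound n) * rnorm x).
  by apply: le_trans (sqrt_iter_norm _ _) _; rewrite ler_wpM2l.
have h2 : rnorm (z (y x) - y (y x)) <=
    (sqrt_bound n.+1 - sqrt_bound n) * (sqrt_bound n * rnorm x).
  apply: le_trans (IH _) _; rewrite ler_wpM2l ?subr_ge0 ?sqrt_boundS//.
  exact: sqrt_iter_norm.
apply: (@le_trans _ _ (2^-1 * (sqrt_bound n.+1 * ((sqrt_bound n.+1 - sqrt_bound n) * rnorm x)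
  + (sqrt_bound n.+1 - sqrt_bound n) * (sqrt_bound n * rnorm x)))).
  by rewrite ler_wpM2l ?invr_ge0//; apply: le_trans (rnormD _ _) _; exact: lerD.
rewrite [sqrt_bound n.+2]/= -[2^-1 * (1 + sqrt_bound n ^+ 2)]/(sqrt_bound n.+1).
have -> : sqrt_bound n.+1 = 2^-1 * (1 + sqrt_bound n ^+ 2) by [].
by rewrite le_eqVlt; apply/orP/or_introl/eqP; field.
Qed.

Lemma sqrt_iter_dist n k x :
  rnorm (sqrt_iter (n + k)%N x - sqrt_iter n x) <=
  (sqrt_bound (n + k)%N - sqrt_bound n) * rnorm x.
Proof.
elim: k => [|k IH]; first by rewrite addn0 !subrr rnorm0 mul0r.
rewrite addnS; apply: le_trans (rnorm_trans (sqrt_iter (n + k)%N x) _ _) _.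
have := sqrt_iterS_dist (n + k)%N x; move: IH.
set a := sqrt_bound _.+1; set b := sqrt_bound _; set c := sqrt_bound n.
by move=> h1 h2; apply: le_trans (lerD h2 h1) _; rewrite -mulrDl subrKA.
Qed.

(** The scalar sequence increases and stays below 1, so it converges, and its increments dominate
    those of the operator sequence. *)
Lemma sqrt_iter_cauchy x (e : R) : 0 < e -> exists N, forall m n,
  (N <= m)%N -> (N <= n)%N -> rnorm (sqrt_iter m x - sqrt_iter n x) <= e.
Proof.
move=> e0.
have x0 : 0 < rnorm x + 1 by rewrite ltr_wpDl ?rnorm_ge0.
have [l ubl] : exists l : R, sqrt_bound @ \oo --> l.
  apply/cvg_ex/nondecreasing_is_cvgn.
    by apply/nondecreasing_seqP; exact: sqrt_boundS.
  by exists 1 => _ [n _ <-]; have /andP[] := sqrt_bound01 n.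
have e20 : 0 < e / 2 / (rnorm x + 1) by rewrite !divr_gt0.
have /cvgrPdist_lt /(_ _ e20)[N _ hN] := ubl.
have aux m n : (N <= m)%N -> (m <= n)%N -> rnorm (sqrt_iter m x - sqrt_iter n x) <= e.
  move=> Nm mn; rewrite rnormBC -(subnKC mn); apply: le_trans (sqrt_iter_dist _ _ _) _.
  rewrite subnKC//.
  have := hN _ Nm; have := hN _ (leq_trans Nm mn).
  rewrite /= !ltr_norml => /andP[a1 a2] /andP[b1 b2].
  have -> : e = (e / 2 / (rnorm x + 1) + e / 2 / (rnorm x + 1)) * (rnorm x + 1).
    by field; rewrite gt_eqF.
  rewrite ler_pM ?rnorm_ge0//; last by rewrite lerDl.
    rewrite subr_ge0; apply: (@nondecreasing_seqP _ R sqrt_bound).1 mn.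
    exact: sqrt_boundS.
  lra.
exists N => m n Nm Nn; have [mn|/ltnW nm] := leqP m n; first exact: aux.
by rewrite rnormBC; exact: aux.
Qed.

Lemma sqrt_fixpoint : exists Y : V -> V, [/\ linear Y,
  forall x y, ip (Y x) y = ip x (Y y) &
  forall x, 2%:C *: Y x = P x + Y (Y x)].
Proof.
have /choice[Y hY] x : exists l, rnorm (sqrt_iter n x - l) @[n --> \oo] --> (0 : R).
  by apply: (hf_complete hV) => e; exact: sqrt_iter_cauchy.
have YC x y : ip (Y x) y = ip x (Y y).
  apply: cvgR_unique (hf_cvg y (hY x)) _.
  have -> : (fun n => ip (sqrt_iter n x) y) = (fun n => ip (sqrt_iter n y) x).
    by apply/funext => n; rewrite sqrt_iterC hfC.
  by rewrite [ip x _]hfC//; exact: hf_cvg.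
have YD a x y : Y (a *: x + y) = a *: Y x + Y y.
  apply: hf_cvg_unique (hY _) _.
  have cv : complex.Re `|a| * rnorm (sqrt_iter n x - Y x) + rnorm (sqrt_iter n y - Y y)
     @[n --> \oo] --> complex.Re `|a| * 0 + (0 : R).
    by apply: cvgD (hY y); apply: cvgM (hY x); exact: cvg_cst.
  rewrite mulr0 addr0 in cv.
  apply: cvgR0_le cv; apply: nearW => n.
  by rewrite ger0_norm ?rnorm_ge0// sqrt_iter_linear opprD addrACA -scalerBr -rnormZ rnormD.
exists Y; split => // x; apply: hf_eq => h.
have h1 : ip (sqrt_iter n x) h @[n --> \oo] --> ip (Y x) h by exact: hf_cvg.
(* By symmetry this is [ip (sqrt_iter n x) (sqrt_iter n h)], a pairing of two strongly convergent
   sequences; it is expanded around the limits [Y x] and [Y h]. *)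
have h2 : ip (sqrt_iter n (sqrt_iter n x)) h @[n --> \oo] --> ip (Y (Y x)) h.
  have -> : (fun n => ip (sqrt_iter n (sqrt_iter n x)) h) = (fun n => ip (sqrt_iter n x) (Y h)
      + ip (sqrt_iter n x - Y x) (sqrt_iter n h - Y h) + ip (Y x) (sqrt_iter n h - Y h)).
    by apply/funext => n; rewrite sqrt_iterC hfB !hfBr; ring.
  have -> : ip (Y (Y x)) h = ip (Y x) (Y h) + 0 + 0 by rewrite YC !addr0.
  apply: cvgD; last first.
    have -> : (fun n => ip (Y x) (sqrt_iter n h - Y h)) =
        (fun n => ip (sqrt_iter n h) (Y x) - ip (Y h) (Y x)).
      by apply/funext => n; rewrite hfC// hfB.
    rewrite -(subrr (ip (Y h) (Y x))); apply: cvgB; [exact: hf_cvg|exact: cvg_cst].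
  apply: cvgD; first exact: hf_cvg.
  have cv : rnorm (sqrt_iter n x - Y x) * rnorm (sqrt_iter n h - Y h) @[n --> \oo] --> (0 : R).
    by rewrite -(mulr0 0); apply: cvgM.
  by apply: cvgR0_le cv; apply: nearW => n; exact: hf_le_norm.
have h3 : 2^-1 * (ip (P x) h + ip (sqrt_iter n (sqrt_iter n x)) h) @[n --> \oo] -->
   2^-1 * (ip (P x) h + ip (Y (Y x)) h).
  by apply: cvgM; [exact: cvg_cst|apply: cvgD h2; exact: cvg_cst].
have h4 : ip (sqrt_iter n.+1 x) h @[n --> \oo] --> ip (Y x) h.
  by move: h1; rewrite -cvg_shiftS.
have : ip (Y x) h = 2^-1 * (ip (P x) h + ip (Y (Y x)) h).
  apply: cvgR_unique h4 _; apply: cvg_trans h3; apply: near_eq_cvg; apply: nearW => n /=.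
  by rewrite hfZ// hfD.
by rewrite hfZ// hfD// => ->; field.
Qed.

End square_root.

(** Riesz gives [b x y = ip (Q x) y]. With [P = 1 - Q] and [Y] the symmetric solution of
    [2 Y = P + Y ^ 2], the operator [L = 1 - Y] is symmetric and [L ^ 2 = 1 - P = Q], so
    [ip (L x) (L x) = b x x]. *)
Lemma form_square_root (b : V -> V -> R) :
  (forall x y z, b (x + y) z = b x z + b y z) ->
  (forall (a : R) x y, b (a%:C *: x) y = a * b x y) ->
  (forall x y, b ('i *: x) y = - b x ('i *: y)) ->
  (forall x y, b x y = b y x) ->
  (forall x, 0 <= b x x <= rnorm x ^+ 2) ->
  exists L : V -> V, linear L /\ forall x, rnorm (L x) ^+ 2 = b x x.
Proof.
move=> bD bZ bi bC b01.
have b_ge0 x : 0 <= b x x by have /andP[] := b01 x.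
have b_le1 x : b x x <= rnorm x ^+ 2 by have /andP[] := b01 x.
have b_le x y : `|b x y| <= rnorm x * rnorm y.
  rewrite -(@ler_pXn2r _ 2)// ?nnegrE ?mulr_ge0 ?rnorm_ge0//.
  rewrite real_normK ?num_real// exprMn.
  apply: le_trans (form_CauchySchwarz bD bZ bC b_ge0 x y) _.
  by rewrite ler_pM.
have /choice[Q hQ] x : exists v, forall w, ip v w = b x w.
  apply: (@riesz (b x) (rnorm x)); last exact: b_le.
    by move=> y z; rewrite !(bC x) bD.
  by move=> a y; rewrite !(bC x) bZ.
have Qlin : linear Q.
  (* Riesz only yields real linearity; as for ['i], both [ip] and [b] move it to the other argument
     with a minus sign. *)
  move=> [a a'] x y; apply: hf_eq => h.
  have -> : (a +i* a') = a%:C + a'%:C * 'i by simpc.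
  rewrite !scalerDl -!scalerA !hfD// !hfZ// hfi// !hQ !bD !bZ bi.
  by [].
pose P x := x - Q x.
have Plin : linear P by move=> a x y; rewrite /P Qlin scalerBr opprD addrACA.
have PC x y : ip (P x) y = ip x (P y).
  by rewrite /P hfB hfBr !hQ [ip x (Q y)]hfC// hQ bC.
(* Cauchy-Schwarz for the form [p] of [P] at the pair [x], [P x] reads [|P x|^4 <= p x x * p (P x)
   (P x) <= |x|^2 |P x|^2]. *)
have P1 x : rnorm (P x) <= rnorm x.
  pose p x y := ip x y - b x y.
  have pD u v w : p (u + v) w = p u w + p v w by rewrite /p hfD// bD; ring.
  have pZ a u v : p (a%:C *: u) v = a * p u v by rewrite /p hfZ// bZ; ring.
  have pC u v : p u v = p v u by rewrite /p hfC// bC.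
  have p_ge0 u : 0 <= p u u by rewrite /p hf_norm// subr_ge0.
  have := form_CauchySchwarz pD pZ pC p_ge0 x (P x).
  have -> : p x (P x) = rnorm (P x) ^+ 2 by rewrite /p -hQ -hfB -/(P x) hf_norm.
  have : p x x <= rnorm x ^+ 2 by rewrite /p hf_norm// gerBl.
  have : p (P x) (P x) <= rnorm (P x) ^+ 2 by rewrite /p hf_norm// gerBl.
  have := p_ge0 x; have := p_ge0 (P x).
  have := rnorm_ge0 x; have := rnorm_ge0 (P x).
  move: (p x x) (p (P x) (P x)) (rnorm x) (rnorm (P x)) => a c X N N0 X0 c0 a0 cN aX h.
  have [->//|Nn0] := eqVneq N 0.
  have {Nn0} N0' : 0 < N by rewrite lt_def Nn0.
  have : N ^+ 2 * N ^+ 2 <= X ^+ 2 * N ^+ 2.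
    by rewrite -expr2; apply: le_trans h _; rewrite ler_pM.
  by rewrite ler_pM2r ?exprn_gt0// ler_pXn2r ?nnegrE.
have [Y [Ylin YC hY]] := sqrt_fixpoint Plin PC P1.
exists (fun x => x - Y x); split.
  by move=> a x y; rewrite Ylin scalerBr opprD addrACA.
move=> x; rewrite hf_normB -!(hf_norm hV) YC.
have : ip (2%:C *: Y x) x = ip (P x + Y (Y x)) x by rewrite hY.
rewrite hfZ// hfD// /P hfB hQ !YC => h.
by rewrite -[RHS]addr0; lra.
Qed.

End hilbert_form_theory.

(** * The real part of the inner product, and the adjoint of a bounded operator *)

Lemma ReD {R : rcfType} (a b : R[i]) : complex.Re (a + b) = complex.Re a + complex.Re b.
Proof. by case: a b => [? ?] []. Qed.

Lemma complete_seq {R : realType} (V : completeNormedModType R[i]) : seq_complete V.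
Proof.
move=> u cu; have : cvg (u @ \oo).
  apply/cauchy_cvgP/cauchy_exP => -[e e']; rewrite ltcE/= => /andP[/eqP -> e0].
  have e20 : 0 < e / 2 by rewrite divr_gt0.
  have [N hN] := cu _ e20; exists (u N), N => // n /= Nn.
  rewrite -ball_normE/= rnormE ltcR; apply: le_lt_trans (hN _ _ _ _) _ => //.
  by rewrite ltr_pdivrMr// ltr_pMr// ltr1n.
by move=> /cvg_ex[l ul]; exists l; apply/cvg_rnormP.
Qed.

Section real_inner.
Context {R : realType} {H : hilbertType R}.
Implicit Types (x y : H).

Definition rin x y : R := complex.Re (inner x y).

Lemma innerC x y : inner x y = Num.conj (inner y x).
Proof. by rewrite hermC/= expr0 mul1r. Qed.

Lemma hilbert_rin : hilbert_form rin.
Proof.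
have innerZ (a : R[i]) (x y : H) : inner (a *: x) y = a * inner x y.
  by rewrite linearZl_LR.
have rinC (x y : H) : rin x y = rin y x.
  by rewrite /rin innerC; case: (inner y x).
have rinJ (x y : H) : rin x ('i *: y) = complex.Im (inner x y).
  rewrite rinC /rin innerZ (innerC x y); case: (inner y x) => a b /=.
  by rewrite mul0r mul1r sub0r.
split => //.
- by move=> x y z; rewrite /rin linearDl ReD.
- move=> a x y; rewrite /rin innerZ; case: (inner x y) => u v /=.
  by rewrite mul0r subr0.
- move=> x y; rewrite rinJ /rin innerZ; case: (inner x y) => u v /=.
  by rewrite mul0r mul1r sub0r.
- move=> x; rewrite /rin -inner_normE rnormE -rmorphXn/=.
  by [].
- exact: complete_seq.
Qed.

Lemma Im_inner x y : complex.Im (inner x y) = - rin ('i *: x) y.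
Proof.
rewrite /rin linearZl_LR/=; case: (inner x y) => u v /=.
by rewrite mul0r mul1r sub0r opprK.
Qed.

End real_inner.

Lemma inner_eqP {R : realType} {H K : hilbertType R} (x y : H) (x' y' : K) : rin x y = rin x' y' ->
  rin ('i *: x) y = rin ('i *: x') y' -> inner x y = inner x' y'.
Proof.
move=> e1 e2; apply/eqP; rewrite eq_complex !Im_inner e2 eqxx andbT.
exact/eqP.
Qed.

Lemma linear_scale {R : realType} {V W : lmodType R[i]} (f : V -> W) :
  linear f -> forall a x, f (a *: x) = a *: f x.
Proof.
move=> lf a x.
have f0 : f 0 = 0.
  by have := lf (-1) 0 0; rewrite scaler0 addr0 scaleN1r addNr.
by have := lf a x 0; rewrite !addr0 f0 addr0.
Qed.

Lemma linear_add {R : realType} {V W : lmodType R[i]} (f : V -> W) :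
  linear f -> forall x y, f (x + y) = f x + f y.
Proof. by move=> lf x y; have := lf 1 x y; rewrite !scale1r. Qed.

Lemma linear_sub {R : realType} {V W : lmodType R[i]} (f : V -> W) :
  linear f -> forall x y, f (x - y) = f x - f y.
Proof. by move=> lf x y; rewrite addrC -scaleN1r lf scaleN1r addrC. Qed.

Lemma adjointE {R : realType} {U H : hilbertType R} (B : {linear U -> H}) (C : R) :
  (forall u, rnorm (B u) <= C * rnorm u) ->
  forall u h, rin u (adjoint B h) = rin (B u) h.
Proof.
move=> BC u h.
have [|||v hv] := riesz hilbert_rin (g := fun u => rin (B u) h) (C := C * rnorm h).
- by move=> x y; rewrite linearD (hfD hilbert_rin).
- by move=> a x; rewrite linearZ (hfZ hilbert_rin).
- move=> x; apply: le_trans (hf_le_norm hilbert_rin _ _) _.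
  by rewrite mulrAC ler_wpM2r ?rnorm_ge0.
suff : forall u, inner (B u) h = inner u (adjoint B h).
  by rewrite /rin => ->.
apply: (@xgetPex _ _ [set v | forall u, inner (B u) h = inner u v]).
(* The representer of the real functional also serves for the complex one: it is tested on [w] and
   on ['i *: w]. *)
exists v => w; apply: inner_eqP; rewrite -?linearZ [RHS](hfC hilbert_rin) hv//.
Qed.

(** * Weak integrals and Bochner integrals *)

(* The canonical measurable structure on [R] carries another display than that of
   [lebesgue_measure]; sets are therefore typed in [measurableTypeR R]. *)

Section real_integral.
Context {R : realType}.
Local Notation mu := (@lebesgue_measure R).
Implicit Types (D E : set (measurableTypeR R)) (f g : R -> R) (a b c d : R).

Lemma integrable_le D f g : measurable D -> measurable_fun D f ->
  mu.-integrable D (EFin \o g) -> (forall t, D t -> `|f t| <= g t) ->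
  mu.-integrable D (EFin \o f).
Proof.
move=> mD mf ig fg; apply: le_integrable ig => //; first exact/measurable_EFinP.
by move=> t Dt /=; rewrite lee_fin; apply: le_trans (fg _ Dt) _; exact: ler_norm.
Qed.

Lemma integrable_addr D f g : measurable D -> mu.-integrable D (EFin \o f) ->
  mu.-integrable D (EFin \o g) -> mu.-integrable D (EFin \o (fun t => f t + g t)).
Proof. by move=> mD fi gi; exact: (integrableD mD fi gi). Qed.

Lemma integrable_subr D f g : measurable D -> mu.-integrable D (EFin \o f) ->
  mu.-integrable D (EFin \o g) -> mu.-integrable D (EFin \o (fun t => f t - g t)).
Proof. by move=> mD fi gi; exact: (integrableB mD fi gi). Qed.

Lemma integrable_mull D c f : measurable D -> mu.-integrable D (EFin \o f) ->
  mu.-integrable D (EFin \o (fun t => c * f t)).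
Proof. by move=> mD fi; exact: (integrableZl mD c fi). Qed.

Lemma integrable_cstr D c : measurable D -> (mu D < +oo)%E ->
  mu.-integrable D (EFin \o (fun=> c)).
Proof.
move=> mD Doo; apply/integrableP; split; first exact: measurable_cst.
rewrite -[X in (X < _)%E]/(\int[mu]_(x in D) cst `|c|%:E x)%E.
by rewrite integral_cst//= lte_mul_pinfty.
Qed.

Lemma Rintegral_ae_eq D f g : measurable D -> measurable_fun D f -> measurable_fun D g ->
  f = g %[ae mu in D] -> \int[mu]_(t in D) f t = \int[mu]_(t in D) g t.
Proof.
move=> mD mf mg fg; rewrite /Rintegral; congr fine.
apply: ae_eq_integral => //; [exact/measurable_EFinP|exact/measurable_EFinP|].
by apply: filterS fg => t h Dt; rewrite h.
Qed.

Lemma Rintegral_norm_le D f g : measurable D -> measurable_fun D f ->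
  mu.-integrable D (EFin \o g) -> (forall t, D t -> `|f t| <= g t) ->
  `|\int[mu]_(t in D) f t| <= \int[mu]_(t in D) g t.
Proof.
move=> mD mf gi fg; have fi := integrable_le mD mf gi fg.
apply: le_trans (le_normr_Rintegral mD fi) _.
by apply: le_Rintegral => //; exact: integrable_norm.
Qed.

Lemma Rintegral_set_le D E f : measurable D -> measurable E -> D `<=` E ->
  mu.-integrable E (EFin \o f) -> (forall t, E t -> 0 <= f t) ->
  \int[mu]_(t in D) f t <= \int[mu]_(t in E) f t.
Proof.
move=> mD mE DE fi f0; rewrite /Rintegral fine_le//.
- by apply: integrable_fin_num => //; exact: integrableS DE fi.
- exact: integrable_fin_num.
- by apply: ge0_subset_integral => //; exact: measurable_int fi.
Qed.

Lemma lebesgue_itvcc a b : a <= b -> mu `[a, b] = (b - a)%:E.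
Proof.
move=> ab; rewrite lebesgue_measure_itv/= lte_fin; case: ltP => //.
by move=> ba; have -> : b = a by [apply/eqP; rewrite eq_le ab ba]; rewrite subrr.
Qed.

Lemma lebesgue_itvcc_fin a b : (mu `[a, b] < +oo)%E.
Proof.
have [ab|ba] := leP a b; first by rewrite lebesgue_itvcc// ltry.
by rewrite set_itv_ge ?measure0// -leNgt bnd_simp.
Qed.

Lemma integrable_itv a b c d f : a <= c -> d <= b ->
  mu.-integrable `[a, b] (EFin \o f) -> mu.-integrable `[c, d] (EFin \o f).
Proof.
move=> ac db; apply: integrableS => //.
by apply: subset_itv; rewrite bnd_simp.
Qed.

Lemma Rintegral_itv_cat a b c f : a <= b -> b <= c ->
  mu.-integrable `[a, c] (EFin \o f) ->
  \int[mu]_(t in `[a, c]) f t = \int[mu]_(t in `[a, b]) f t + \int[mu]_(t in `[b, c]) f t.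
Proof.
move=> ab bc fi; have := @Rintegral_itvB R f (BLeft a) (BRight c) b fi.
rewrite !bnd_simp => /(_ ab bc)/eqP; rewrite subr_eq addrC => /eqP ->.
congr (_ + _); apply: Rintegral_itv_obnd_cbnd.
apply: integrableS fi => //.
by apply: subset_itv; rewrite bnd_simp.
Qed.

Lemma Rintegral_itv_cst a b c : a <= b -> \int[mu]_(t in `[a, b]) c = c * (b - a).
Proof. by move=> ab; rewrite -[b - a]/(fine (b - a)%:E) -lebesgue_itvcc// Rintegral_cst. Qed.

(** The integral of [(f - c) ^ 2] is nonnegative for every [c]; taking for [c] the mean of [f] gives
    the bound. Integrability of [f] comes from [|f| <= 1 + f ^ 2]. *)
Lemma Rintegral_CauchySchwarz a b f : a <= b -> measurable_fun `[a, b] f ->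
  mu.-integrable `[a, b] (EFin \o (fun t => f t ^+ 2)) ->
  mu.-integrable `[a, b] (EFin \o f) /\
  (\int[mu]_(t in `[a, b]) f t) ^+ 2 <= (b - a) * \int[mu]_(t in `[a, b]) f t ^+ 2.
Proof.
move=> ab mf f2.
have ci c : mu.-integrable `[a, b] (EFin \o (fun=> c)).
  by apply: integrable_cstr => //; exact: lebesgue_itvcc_fin.
have fi : mu.-integrable `[a, b] (EFin \o f).
  apply: (@integrable_le _ _ (fun t => 1 + f t ^+ 2)) => //.
    exact: integrable_addr.
  move=> t _; have := sqr_ge0 (`|f t| - 1); rewrite -(real_normK (num_real (f t))).
  by have := normr_ge0 (f t); nra.
split=> //; set I := \int[mu]_(t in _) f t; set J := \int[mu]_(t in _) _.
have [e|ba] := eqVneq a b.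
  by rewrite /I e set_itv1 Rintegral_set1 expr0n/= subrr mul0r.
have ba0 : 0 < b - a by rewrite subr_gt0 lt_def eq_sym ba.
have key c : 0 <= J - 2 * c * I + c ^+ 2 * (b - a).
  have -> : J - 2 * c * I + c ^+ 2 * (b - a) =
      \int[mu]_(t in `[a, b]) (f t ^+ 2 - (2 * c) * f t + c ^+ 2).
    rewrite RintegralD//; last by apply: integrable_subr => //; exact: integrable_mull.
    rewrite RintegralB//; last exact: integrable_mull.
    by rewrite RintegralZl// Rintegral_itv_cst.
  apply: Rintegral_ge0 => t _; have := sqr_ge0 (f t - c).
  by rewrite sqrrB; congr (_ <= _); rewrite -mulr_natl; ring.
have := key (I / (b - a)).
have -> : J - 2 * (I / (b - a)) * I + (I / (b - a)) ^+ 2 * (b - a) =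
  ((b - a) * J - I ^+ 2) / (b - a) by field; rewrite gt_eqF.
by rewrite pmulr_lge0 ?invr_gt0// subr_ge0.
Qed.

End real_integral.

Section weak_integral.
Context {R : realType} {H : hilbertType R}.
Local Notation mu := (@lebesgue_measure R).
Local Notation hH := (@hilbert_rin R H).
Implicit Types (D E : set (measurableTypeR R)) (f : R -> H) (g : R -> R).

(* Weak (Pettis) integral: by Riesz it exists as soon as the scalar functions are
   measurable with a common integrable bound. *)
Definition wint D f : H :=
  xget 0 [set v | forall h, rin v h = \int[mu]_(t in D) rin (f t) h].

(** The bound [g] is explicit because it is carried along by sums and operators and reappears in the
    estimate [wint_norm]. *)
Definition dominated D f g : Prop :=
  [/\ measurable D, mu.-integrable D (EFin \o g), forall t, D t -> rnorm (f t) <= g t &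
      forall h, measurable_fun D (fun t => rin (f t) h)].

Lemma dominated_integrable D f g h : dominated D f g ->
  mu.-integrable D (EFin \o (fun t => rin (f t) h)).
Proof.
move=> [mD ig fg mf]; apply: (integrable_le mD (mf h) (integrable_mull (rnorm h) mD ig)).
move=> t Dt; apply: le_trans (hf_le_norm hH _ _) _.
by rewrite mulrC ler_wpM2l ?rnorm_ge0// fg.
Qed.

Lemma wintE D f g : dominated D f g ->
  forall h, rin (wint D f) h = \int[mu]_(t in D) rin (f t) h.
Proof.
move=> dfg; have [mD ig fg mf] := dfg.
apply: (@xgetPex _ _ [set v | forall h, rin v h = \int[mu]_(t in D) rin (f t) h]).
apply: (riesz hH (C := \int[mu]_(t in D) g t)).
- move=> x y; rewrite -RintegralD//; try exact: dominated_integrable dfg.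
  by apply: eq_Rintegral => t _; rewrite (hfDr hH).
- move=> a x; rewrite -RintegralZl//; try exact: dominated_integrable dfg.
  by apply: eq_Rintegral => t _; rewrite (hfZr hH).
- move=> x; rewrite -RintegralZr//.
  apply: Rintegral_norm_le => //.
    have := integrable_mull (rnorm x) mD ig.
    by congr (integrable _ _ _); apply/funext => t /=; rewrite mulrC.
  move=> t Dt; apply: le_trans (hf_le_norm hH _ _) _.
  by rewrite ler_wpM2r ?rnorm_ge0// fg.
Qed.

Lemma wint_unique D f g v : dominated D f g ->
  (forall h, rin v h = \int[mu]_(t in D) rin (f t) h) -> wint D f = v.
Proof. by move=> dfg hv; apply: (hf_eq hH) => h; rewrite hv (wintE dfg). Qed.

(** Pairing the integral [v] with itself bounds [|v|^2] by [|v|] times the integral of [g]. *)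
Lemma wint_norm D f g : dominated D f g -> rnorm (wint D f) <= \int[mu]_(t in D) g t.
Proof.
move=> dfg; have [mD ig fg mf] := dfg.
set v := wint D f.
have h : rnorm v ^+ 2 <= \int[mu]_(t in D) g t * rnorm v.
  rewrite -(hf_norm hH) (wintE dfg) -RintegralZr//.
  apply: le_trans (ler_norm _) _; apply: Rintegral_norm_le => //.
    have := integrable_mull (rnorm v) mD ig.
    by congr (integrable _ _ _); apply/funext => t /=; rewrite mulrC.
  move=> t Dt; apply: le_trans (hf_le_norm hH _ _) _.
  by rewrite ler_wpM2r ?rnorm_ge0// fg.
have [->|v0] := eqVneq (rnorm v) 0.
  apply: Rintegral_ge0 => t Dt; exact: le_trans (rnorm_ge0 _) (fg _ Dt).
by move: h; rewrite expr2 ler_pM2r// lt_def v0 rnorm_ge0.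
Qed.

Lemma eq_wint D f1 f2 : (forall t, D t -> f1 t = f2 t) -> wint D f1 = wint D f2.
Proof.
move=> f12; rewrite /wint; congr xget; apply/funext => v; apply/propext.
by split=> hv h; rewrite hv; apply: eq_Rintegral => t /set_mem/f12 ->.
Qed.

Lemma ae_eq_wint D f1 f2 g1 g2 : dominated D f1 g1 -> dominated D f2 g2 ->
  f1 = f2 %[ae mu in D] -> wint D f1 = wint D f2.
Proof.
move=> d1 d2 f12; apply: (wint_unique d1) => h; rewrite (wintE d2).
have [mD _ _ m1] := d1; have [_ _ _ m2] := d2.
by apply: Rintegral_ae_eq => //; apply: filterS f12 => t e Dt; rewrite e.
Qed.

Lemma dominatedD D f1 f2 g1 g2 : dominated D f1 g1 -> dominated D f2 g2 ->
  dominated D (fun t => f1 t + f2 t) (fun t => g1 t + g2 t).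
Proof.
move=> [mD i1 h1 m1] [_ i2 h2 m2]; split => //.
- exact: integrable_addr.
- by move=> t Dt; apply: le_trans (rnormD _ _) _; rewrite lerD ?h1 ?h2.
- move=> h; have -> : (fun t => rin (f1 t + f2 t) h) = (fun t => rin (f1 t) h + rin (f2 t) h).
    by apply/funext => t; rewrite (hfD hH).
  exact: measurable_funD.
Qed.

Lemma wintD D f1 f2 g1 g2 : dominated D f1 g1 -> dominated D f2 g2 ->
  wint D (fun t => f1 t + f2 t) = wint D f1 + wint D f2.
Proof.
move=> d1 d2; apply: wint_unique (dominatedD d1 d2) _ => h.
rewrite (hfD hH) (wintE d1) (wintE d2) -RintegralD; first last.
- exact: dominated_integrable d2.
- exact: dominated_integrable d1.
- by case: d1.
by apply: eq_Rintegral => t _; rewrite (hfD hH).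
Qed.

Lemma dominated_op D f g (W : H -> H) (C : R) : linear W ->
  (forall x, rnorm (W x) <= C * rnorm x) -> 0 <= C ->
  dominated D f g -> dominated D (fun t => W (f t)) (fun t => C * g t).
Proof.
move=> Wlin WC C0 [mD ig fg mf]; split => //.
- exact: integrable_mull.
- by move=> t Dt; apply: le_trans (WC _) _; rewrite ler_wpM2l// fg.
- move=> h; have [||h' hh'] := riesz_adjoint hH _ _ WC h.
  + exact: linear_add.
  + by move=> a x; exact: linear_scale.
  have -> : (fun t => rin (W (f t)) h) = (fun t => rin (f t) h') by apply/funext => t.
  exact: mf.
Qed.

Lemma wint_op D f g (W : H -> H) (C : R) : linear W ->
  (forall x, rnorm (W x) <= C * rnorm x) -> 0 <= C ->
  dominated D f g -> W (wint D f) = wint D (fun t => W (f t)).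
Proof.
move=> Wlin WC C0 dfg; apply/esym/(wint_unique (dominated_op Wlin WC C0 dfg)) => h.
have [||h' hh'] := riesz_adjoint hH _ _ WC h.
+ exact: linear_add.
+ by move=> a x; exact: linear_scale.
by rewrite hh' (wintE dfg); apply: eq_Rintegral => t _; rewrite hh'.
Qed.

(** [rin] is only real-linear, so multiplication by a complex [a] is treated as a bounded
    operator. *)
Lemma wintZ D f g (a : R[i]) : dominated D f g ->
  wint D (fun t => a *: f t) = a *: wint D f.
Proof.
move=> dfg; apply/esym; apply: (wint_op _ _ _ dfg (C := complex.Re `|a|)).
- by move=> b x y; rewrite scalerDr !scalerA mulrC.
- by move=> x; rewrite rnormZ.
- by rewrite normc_def/= sqrtr_ge0.
Qed.

Lemma dominatedS D E f g : measurable D -> D `<=` E -> dominated E f g -> dominated D f g.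
Proof.
move=> mD DE [mE ig fg mf]; split => //.
- exact: integrableS DE ig.
- by move=> t /DE; exact: fg.
- by move=> h; exact: measurable_funS (mf h).
Qed.

Lemma dominated_itv (a b c d : R) f g : a <= c -> d <= b ->
  dominated `[a, b] f g -> dominated `[c, d] f g.
Proof. by move=> ac db; apply: dominatedS => //; apply: subset_itv; rewrite bnd_simp. Qed.

Lemma wint_itv_cat (a b c : R) f g : a <= b -> b <= c -> dominated `[a, c] f g ->
  wint `[a, c] f = wint `[a, b] f + wint `[b, c] f.
Proof.
move=> ab bc dfg; apply: (wint_unique dfg) => h.
rewrite (hfD hH) (wintE (dominated_itv _ _ dfg))// (wintE (dominated_itv _ _ dfg))//.
by rewrite -Rintegral_itv_cat//; exact: dominated_integrable dfg.
Qed.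

Lemma wint_cst (a b : R) (x : H) : a <= b -> wint `[a, b] (fun=> x) = (b - a)%:C *: x.
Proof.
move=> ab; apply: (@wint_unique _ _ (fun=> rnorm x)).
  split => //; first by apply: integrable_cstr => //; exact: lebesgue_itvcc_fin.
by move=> h; rewrite Rintegral_itv_cst// (hfZ hH) mulrC.
Qed.

End weak_integral.

Lemma strongly_measurableB d {T : measurableType d} {R : realType}
    {V : normedModType R[i]} (D : set T) (f g : T -> V) : strongly_measurable D f ->
  strongly_measurable D g -> strongly_measurable D (fun t => f t - g t).
Proof.
move=> mf mg; have := strongly_measurableD mf (strongly_measurableZ (-1) mg).
congr (strongly_measurable _ _); apply/funext => t /=.
by rewrite -[((-1) *: g) t]/((-1) *: g t) scaleN1r.
Qed.

Lemma simple_fun_if d {T : measurableType d} {R : realType} {V : normedModType R[i]}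
    (E : set T) (s : T -> V) :
  measurable E -> simple_fun s -> simple_fun (fun t => if t \in E then s t else 0).
Proof.
move=> mE [fs ms].
apply: (@simple_fun_comp _ _ _ _ (bool * V)%type (fun t => (t \in E, s t))
  (fun p => if p.1 then p.2 else 0)).
  apply: sub_finite_set (finite_setX (@finite_finset _ [set: bool]) fs) => _ [t _ <-].
  by split => //; exists t.
move=> [b w].
rewrite (_ : _ @^-1` _ = (fun t => t \in E) @^-1` [set b] `&` s @^-1` [set w]).
  apply: measurableI => //; case: b.
    rewrite (_ : _ @^-1` _ = E) //; apply/seteqP; split => t /=; first exact: set_mem.
    exact: mem_set.
  rewrite (_ : _ @^-1` _ = ~` E); first exact: measurableC.
  by apply/seteqP; split => t /=; [move/negbT; rewrite notin_setE|move=> h; rewrite memNset].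
by apply/seteqP; split => t /=; [case=> -> ->|case=> -> ->].
Qed.

Lemma simple_fun_bounded d {T : measurableType d} {R : realType} {V : normedModType R[i]}
    (s : T -> V) : simple_fun s ->
  exists c, forall t, rnorm (s t) <= c.
Proof.
move=> [fs _]; exists (\sum_(v <- fset_set (range s)) rnorm v) => t.
rewrite (bigD1_seq (s t)) ?fset_uniq//=; last by rewrite in_fset_set// mem_set//; exists t.
by rewrite lerDl sumr_ge0// => v _; exact: rnorm_ge0.
Qed.

Section bochner_weak.
Context {R : realType} {H : hilbertType R}.
Local Notation mu := (@lebesgue_measure R).
Local Notation hH := (@hilbert_rin R H).
Implicit Types (D E : set (measurableTypeR R)) (f s : R -> H) (g : R -> R).

(** Polarization reduces the pairing to norms of strongly measurable functions. *)
Lemma strongly_measurable_rin D f1 f2 : measurable D ->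
  strongly_measurable D f1 -> strongly_measurable D f2 ->
  measurable_fun D (fun t => rin (f1 t) (f2 t)).
Proof.
move=> mD m1 m2.
have -> : (fun t => rin (f1 t) (f2 t)) =
    (fun t => 4^-1 * (rnorm (f1 t + f2 t) ^+ 2 - rnorm (f1 t + (- 1) *: f2 t) ^+ 2)).
  by apply/funext => t; rewrite scaleN1r (hf_normD hH) (hf_normB hH); field.
apply: measurable_funM; first exact: measurable_cst.
apply: measurable_funB; apply: measurable_funX.
- exact: (strongly_measurable_rnorm mD (strongly_measurableD m1 m2)).
- exact: (strongly_measurable_rnorm mD (strongly_measurableD m1 (strongly_measurableZ (-1) m2))).
Qed.

Lemma strongly_measurable_cst D (x : H) : strongly_measurable D (fun=> x).
Proof. by exists (fun=> cst x); split => [n|t _]; [exact: simple_fun_cst|exact: cvg_cst]. Qed.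

Lemma strongly_measurable_dominated D f g : measurable D -> strongly_measurable D f ->
  mu.-integrable D (EFin \o g) -> (forall t, D t -> rnorm (f t) <= g t) -> dominated D f g.
Proof.
move=> mD sf gi fg; split => // h.
by apply: strongly_measurable_rin => //; exact: strongly_measurable_cst.
Qed.

Lemma simple_fun_strongly_measurable D s : simple_fun (s : measurableTypeR R -> H) ->
  strongly_measurable D s.
Proof. by move=> ss; exists (fun=> s); split => // t _; exact: cvg_cst. Qed.

Lemma simple_fun_dominated D s : measurable D -> (mu D < +oo)%E ->
  simple_fun (s : measurableTypeR R -> H) ->
  dominated D s (fun t => rnorm (s t)).
Proof.
move=> mD Doo ss; have [c hc] := simple_fun_bounded ss.
apply: strongly_measurable_dominated => //; first exact: simple_fun_strongly_measurable.
apply: (@integrable_le _ _ _ (fun=> c)) => //; last 1 first.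
- by move=> t _; rewrite ger0_norm ?rnorm_ge0.
- exact: (simple_fun_rnorm (D := D) ss).
- exact: integrable_cstr.
Qed.

Lemma Rintegral_sum D (I : Type) (r : seq I) (F : I -> R -> R) : measurable D ->
  (forall i, mu.-integrable D (EFin \o F i)) ->
  \int[mu]_(t in D) (\sum_(i <- r) F i t) = \sum_(i <- r) \int[mu]_(t in D) F i t.
Proof.
move=> mD iF.
suff : mu.-integrable D (EFin \o (fun t => \sum_(i <- r) F i t)) /\
  \int[mu]_(t in D) (\sum_(i <- r) F i t) = \sum_(i <- r) \int[mu]_(t in D) F i t by case.
elim: r => [|i r [IH1 IH2]].
  rewrite big_nil.
  have -> : (fun t : R => \sum_(i <- [::]) F i t) = (fun=> 0) by apply/funext => t; rewrite big_nil.
  by split; [exact: integrable0|rewrite Rintegral_cst// mul0r].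
have -> : (fun t => \sum_(j <- i :: r) F j t) = (fun t => F i t + \sum_(j <- r) F j t).
  by apply/funext => t; rewrite big_cons.
by split; [exact: integrable_addr|rewrite RintegralD// IH2 big_cons].
Qed.

Lemma simple_integral_wint D s : measurable D -> (mu D < +oo)%E ->
  simple_fun (s : measurableTypeR R -> H) -> simple_integral mu D s = wint D s.
Proof.
move=> mD Doo ss; have [fs ms] := ss.
apply/esym; apply: (wint_unique (simple_fun_dominated mD Doo ss)) => h.
rewrite /simple_integral fsbig_finite//=.
rewrite (big_morph (rin^~ h) (fun x y => hfD hH x y h) (hf0 hH h)).
have -> : (\int[mu]_(t in D) rin (s t) h) =
   \int[mu]_(t in D) \sum_(v <- fset_set (range s)) \1_(s @^-1` [set v]) t * rin v h.
  apply: eq_Rintegral => t _; rewrite (bigD1_seq (s t)) ?fset_uniq//=; last first.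
    by rewrite in_fset_set// mem_set//; exists t.
  rewrite indicE mem_set// mul1r big1 ?addr0// => v vs.
  by rewrite indicE memNset ?mul0r//= => e; rewrite e eqxx in vs.
have iE v : mu.-integrable D (EFin \o \1_(s @^-1` [set v])).
  apply: (@integrable_le _ _ _ (fun=> 1)) => //.
  - exact: integrable_cstr.
  - by move=> t _; rewrite indicE; case: (_ \in _); rewrite /= ?normr0 ?normr1.
rewrite Rintegral_sum//; last first.
  move=> v; have := integrable_mull (rin v h) mD (iE v).
  by congr (integrable _ _ _); apply/funext => t /=; rewrite mulrC.
apply: eq_bigr => v _; rewrite (hfZ hH) RintegralZr//; congr (_ * _).
rewrite /Rintegral/= integral_indic//.
by rewrite setIC.
Qed.

(** Integrals of simple functions are weak integrals, and [wint_norm] bounds their distance to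
    [wint D f] by the [L^1] distance to [f]. Every Bochner integral is therefore the weak one. *)
Lemma is_bochner_wint D f g v : (mu D < +oo)%E -> dominated D f g ->
  is_bochner mu D f v -> v = wint D f.
Proof.
move=> Doo dfg [sf [s [ss _ cvs cvv]]]; have [mD _ _ _] := dfg.
have h1 n : rnorm (simple_integral mu D (s n) - wint D f) <=
    \int[mu]_(t in D) rnorm (f t - s n t).
  have ds := simple_fun_dominated mD Doo (ss n).
  have dm : mu.-integrable D (EFin \o (fun t => rnorm (f t - s n t))).
    apply: (@integrable_le _ _ _ (fun t => g t + rnorm (s n t))) => //.
    - apply: (strongly_measurable_rnorm mD).
      by apply: strongly_measurableB => //; exact: simple_fun_strongly_measurable.
    - by apply: integrable_addr => //; [case: dfg|case: ds].
    - move=> t Dt; rewrite ger0_norm ?rnorm_ge0//; apply: le_trans (rnormB_le _ _) _.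
      by rewrite lerD2r; case: dfg => _ _ ->.
  rewrite simple_integral_wint// rnormBC.
  have dd : dominated D (fun t => f t - s n t) (fun t => rnorm (f t - s n t)).
    split => // h; have [_ _ _ m1] := dfg; have [_ _ _ m2] := ds.
    have -> : (fun t => rin (f t - s n t) h) = (fun t => rin (f t) h - rin (s n t) h).
      by apply/funext => t; rewrite (hfB hH).
    exact: measurable_funB.
  rewrite -(_ : wint D (fun t => f t - s n t) = wint D f - wint D (s n)); first exact: wint_norm.
  apply: (wint_unique dd) => h; rewrite (hfB hH) (wintE dfg) (wintE ds) -RintegralB//.
  - by apply: eq_Rintegral => t _; rewrite (hfB hH).
  - exact: (dominated_integrable h dfg).
  - exact: (dominated_integrable h ds).
have h2 : \int[mu]_(t in D) rnorm (f t - s n t) @[n --> \oo] --> (0 : R).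
  exact: fine_cvg cvs.
have h3 : rnorm (simple_integral mu D (s n) - wint D f) @[n --> \oo] --> (0 : R).
  by apply: cvgR0_le h2; apply: nearW => n; rewrite ger0_norm ?rnorm_ge0.
have h4 : rnorm (simple_integral mu D (s n) - v) @[n --> \oo] --> (0 : R).
  exact/cvg_rnormP.
by apply: (hf_cvg_unique hH) h4 h3.
Qed.

Lemma bochner_exists D f g : (mu D < +oo)%E -> strongly_measurable D f -> dominated D f g ->
  is_bochner mu D f (wint D f).
Proof.
move=> Doo sf dfg; split=> //; have [s [ss cs]] := sf; have [mD ig fg _] := dfg.
(* Truncation by zero where [|s n|] exceeds [2 |f|]: the errors are then dominated by [3 g], and
   convergence is kept because [|s n| <= 2 |f|] eventually wherever [f] does not vanish. *)
pose E n := D `&` [set t | rnorm (s n t) <= 2 * rnorm (f t)].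
have mf := strongly_measurable_rnorm mD sf.
have mE n : measurable (E n).
  apply: measurable_fun_le => //; first exact: (simple_fun_rnorm (D := D) (ss n)).
  by apply: measurable_funM => //; exact: measurable_cst.
pose s' n t := if t \in E n then s n t else 0.
have ss' n : simple_fun (s' n : measurableTypeR R -> H) by exact: simple_fun_if (mE n) (ss n).
have ms' n : measurable_fun D (fun t => rnorm (f t - s' n t)).
  apply: (strongly_measurable_rnorm mD).
  by apply: strongly_measurableB => //; exact: simple_fun_strongly_measurable.
have s'f n t : D t -> rnorm (f t - s' n t) <= 3 * g t.
  move=> Dt; have := fg _ Dt; rewrite /s'; case: ifPn => [/set_mem[_ /= h]|_].
    by move=> h1; apply: le_trans (rnormB_le _ _) _; lra.
  by rewrite subr0; have := rnorm_ge0 (f t); lra.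
have cs' t : D t -> rnorm (f t - s' n t) @[n --> \oo] --> (0 : R).
  move=> Dt; have /cvg_rnormP cst := cs _ Dt.
  have [f0|f0] := eqVneq (rnorm (f t)) 0.
    apply: (cvgR0_le _ cst); apply: nearW => n.
    rewrite (rnorm_eq0 f0) sub0r rnormN subr0 ger0_norm ?rnorm_ge0// /s'.
    by case: ifP => // _; rewrite rnorm0 rnorm_ge0.
  have fp : 0 < rnorm (f t) by rewrite lt_def f0 rnorm_ge0.
  apply: (cvgR0_le _ cst); have /cvgrPdist_lt/(_ _ fp) := cst.
  apply: filterS => n; rewrite sub0r normrN ger0_norm ?rnorm_ge0// => h.
  have tE : t \in E n.
    apply: mem_set; split => //=; have := rnorm_trans (f t) (s n t) 0.
    by rewrite !subr0 => h'; apply: le_trans h' _; rewrite mulrDl mul1r lerD2r ltW.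
  by rewrite ger0_norm ?rnorm_ge0// /s' tE rnormBC.
have := @dominated_convergence _ _ R mu D mD (fun n t => (rnorm (f t - s' n t))%:E)
   (cst 0%E) (EFin \o (fun t => 3 * g t)).
case.
- by move=> n; exact/measurable_EFinP.
- exact: measurable_cst.
- by apply: aeW => t Dt; apply: cvg_EFin; [exact: nearW|exact: cs'].
- exact: integrable_mull.
- apply: aeW => t n Dt; rewrite lee_fin ger0_norm ?rnorm_ge0//; exact: s'f.
move=> _ _ h3; rewrite integral0 in h3.
exists s'; split => //.
- move=> n w _; apply: le_lt_trans Doo; apply: le_measure; rewrite ?inE//.
  by apply: measurableI => //; have [_] := ss' n; exact.
- apply/cvg_rnormP.
  have hn n : simple_integral mu D (s' n) = wint D (s' n) by exact: simple_integral_wint.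
  have ds n := simple_fun_dominated mD Doo (ss' n).
  have h2 : \int[mu]_(t in D) rnorm (f t - s' n t) @[n --> \oo] --> (0 : R).
    exact: fine_cvg h3.
  apply: (cvgR0_le _ h2); apply: nearW => n; rewrite ger0_norm ?rnorm_ge0// hn rnormBC.
  have dm : mu.-integrable D (EFin \o (fun t => rnorm (f t - s' n t))).
    apply: (@integrable_le _ _ _ (fun t => 3 * g t)) => //; first exact: integrable_mull.
    by move=> t Dt; rewrite ger0_norm ?rnorm_ge0// s'f.
  have dd : dominated D (fun t => f t - s' n t) (fun t => rnorm (f t - s' n t)).
    split => // h; have [_ _ _ m1] := dfg; have [_ _ _ m2] := ds n.
    have -> : (fun t => rin (f t - s' n t) h) = (fun t => rin (f t) h - rin (s' n t) h).
      by apply/funext => t; rewrite (hfB hH).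
    exact: measurable_funB.
  rewrite -(_ : wint D (fun t => f t - s' n t) = wint D f - wint D (s' n)); first exact: wint_norm.
  apply: (wint_unique dd) => h; rewrite (hfB hH) (wintE dfg) (wintE (ds n)) -RintegralB//.
  - by apply: eq_Rintegral => t _; rewrite (hfB hH).
  - exact: (dominated_integrable h dfg).
  - exact: (dominated_integrable h (ds n)).
Qed.

Lemma bochner_wint D f g : (mu D < +oo)%E -> strongly_measurable D f -> dominated D f g ->
  bochner mu D f = wint D f.
Proof.
move=> Doo sf dfg; apply: (is_bochner_wint Doo dfg).
by apply: xgetPex; exists (wint D f); exact: bochner_exists sf dfg.
Qed.

End bochner_weak.

(** * Contraction semigroups and their regularizers *)

Section discretization.
Context {R : realType}.
Local Notation mu := (@lebesgue_measure R).

(** The cap makes the range finite; for [0 <= r <= n + 1] it has no effect. *)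
Definition disc_index (n : nat) (r : R) : nat :=
  minn (Num.truncn (n.+1%:R * r)) (n.+1 ^ 2)%N.

Definition disc (n : nat) (r : R) : R := (disc_index n r)%:R / n.+1%:R.

Lemma disc_ge0 n r : 0 <= disc n r.
Proof. by rewrite divr_ge0. Qed.

Lemma disc_le n r : 0 <= r -> disc n r <= r.
Proof.
move=> r0; rewrite ler_pdivrMr// mulrC.
apply: (@le_trans _ _ (Num.truncn (n.+1%:R * r))%:R); first by rewrite ler_nat geq_minl.
by rewrite truncn_le mulr_ge0.
Qed.

Lemma disc_dist n r : 0 <= r <= n.+1%:R -> r - disc n r <= n.+1%:R^-1.
Proof.
move=> /andP[r0 rn]; have nr0 : 0 <= n.+1%:R * r by rewrite mulr_ge0.
rewrite /disc /disc_index (minn_idPl _); last first.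
  rewrite -(ler_nat R); apply: (@le_trans _ _ (n.+1%:R * r)); first by rewrite truncn_le.
  by rewrite natrX expr2 ler_wpM2l.
have /andP[_ h] := truncn_itv nr0.
by rewrite lerBlDr -[X in X + _]mul1r -mulrDl ler_pdivlMr// mulrC addrC natr1 ltW.
Qed.

Lemma disc_index_range n (phi : R -> R) : finite_set (range (fun t => disc_index n (phi t))).
Proof.
apply: (sub_finite_set _ (finite_II (n.+1 ^ 2).+1)) => _ [t _ <-] /=.
by rewrite ltnS geq_minr.
Qed.

Lemma measurable_disc_index n (phi : R -> R) k :
  measurable_fun [set: measurableTypeR R] phi ->
  measurable ((fun t : measurableTypeR R => disc_index n (phi t)) @^-1` [set k]).
Proof.
move=> mphi.
(* A fiber is the difference of consecutive superlevel sets, the whole line coming first; each [B j]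
   is the preimage of a half-line or empty. *)
pose B j := [set t : measurableTypeR R | (j < disc_index n (phi t))%N].
have mB j : measurable (B j).
  have [jN|jN] := ltnP j (n.+1 ^ 2)%N.
    rewrite (_ : B j = phi @^-1` `[j.+1%:R / n.+1%:R, +oo[).
      by rewrite -[X in measurable X]setTI; exact: mphi.
    apply/seteqP; split => t; rewrite /B /= /disc_index leq_min jN andbT truncn_gt_nat;
      by rewrite in_itv/= andbT ler_pdivrMr// mulrC.
  rewrite (_ : B j = set0) //; apply/seteqP; split => t //=.
  by rewrite /B/= /disc_index leq_min [(j < _ ^ 2)%N]ltnNge jN andbF.
rewrite (_ : _ @^-1` _ = (if k is j.+1 then B j else setT) `\` B k).
  by apply: measurableD => //; case: k => // j; exact: mB.
apply/seteqP; split => t; rewrite /B/=.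
  by case: k => [|j] /= e; split; rewrite ?e ?ltnn ?ltnSn.
by case: k => [|j] /= [h1 /negP h2]; apply/eqP; rewrite eqn_leq leqNgt h2.
Qed.

Lemma cvg_disc (r : R) : 0 <= r -> disc n r @[n --> \oo] --> r.
Proof.
move=> r0; have := @cvg_harmonic R; move=> /cvgrPdist_lt h.
apply/cvgrPdist_lt => e /h [N _ hN].
exists (maxn N (Num.truncn r).+1) => // n /=; rewrite geq_max => /andP[Nn rn].
have := hN n Nn; rewrite sub0r normrN /harmonic/= ger0_norm ?invr_ge0//.
apply: le_lt_trans; rewrite ger0_norm ?subr_ge0 ?disc_le//.
apply: disc_dist; rewrite r0/=; apply: ltW; rewrite -truncn_lt_nat//.
by rewrite ltnS (leq_trans _ rn).
Qed.

(** [F] can be arbitrary because both of its arguments take finitely many values. *)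
Lemma simple_fun_disc {V : normedModType R[i]} n (phi : R -> R) (F : R -> V -> V) (s : R -> V) :
  measurable_fun [set: measurableTypeR R] phi -> simple_fun (s : measurableTypeR R -> V) ->
  simple_fun (fun t : measurableTypeR R => F (disc n (phi t)) (s t)).
Proof.
move=> mphi [fs ms].
apply: (@simple_fun_comp _ _ _ _ (nat * V)%type (fun t => (disc_index n (phi t), s t))
  (fun p => F (p.1%:R / n.+1%:R) p.2)).
  apply: sub_finite_set (finite_setX (disc_index_range n phi) fs) => _ [t _ <-].
  by split; exists t.
move=> [k w]; rewrite (_ : _ @^-1` _ =
   (fun t : measurableTypeR R => disc_index n (phi t)) @^-1` [set k] `&` s @^-1` [set w]).
  by apply: measurableI; [exact: measurable_disc_index|exact: ms].
by apply/seteqP; split => t /=; [case=> -> ->|case=> -> ->].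
Qed.

Lemma Rintegral_shift (G : R -> R) (a b c : R) : a <= b -> continuous G ->
  \int[mu]_(t in `[a + c, b + c]) G t = \int[mu]_(t in `[a, b]) G (t + c).
Proof.
move=> ab cG; rewrite /Rintegral; congr fine.
have dF t : is_derive (t : R) 1 (fun x => x + c) 1.
  by rewrite -[X in is_derive _ _ _ X]addr0; apply: is_deriveD.
have F1 : (fun x : R => x + c)^`()%classic = cst 1.
  by apply/funext => t; rewrite derive1E; apply: derive_val.
have := @integration_by_substitution_increasing R (fun t => t + c) G a b ab.
rewrite F1 => -> //.
- by apply: eq_integral => t _; rewrite /= mulr1.
- by move=> x y _ _; rewrite ltrD2r.
- by move=> x _; exact: cst_continuous.
- exact: is_cvg_cst.
- exact: is_cvg_cst.
- split.
  + by move=> t _; have [] := dF t.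
  + by apply: cvg_at_right_filter; apply: cvgD; [exact: cvg_id|exact: cvg_cst].
  + by apply: cvg_at_left_filter; apply: cvgD; [exact: cvg_id|exact: cvg_cst].
- exact: continuous_subspaceT.
Qed.

End discretization.

Lemma subr_swap {V : zmodType} (a b c d : V) : (a - b) - (c - d) = (a - c) - (b - d).
Proof. by rewrite !opprB addrACA [RHS]addrACA [- b - c]addrC. Qed.

Section contraction_semigroup.
Context {R : realType} {H : hilbertType R} {S : R -> H -> H}.
Hypothesis cS : contraction_semigroup S.
Local Notation mu := (@lebesgue_measure R).
Local Notation hH := (@hilbert_rin R H).
Implicit Types (x y : H) (s t h : R).

Lemma sg_linear t : 0 <= t -> linear (S t).
Proof. by move=> t0; have [h _ _ _ _] := cS; exact: h. Qed.

Lemma sg0 x : S 0 x = x.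
Proof. by have [_ h _ _ _] := cS; exact: h. Qed.

Lemma sgD s t x : 0 <= s -> 0 <= t -> S (s + t) x = S s (S t x).
Proof. by move=> s0 t0; have [_ _ h _ _] := cS; exact: h. Qed.

Lemma sgC s t x : 0 <= s -> 0 <= t -> S s (S t x) = S t (S s x).
Proof. by move=> s0 t0; rewrite -!sgD// addrC. Qed.

Lemma sg_norm t x : 0 <= t -> rnorm (S t x) <= rnorm x.
Proof.
move=> t0; have [_ _ _ _ h] := cS.
by rewrite -lecR -!rnormE; exact: h.
Qed.

Lemma sg_norm1 t x : 0 <= t -> rnorm (S t x) <= 1 * rnorm x.
Proof. by move=> t0; rewrite mul1r; exact: sg_norm. Qed.

Lemma sgB t x y : 0 <= t -> S t (x - y) = S t x - S t y.
Proof. by move=> t0; exact: (linear_sub (sg_linear t0)). Qed.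

Lemma sgZ t (a : R[i]) x : 0 <= t -> S t (a *: x) = a *: S t x.
Proof. by move=> t0; exact: (linear_scale (sg_linear t0)). Qed.

Lemma sg_near0 x (e : R) : 0 < e ->
  exists2 d, 0 < d & forall t, 0 <= t < d -> rnorm (S t x - x) <= e.
Proof.
move=> e0; have [_ _ _ h _] := cS.
have /cvg_rnormP/cvgrPdist_lt/(_ _ e0) [d /= d0 hd] := h x.
exists d => // t /andP[]; rewrite le_eqVlt => /predU1P[<- _|t0 td].
  by rewrite sg0 subrr rnorm0 ltW.
have := hd t; rewrite /= sub0r normrN gtr0_norm// => /(_ td t0).
by rewrite sub0r normrN ger0_norm ?rnorm_ge0// => /ltW.
Qed.

Lemma sg_dist s t x : 0 <= s <= t -> rnorm (S t x - S s x) <= rnorm (S (t - s) x - x).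
Proof.
move=> /andP[s0 st]; have ts : 0 <= t - s by rewrite subr_ge0.
by rewrite -{1}(subrKC s t) (sgD _ s0 ts) -sgB//; exact: sg_norm.
Qed.

(** Contractivity spreads the continuity at 0 uniformly along the whole orbit. *)
Lemma sg_unif x (e : R) : 0 < e -> exists2 d, 0 < d &
  forall s t, 0 <= s -> 0 <= t -> `|s - t| < d -> rnorm (S t x - S s x) <= e.
Proof.
move=> /(sg_near0 x)[d d0 hd]; exists d => // s t s0 t0.
have [st|/ltW ts] := leP s t.
  rewrite ler0_norm ?subr_le0// opprB => h.
  by apply: le_trans (sg_dist _ _) _; [rewrite s0|rewrite hd// h subr_ge0 st].
rewrite ger0_norm ?subr_ge0// => h; rewrite rnormBC.
by apply: le_trans (sg_dist _ _) _; [rewrite t0|rewrite hd// h subr_ge0 ts].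
Qed.

Lemma max0_dist (s t : R) : `|Num.max 0 s - Num.max 0 t| <= `|s - t|.
Proof.
rewrite !maxEle; case: (leP 0 s); case: (leP 0 t) => // ht hs.
- by rewrite subr0 ger0_norm//; apply: le_trans (ler_norm _); lra.
- by rewrite sub0r normrN ger0_norm// distrC; apply: le_trans (ler_norm _); lra.
- by rewrite subrr normr0 normr_ge0.
Qed.

(** The orbit is frozen at negative times, where [S] is unspecified, because the translation formula
    [Rintegral_shift] asks for continuity on the whole line. *)
Lemma sg_continuous x y : continuous (fun t => rin (S (Num.max 0 t) x) y).
Proof.
move=> t0; apply/(hf_cvg hH)/cvgrPdist_le => e /(sg_unif x)[d d0 hd].
near=> t.
rewrite sub0r normrN ger0_norm ?rnorm_ge0//.
apply: hd; rewrite ?le_max ?lexx//.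
apply: le_lt_trans (max0_dist _ _) _.
by near: t; exact: cvgr_dist_lt.
Unshelve. all: by end_near. Qed.

(** The time is discretized along with the argument. [S] is a contraction at the grid times, which
    are nonnegative, so the limit follows from [s n t -> f t] and the continuity of orbits. *)
Lemma strongly_measurable_sg (D : set (measurableTypeR R)) (phi : R -> R) (f : R -> H) :
  measurable_fun [set: measurableTypeR R] phi -> (forall t, D t -> 0 <= phi t) ->
  strongly_measurable D f -> strongly_measurable D (fun t => S (phi t) (f t)).
Proof.
move=> mphi phi0 [s [ss sf]].
exists (fun n t => S (disc n (phi t)) (s n t)); split.
  by move=> n; exact: (simple_fun_disc n S mphi (ss n)).
move=> t Dt; have p0 := phi0 _ Dt; apply/cvg_rnormP.
have h1 : rnorm (s n t - f t) @[n --> \oo] --> (0 : R) by apply/cvg_rnormP; exact: sf.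
have h2 : rnorm (S (disc n (phi t)) (f t) - S (phi t) (f t)) @[n --> \oo] --> (0 : R).
  apply/cvgrPdist_le => e /(sg_unif (f t))[d d0 hd].
  have /cvgrPdist_lt/(_ _ d0) := cvg_disc p0.
  apply: filterS => n hn; rewrite sub0r normrN ger0_norm ?rnorm_ge0//.
  by apply: hd => //; exact: disc_ge0.
have h3 : rnorm (s n t - f t) + rnorm (S (disc n (phi t)) (f t) - S (phi t) (f t))
    @[n --> \oo] --> (0 : R).
  by rewrite -[X in _ --> X](addr0 (0 : R)); apply: cvgD.
apply: cvgR0_le h3; apply: nearW => n; rewrite ger0_norm ?rnorm_ge0//.
apply: le_trans (rnorm_trans (S (disc n (phi t)) (f t)) _ _) _.
by rewrite lerD2r -sgB ?disc_ge0//; apply: sg_norm; exact: disc_ge0.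
Qed.

Definition sg_int h x : H := wint `[0, h] (fun r => S r x).

Lemma sg_int_dominated (a b : R) x : 0 <= a ->
  dominated `[a, b] (fun r => S r x) (fun=> rnorm x).
Proof.
move=> a0; apply: strongly_measurable_dominated => //.
- apply: (@strongly_measurable_sg _ id (fun=> x)) => //.
    by move=> t /=; rewrite in_itv/= => /andP[at_ _]; exact: le_trans at_.
  exact: strongly_measurable_cst.
- by apply: integrable_cstr => //; exact: lebesgue_itvcc_fin.
- by move=> t /=; rewrite in_itv/= => /andP[at_ _]; apply: sg_norm; exact: le_trans at_.
Qed.

Lemma sg_int_norm h x : 0 <= h -> rnorm (sg_int h x) <= h * rnorm x.
Proof.
move=> h0; apply: le_trans (wint_norm (sg_int_dominated _ _ _)) _ => //.
by rewrite Rintegral_itv_cst// subr0 mulrC.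
Qed.

Lemma sg_int_linear h : linear (sg_int h).
Proof.
move=> a x y; rewrite /sg_int -(wintZ a (sg_int_dominated h x (lexx 0))).
have da : dominated `[0, h] (fun r => a *: S r x) (fun r => complex.Re `|a| * rnorm x).
  apply: (dominated_op (W := *:%R a) _ _ _ (sg_int_dominated h x (lexx 0))).
  - by move=> b u v; rewrite scalerDr !scalerA mulrC.
  - by move=> u; rewrite rnormZ.
  - by rewrite normc_def/= sqrtr_ge0.
rewrite -(wintD da (sg_int_dominated h y (lexx 0))).
apply: eq_wint => r /=; rewrite in_itv/= => /andP[r0 _].
exact: sg_linear.
Qed.

Lemma sg_int_sg h t x : 0 <= h -> 0 <= t -> S t (sg_int h x) = sg_int h (S t x).
Proof.
move=> h0 t0; rewrite /sg_int (wint_op (sg_linear t0) _ ler01 (sg_int_dominated h x (lexx 0))).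
  by apply: eq_wint => r /=; rewrite in_itv/= => /andP[r0 _]; exact: sgC.
by move=> y; exact: sg_norm1.
Qed.

Lemma sg_int_cat s h x : 0 <= s -> 0 <= h -> sg_int (s + h) x = sg_int s x + S s (sg_int h x).
Proof.
move=> s0 h0; rewrite {1}/sg_int (@wint_itv_cat _ _ _ s _ _ (fun=> rnorm x)) ?lerDl//.
  congr (_ + _).
  rewrite /sg_int (wint_op (sg_linear s0) _ ler01 (sg_int_dominated h x (lexx 0))); last first.
    by move=> y; exact: sg_norm1.
  apply: (wint_unique (sg_int_dominated _ _ s0)) => y.
  have d := dominated_op (sg_linear s0) (fun y => sg_norm1 y s0) ler01
    (sg_int_dominated h x (lexx 0)).
  rewrite (wintE d).
  transitivity (\int[mu]_(t in `[0 + s, h + s]) rin (S (Num.max 0 t) x) y).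
    rewrite Rintegral_shift//; last exact: sg_continuous.
    apply: eq_Rintegral => t /set_mem/=; rewrite in_itv/= => /andP[t0 _].
    by rewrite (max_idPr _) ?addr_ge0// addrC sgD.
  rewrite add0r addrC; apply: eq_Rintegral => t /set_mem/=; rewrite in_itv/= => /andP[st _].
  by rewrite (max_idPr _)// (le_trans s0).
exact: sg_int_dominated.
Qed.

(** Both sides equal the integral of the orbit over [[0, h + d]] less those over [[0, h]] and
    [[0, d]]. *)
Lemma sg_int_diff h d x : 0 <= h -> 0 <= d ->
  S d (sg_int h x) - sg_int h x = S h (sg_int d x) - sg_int d x.
Proof.
move=> h0 d0; have := sg_int_cat x h0 d0; rewrite addrC sg_int_cat// => e.
by apply/eqP; rewrite subr_eq addrAC [_ + sg_int h x]addrC -e addrC addKr.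
Qed.

Lemma sg_int_approx h x (e : R) : 0 <= h ->
  (forall r, 0 <= r <= h -> rnorm (S r x - x) <= e) ->
  rnorm (sg_int h x - h%:C *: x) <= h * e.
Proof.
move=> h0 he.
have dc : dominated `[0, h] (fun=> - x) (fun=> rnorm x).
  split => //.
  - by apply: integrable_cstr => //; exact: lebesgue_itvcc_fin.
  - by move=> t _; rewrite rnormN.
have d : dominated `[0, h] (fun r => S r x + - x) (fun=> e).
  have [m _ _ mf] := dominatedD (sg_int_dominated h x (lexx 0)) dc.
  split => //; first by apply: integrable_cstr => //; exact: lebesgue_itvcc_fin.
have := wint_norm d; rewrite (wintD (sg_int_dominated h x (lexx 0)) dc) wint_cst//.
by rewrite subr0 scalerN Rintegral_itv_cst// subr0 [e * h]mulrC.
Qed.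

(* Integrated form of [y = A x]; it needs no domain. *)
Definition gen_rel x y : Prop := forall h, 0 <= h -> S h x - x = sg_int h y.

Lemma gen_dist x y t : gen_rel x y -> 0 <= t -> rnorm (S t x - x) <= t * rnorm y.
Proof. by move=> xy t0; rewrite xy//; exact: sg_int_norm. Qed.

(** Second-order Taylor bound: the remainder is the integral over [[0, t]] of [S r y - y], whose
    norm is at most [r |z|]. *)
Lemma gen_dist2 x y z t : gen_rel x y -> gen_rel y z -> 0 <= t ->
  rnorm (S t x - x - t%:C *: y) <= t ^+ 2 * rnorm z.
Proof.
move=> xy yz t0; rewrite xy// expr2 -mulrA; apply: sg_int_approx => // r /andP[r0 rt].
by apply: le_trans (gen_dist yz r0) _; rewrite ler_wpM2r ?rnorm_ge0.
Qed.

Lemma sg_int_cvg x : rnorm (h^-1%:C *: sg_int h x - x) @[h --> 0^'+] --> (0 : R).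
Proof.
apply/cvgrPdist_le => e /(sg_near0 x)[d d0 hd].
near=> h.
have h0 : 0 < h by near: h; exact: nbhs_right_gt.
have hd' : h < d by near: h; exact: nbhs_right_lt.
rewrite sub0r normrN ger0_norm ?rnorm_ge0//.
have -> : h^-1%:C *: sg_int h x - x = h^-1%:C *: (sg_int h x - h%:C *: x).
  by rewrite scalerBr scalerA -rmorphM/= mulVf ?gt_eqF// scale1r.
rewrite rnormZr gtr0_norm ?invr_gt0// ler_pdivrMl//.
apply: sg_int_approx; first exact: ltW.
by move=> r /andP[r0 rh]; apply: hd; rewrite r0 (le_lt_trans rh).
Unshelve. all: by end_near. Qed.

Lemma gen_rel_cvg x y : gen_rel x y -> h^-1%:C *: (S h x - x) @[h --> 0^'+] --> y.
Proof.
move=> xy; apply/cvg_rnormP; apply: cvg_trans (sg_int_cvg y).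
apply: near_eq_cvg; near=> h.
have h0 : 0 < h by near: h; exact: nbhs_right_gt.
by rewrite xy// ltW.
Unshelve. all: by end_near. Qed.

(** For every [d > 0], by [sg_int_diff], [S t - 1] applied to the mean of the orbit over [[0, d]]
    equals [sg_int t] of the difference quotient at [d]. Letting [d] tend to 0 on both sides gives
    the integrated relation. *)
Lemma cvg_gen_rel x y : h^-1%:C *: (S h x - x) @[h --> 0^'+] --> y -> gen_rel x y.
Proof.
move=> /cvg_rnormP xy t t0; apply: (hf_eq hH) => w.
have c1 : rin (d^-1%:C *: (S t (sg_int d x) - sg_int d x)) w @[d --> 0^'+] --> rin (S t x - x) w.
  apply: (hf_cvg hH).
  have c2 : 2 * rnorm (h^-1%:C *: sg_int h x - x) @[h --> 0^'+] --> (0 : R).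
    by rewrite -[X in _ --> X](mulr0 2); apply: cvgM (sg_int_cvg x); exact: cvg_cst.
  apply: cvgR0_le c2; apply: nearW => d; rewrite ger0_norm ?rnorm_ge0//.
  rewrite scalerBr -sgZ// subr_swap -sgB//.
  by apply: le_trans (rnormB_le _ _) _; rewrite mulrDl mul1r lerD2r sg_norm.
have c3 : rin (sg_int t (d^-1%:C *: (S d x - x))) w @[d --> 0^'+] --> rin (sg_int t y) w.
  apply: (hf_cvg hH).
  have c2 : t * rnorm (h^-1%:C *: (S h x - x) - y) @[h --> 0^'+] --> (0 : R).
    by rewrite -[X in _ --> X](mulr0 t); apply: cvgM xy; exact: cvg_cst.
  apply: cvgR0_le c2; apply: nearW => d; rewrite ger0_norm ?rnorm_ge0//.
  by rewrite -(linear_sub (sg_int_linear t)) sg_int_norm.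
apply: cvgR_unique c1 _; apply: cvg_trans c3; apply: near_eq_cvg; near=> d.
have d0 : 0 <= d by apply: ltW; near: d; exact: nbhs_right_gt.
rewrite (linear_scale (sg_int_linear t)) (linear_sub (sg_int_linear t)).
by rewrite -sg_int_sg// sg_int_diff.
Unshelve. all: by end_near. Qed.

(** Closedness of the generator: only bounded operators occur in the integrated form, so both sides
    pass to the limit. *)
Lemma gen_rel_closed (u v : nat -> H) x y : (forall n, gen_rel (u n) (v n)) ->
  rnorm (u n - x) @[n --> \oo] --> (0 : R) -> rnorm (v n - y) @[n --> \oo] --> (0 : R) ->
  gen_rel x y.
Proof.
move=> uv ux vy t t0; apply: (hf_eq hH) => w.
have c1 : rin (S t (u n) - u n) w @[n --> \oo] --> rin (S t x - x) w.
  apply: (hf_cvg hH).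
  have c2 : 2 * rnorm (u n - x) @[n --> \oo] --> (0 : R).
    by rewrite -[X in _ --> X](mulr0 2); apply: cvgM ux; exact: cvg_cst.
  apply: cvgR0_le c2; apply: nearW => n; rewrite ger0_norm ?rnorm_ge0//.
  rewrite subr_swap -sgB//.
  by apply: le_trans (rnormB_le _ _) _; rewrite mulrDl mul1r lerD2r sg_norm.
have c3 : rin (sg_int t (v n)) w @[n --> \oo] --> rin (sg_int t y) w.
  apply: (hf_cvg hH).
  have c2 : t * rnorm (v n - y) @[n --> \oo] --> (0 : R).
    by rewrite -[X in _ --> X](mulr0 t); apply: cvgM vy; exact: cvg_cst.
  apply: cvgR0_le c2; apply: nearW => n; rewrite ger0_norm ?rnorm_ge0//.
  by rewrite -(linear_sub (sg_int_linear t)) sg_int_norm.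
apply: cvgR_unique c1 _.
by have -> : (fun n => rin (S t (u n) - u n) w) = (fun n => rin (sg_int t (v n)) w)
  by apply/funext => n; rewrite uv.
Qed.

Lemma gen_relB x1 y1 x2 y2 : gen_rel x1 y1 -> gen_rel x2 y2 -> gen_rel (x1 - x2) (y1 - y2).
Proof.
move=> h1 h2 t t0; rewrite (linear_sub (sg_int_linear t)) -h1// -h2// sgB//.
exact: subr_swap.
Qed.

(** By contractivity the pairing of [S h x] with [x] is at most [|x|^2], so the difference quotients
    already have the sign. *)
Lemma gen_rel_dissipative x y : gen_rel x y -> rin y x <= 0.
Proof.
move=> /gen_rel_cvg /cvg_rnormP xy.
have c : rin (h^-1%:C *: (S h x - x)) x @[h --> 0^'+] --> rin y x by exact: (hf_cvg hH).
apply: (cvgr_to_le c); near=> h.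
have h0 : 0 < h by near: h; exact: nbhs_right_gt.
rewrite (hfZ hH) pmulr_rle0 ?invr_gt0// (hfB hH) subr_le0 (hf_norm hH).
apply: le_trans (ler_norm _) _; apply: le_trans (hf_le_norm hH _ _) _.
by rewrite expr2 ler_wpM2r ?rnorm_ge0// sg_norm// ltW.
Unshelve. all: by end_near. Qed.

End contraction_semigroup.

(** Over [n + 1] equal pieces each error is at most [K] times the largest increment of [m] times the
    increment on the piece. The largest increment is of order [sqrt (T / (n + 1))], and the others
    add up to [m T - m 0]. Below, [e] is an energy defect and [m] the clock of a trajectory. *)
Lemma telescoping_eq {R : realType} (T K D : R) (e m : R -> R) :
  0 <= T -> 0 <= K -> 0 <= D ->
  (forall s t, 0 <= s -> s <= t -> t <= T -> 0 <= m t - m s <= D * Num.sqrt (t - s)) ->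
  (forall s t, 0 <= s -> s <= t -> t <= T -> `|e t - e s| <= K * (m t - m s) ^+ 2) ->
  e T = e 0.
Proof.
move=> T0 K0 D0 hm he.
have mT0 : 0 <= m T - m 0 by have /andP[] := hm 0 T (lexx _) T0 (lexx _).
have step n : `|e T - e 0| <= K * D * Num.sqrt (T / n.+1%:R) * (m T - m 0).
  pose p k := k%:R * (T / n.+1%:R).
  have dp k : p k.+1 - p k = T / n.+1%:R by rewrite /p -natr1; ring.
  have Tn : 0 <= T / n.+1%:R by rewrite divr_ge0.
  have p0 k : 0 <= p k by rewrite mulr_ge0.
  have pS k : p k <= p k.+1 by rewrite -subr_ge0 dp.
  have pn : p n.+1 = T by rewrite /p mulrC divfK.
  have pT k : (k <= n.+1)%N -> p k <= T.
    by move=> kn; rewrite -pn ler_wpM2r// ler_nat.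
  have ind k : (k <= n.+1)%N ->
      `|e (p k) - e 0| <= K * D * Num.sqrt (T / n.+1%:R) * (m (p k) - m 0).
    elim: k => [_|k IH kn]; first by rewrite /p mul0r !subrr normr0 mulr0.
    have hk := IH (ltnW kn).
    have := he _ _ (p0 k) (pS k) (pT _ kn).
    have /andP[m1 m2] := hm _ _ (p0 k) (pS k) (pT _ kn).
    rewrite dp in m2 => h.
    have h2 : K * (m (p k.+1) - m (p k)) ^+ 2 <=
        K * D * Num.sqrt (T / n.+1%:R) * (m (p k.+1) - m (p k)).
      by rewrite expr2 mulrA -!mulrA ler_wpM2l// !mulrA ler_wpM2r.
    rewrite -[e (p k.+1) - e 0](subrKA (e (p k))).
    apply: le_trans (ler_normD _ _) _; apply: le_trans (lerD (le_trans h h2) hk) _.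
    by rewrite -mulrDr subrKA.
  by have := ind n.+1 (leqnn _); rewrite pn.
(* Squaring replaces the root by [T / (n + 1)], a multiple of the harmonic sequence. *)
apply/eqP; rewrite -subr_eq0 -normr_eq0 -sqrf_eq0 eq_le sqr_ge0 andbT.
have cv : (K * D * (m T - m 0)) ^+ 2 * T * n.+1%:R^-1 @[n --> \oo] --> (0 : R).
  rewrite -[X in _ --> X](mulr0 ((K * D * (m T - m 0)) ^+ 2 * T)).
  by apply: cvgM; [exact: cvg_cst|exact: (@cvg_harmonic R)].
apply: (cvgr_to_ge cv); apply: nearW => n.
rewrite -mulrA -[T / _]sqr_sqrtr ?divr_ge0// -exprMn lerXn2r// ?nnegrE ?mulr_ge0 ?sqrtr_ge0//.
by apply: le_trans (step n) _; rewrite mulrAC.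
Qed.

(** * Uniform approximation by simple functions on bounded intervals *)

Section locally_uniform_simple.
Context {R : realType} {V : normedModType R[i]}.
Implicit Types (f : R -> V).

(** Uniformity allows a diagonal choice: a pointwise limit of such functions is a limit of simple
    functions, one for each index ([simple_approx_cvg]). *)
Definition simple_approx f : Prop := forall (T e : R), 0 < e ->
  exists s : R -> V, simple_fun (s : measurableTypeR R -> V) /\
    forall t, 0 <= t -> t <= T -> rnorm (f t - s t) <= e.

Lemma holder_simple_approx f :
  (forall T : R, 0 <= T -> exists2 D : R, 0 <= D & forall s t : R, 0 <= s -> s <= t -> t <= T ->
     rnorm (f t - f s) <= D * Num.sqrt (t - s)) -> simple_approx f.
Proof.
move=> hf T e e0; have [T0|T0] := leP 0 T; last first.
  exists (cst 0); split; first exact: simple_fun_cst.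
  by move=> t t0 tT; have := le_lt_trans t0 (le_lt_trans tT T0); rewrite ltxx.
have [D D0 hD] := hf T T0.
have D1 : 0 < D + 1 by rewrite ltr_wpDl.
have e1 : 0 < (e / (D + 1)) ^+ 2 by rewrite exprn_gt0// divr_gt0.
have /cvgrPdist_lt/(_ _ e1)[N _ hN] := @cvg_harmonic R.
(* The grid has to be fine enough, and its cap has to lie beyond [T]. *)
pose n := maxn N (Num.truncn T).
exists (fun t => f (disc n t)); split.
  have := simple_fun_disc n (fun r (_ : V) => f r) (@measurable_id _ (measurableTypeR R) setT)
    (@simple_fun_cst _ (measurableTypeR R) R V 0).
  by [].
move=> t t0 tT; apply: le_trans (hD _ _ (disc_ge0 _ _) (disc_le _ t0) tT) _.
have hn : t - disc n t <= (e / (D + 1)) ^+ 2.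
  apply: (@le_trans _ _ n.+1%:R^-1).
    apply: disc_dist; rewrite t0/=; apply: le_trans tT _; apply/ltW.
    by rewrite -truncn_lt_nat// ltnS leq_maxr.
  have := hN n (leq_maxl _ _); rewrite sub0r normrN /harmonic/= ger0_norm ?invr_ge0//.
  exact: ltW.
apply: (@le_trans _ _ (D * (e / (D + 1)))).
  rewrite ler_wpM2l// -(@ler_pXn2r _ 2) ?nnegrE ?sqrtr_ge0 ?divr_ge0 ?(ltW e0) ?(ltW D1)//.
  by rewrite sqr_sqrtr ?subr_ge0 ?disc_le.
rewrite mulrA ler_pdivrMr// mulrC ler_pM2l//; lra.
Qed.

Lemma simple_approx_cvg (fn : nat -> R -> V) f : (forall n, simple_approx (fn n)) ->
  (forall t, 0 <= t -> rnorm (fn n t - f t) @[n --> \oo] --> (0 : R)) ->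
  strongly_measurable (`[0, +oo[%classic : set (measurableTypeR R)) f.
Proof.
move=> hfn cfn.
have /choice[s hs] n : exists s : R -> V, simple_fun (s : measurableTypeR R -> V) /\
    forall t, 0 <= t -> t <= n%:R -> rnorm (fn n t - s t) <= n.+1%:R^-1.
  by apply: hfn; rewrite invr_gt0.
exists s; split; first by move=> n; case: (hs n).
move=> t /=; rewrite in_itv/= andbT => t0; apply/cvg_rnormP.
have cv : n.+1%:R^-1 + rnorm (fn n t - f t) @[n --> \oo] --> (0 : R).
  rewrite -[X in _ --> X](addr0 (0 : R)).
  by apply: cvgD (cfn t t0); exact: (@cvg_harmonic R).
apply: cvgR0_le cv; near=> n; rewrite ger0_norm ?rnorm_ge0//.
apply: le_trans (rnorm_trans (fn n t) _ _) _; rewrite lerD2r rnormBC.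
have [_] := hs n; apply => //.
have : (Num.truncn t < n)%N by near: n; exists (Num.truncn t).+1.
by rewrite truncn_lt_nat// => /ltW.
Unshelve. all: by end_near. Qed.

Lemma simple_approx_measurable f : simple_approx f ->
  strongly_measurable (`[0, +oo[%classic : set (measurableTypeR R)) f.
Proof.
move=> hf; apply: (@simple_approx_cvg (fun=> f)) => // t _.
by rewrite subrr rnorm0; exact: cvg_cst.
Qed.

End locally_uniform_simple.

Lemma strongly_measurable_op {R : realType} {U V : normedModType R[i]}
    (D : set (measurableTypeR R)) (W : U -> V) (C : R) (f : R -> U) :
  linear W -> (forall x, rnorm (W x) <= C * rnorm x) ->
  strongly_measurable D f -> strongly_measurable D (fun t => W (f t)).
Proof.
move=> Wlin WC [s [ss sf]]; exists (fun n t => W (s n t)); split.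
  by move=> n; have [fs ms] := ss n; exact: (simple_fun_comp W fs ms).
move=> t Dt; apply/cvg_rnormP.
have cv : C * rnorm (s n t - f t) @[n --> \oo] --> (0 : R).
  rewrite -[X in _ --> X](mulr0 C); apply: cvgM; first exact: cvg_cst.
  by apply/cvg_rnormP; exact: sf.
apply: cvgR0_le cv; apply: nearW => n; rewrite ger0_norm ?rnorm_ge0//.
by rewrite -(linear_sub Wlin).
Qed.

(** * Bounded operators that smooth trajectories *)

Section regularizer.
Context {R : realType} {H : hilbertType R} {S : R -> H -> H}.
Hypothesis cS : contraction_semigroup S.

(* [W], [A W] and [A ^ 2 W] as bounded operators. *)
Record regularizer (W W1 W2 : H -> H) (C : R) : Prop := Regularizer {
  reg_linear : linear W ;
  reg_linear1 : linear W1 ;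
  reg_ge0 : 0 <= C ;
  reg_bound : forall x, rnorm (W x) <= C * rnorm x ;
  reg_bound1 : forall x, rnorm (W1 x) <= C * rnorm x ;
  reg_bound2 : forall x, rnorm (W2 x) <= C * rnorm x ;
  reg_sg : forall t x, 0 <= t -> S t (W x) = W (S t x) ;
  reg_sg1 : forall t x, 0 <= t -> S t (W1 x) = W1 (S t x) ;
  reg_gen : forall x, gen_rel (S := S) (W x) (W1 x) ;
  reg_gen1 : forall x, gen_rel (S := S) (W1 x) (W2 x) }.

Lemma regularizerB W W1 W2 C V V1 V2 D : regularizer W W1 W2 C -> regularizer V V1 V2 D ->
  regularizer (fun x => W x - V x) (fun x => W1 x - V1 x) (fun x => W2 x - V2 x) (C + D).
Proof.
move=> [Wl W1l C0 Wb W1b W2b Ws W1s Wg W1g] [Vl V1l D0 Vb V1b V2b Vs V1s Vg V1g]; split.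
- by move=> a x y; rewrite Wl Vl scalerBr opprD addrACA.
- by move=> a x y; rewrite W1l V1l scalerBr opprD addrACA.
- exact: addr_ge0.
- by move=> x; apply: le_trans (rnormB_le _ _) _; rewrite mulrDl lerD.
- by move=> x; apply: le_trans (rnormB_le _ _) _; rewrite mulrDl lerD.
- by move=> x; apply: le_trans (rnormB_le _ _) _; rewrite mulrDl lerD.
- by move=> t x t0; rewrite (sgB cS)// Ws// Vs.
- by move=> t x t0; rewrite (sgB cS)// W1s// V1s.
- by move=> x; exact: gen_relB.
- by move=> x; exact: gen_relB.
Qed.

Definition sg_mean (h : R) (x : H) : H := h^-1%:C *: sg_int (S := S) h x.

Definition sg_quot (h : R) (x : H) : H := h^-1%:C *: (S h x - x).

Lemma sg_mean_linear h : linear (sg_mean h).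
Proof.
by move=> a x y; rewrite /sg_mean (sg_int_linear cS) scalerDr !scalerA mulrC.
Qed.

Lemma sg_quot_linear h : 0 <= h -> linear (sg_quot h).
Proof.
move=> h0 a x y; rewrite /sg_quot (sg_linear cS)// opprD addrACA -scalerBr scalerDr.
by rewrite !scalerA mulrC.
Qed.

Lemma sg_mean_norm h x : 0 < h -> rnorm (sg_mean h x) <= rnorm x.
Proof.
move=> h0; rewrite rnormZr gtr0_norm ?invr_gt0// ler_pdivrMl//.
by apply: (sg_int_norm cS); exact: ltW.
Qed.

Lemma sg_quot_norm h x : 0 < h -> rnorm (sg_quot h x) <= 2 / h * rnorm x.
Proof.
move=> h0; rewrite rnormZr gtr0_norm ?invr_gt0// [2 / h]mulrC -mulrA ler_pM2l ?invr_gt0//.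
by apply: le_trans (rnormB_le _ _) _; rewrite mulrDl mul1r lerD2r (sg_norm cS)// ltW.
Qed.

Lemma sg_mean_sg h t x : 0 < h -> 0 <= t -> S t (sg_mean h x) = sg_mean h (S t x).
Proof. by move=> h0 t0; rewrite (sgZ cS)// (sg_int_sg cS)// ltW. Qed.

Lemma sg_quot_sg h t x : 0 < h -> 0 <= t -> S t (sg_quot h x) = sg_quot h (S t x).
Proof. by move=> h0 t0; rewrite (sgZ cS)// (sgB cS)// (sgC cS)// ltW. Qed.

Lemma sg_mean_quot h x : 0 < h -> sg_mean h (sg_quot h x) = sg_quot h (sg_mean h x).
Proof.
move=> h0; rewrite /sg_quot (linear_scale (sg_mean_linear h)).
by rewrite (linear_sub (sg_mean_linear h)) -sg_mean_sg// ltW.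
Qed.

(** Averaging an orbit lands in the domain: by [sg_int_diff], the generator applied to the mean is
    the difference quotient over [h]. *)
Lemma sg_mean_gen h x : 0 < h -> gen_rel (S := S) (sg_mean h x) (sg_quot h x).
Proof.
move=> h0 d d0; have h0' := ltW h0.
rewrite (sgZ cS)// -scalerBr (sg_int_diff cS)// /sg_quot.
rewrite (linear_scale (sg_int_linear cS d)) (linear_sub (sg_int_linear cS d)).
by rewrite (sg_int_sg cS).
Qed.

(* One average maps into [dom A], two averages into [dom A ^ 2]. *)
Definition double_mean (h : R) (x : H) : H := sg_mean h (sg_mean h x).

Lemma double_mean_norm h x : 0 < h -> rnorm (double_mean h x) <= rnorm x.
Proof. by move=> h0; apply: le_trans (sg_mean_norm _ h0) (sg_mean_norm _ h0). Qed.

Lemma double_mean_regularizer h : 0 < h -> exists C,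
  regularizer (double_mean h) (fun x => sg_quot h (sg_mean h x))
    (fun x => sg_quot h (sg_quot h x)) C.
Proof.
move=> h0; have h0' := ltW h0; have h2 : 0 <= 2 / h by rewrite divr_ge0.
(* The three summands bound [W], [W1] and [W2] in this order; their sum serves for all. *)
exists (1 + 2 / h + (2 / h) ^+ 2); split.
- by move=> a x y; rewrite /double_mean !sg_mean_linear.
- by move=> a x y; rewrite sg_mean_linear sg_quot_linear.
- by rewrite !addr_ge0// sqr_ge0.
- move=> x; apply: le_trans (double_mean_norm x h0) _.
  by rewrite ler_peMl ?rnorm_ge0// -addrA lerDl addr_ge0// sqr_ge0.
- move=> x; apply: le_trans (sg_quot_norm _ h0) _.
  apply: (@le_trans _ _ (2 / h * rnorm x)); first by rewrite ler_wpM2l// sg_mean_norm.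
  by rewrite ler_wpM2r ?rnorm_ge0// addrAC lerDr addr_ge0// sqr_ge0.
- move=> x; apply: le_trans (sg_quot_norm _ h0) _.
  apply: (@le_trans _ _ (2 / h * (2 / h * rnorm x))); first by rewrite ler_wpM2l// sg_quot_norm.
  by rewrite mulrA -expr2 ler_wpM2r ?rnorm_ge0// lerDr addr_ge0.
- by move=> t x t0; rewrite /double_mean !sg_mean_sg.
- by move=> t x t0; rewrite sg_quot_sg// sg_mean_sg.
- by move=> x; exact: sg_mean_gen.
- by move=> x; rewrite -sg_mean_quot//; exact: sg_mean_gen.
Qed.

Lemma double_mean_cvg x :
  rnorm (double_mean n.+1%:R^-1 x - x) @[n --> \oo] --> (0 : R).
Proof.
have h0 n : 0 < n.+1%:R^-1 :> R by rewrite invr_gt0.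
have c0 : rnorm (sg_mean n.+1%:R^-1 x - x) @[n --> \oo] --> (0 : R).
  have := sg_int_cvg cS x => /cvg_at_rightP; apply.
  by split; [exact: h0|exact: (@cvg_harmonic R)].
have c2 : 2 * rnorm (sg_mean n.+1%:R^-1 x - x) @[n --> \oo] --> (0 : R).
  by rewrite -[X in _ --> X](mulr0 2); apply: cvgM c0; exact: cvg_cst.
apply: cvgR0_le c2; apply: nearW => n; rewrite ger0_norm ?rnorm_ge0//.
apply: le_trans (rnorm_trans (sg_mean n.+1%:R^-1 x) _ _) _.
rewrite mulrDl mul1r lerD2r /double_mean -(linear_sub (sg_mean_linear _)).
exact: sg_mean_norm.
Qed.

End regularizer.

(** * Energy balance of regularized trajectories *)

Definition locally_sq_integrable {R : realType} {V : normedModType R[i]}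
    (f : R -> V) : Prop := forall T : R, 0 <= T ->
  strongly_measurable (`[0, T]%classic : set (measurableTypeR R)) f /\
  (@lebesgue_measure R).-integrable `[0, T]%classic
    (EFin \o (fun t => rnorm (f t) ^+ 2)).

Section controlled_trajectory.
Context {R : realType} {H : hilbertType R} {S : R -> H -> H}.
Hypothesis cS : contraction_semigroup S.
Local Notation mu := (@lebesgue_measure R).
Local Notation hH := (@hilbert_rin R H).
Local Notation itv0 T := (`[0, T]%classic : set (measurableTypeR R)).

(** The mild solution for the forcing [g = B u], written with the weak integral; see
    [mild_solutionE]. *)
Definition trajectory (x0 : H) (g : R -> H) (t : R) : H :=
  S t x0 + wint `[0, t] (fun s => S (t - s) (g s)).

Definition forcing_norm (g : R -> H) (a b : R) : R := \int[mu]_(t in `[a, b]) rnorm (g t).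

Variable g : R -> H.
Hypothesis g2 : locally_sq_integrable g.
Local Notation N1 := (forcing_norm g).

Lemma forcing_integrable a b : 0 <= a -> a <= b ->
  mu.-integrable (`[a, b]%classic : set (measurableTypeR R)) (EFin \o (fun t => rnorm (g t))) /\
  N1 a b ^+ 2 <= (b - a) * \int[mu]_(t in `[a, b]) rnorm (g t) ^+ 2.
Proof.
move=> a0 ab; have [mg ig] := g2 (le_trans a0 ab).
apply: Rintegral_CauchySchwarz => //.
  have sub : `[a, b]%classic `<=` `[0, b]%classic by apply: subset_itv; rewrite bnd_simp.
  exact: (strongly_measurable_rnorm _ (strongly_measurable_sub sub mg)).
exact: (integrable_itv a0 (lexx b)).
Qed.

Lemma forcing_norm_ge0 a b : 0 <= N1 a b.
Proof. by apply: Rintegral_ge0 => t _; exact: rnorm_ge0. Qed.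

Lemma forcing_norm_le a b T : 0 <= a -> a <= b -> b <= T -> N1 a b <= N1 0 T.
Proof.
move=> a0 ab bT; apply: Rintegral_set_le => //.
- by apply: subset_itv; rewrite bnd_simp.
- by have [] := forcing_integrable (lexx 0) (le_trans a0 (le_trans ab bT)).
- by move=> t _; exact: rnorm_ge0.
Qed.

Lemma sg_forcing_measurable a b t : 0 <= a -> a <= b -> b <= t ->
  strongly_measurable (`[a, b]%classic : set (measurableTypeR R)) (fun s => S (t - s) (g s)).
Proof.
move=> a0 ab bt; have [mg _] := g2 (le_trans a0 ab).
apply: (strongly_measurable_sg cS (phi := fun s => t - s)).
- by apply: measurable_funB => //; exact: measurable_cst.
- by move=> s /=; rewrite in_itv/= subr_ge0 => /andP[_ sb]; exact: le_trans bt.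
- by apply: strongly_measurable_sub mg; apply: subset_itv; rewrite bnd_simp.
Qed.

Lemma sg_forcing_dominated a b t : 0 <= a -> a <= b -> b <= t ->
  dominated `[a, b] (fun s => S (t - s) (g s)) (fun s => rnorm (g s)).
Proof.
move=> a0 ab bt; apply: strongly_measurable_dominated => //.
- exact: sg_forcing_measurable.
- by have [] := forcing_integrable a0 ab.
- move=> s /=; rewrite in_itv/= => /andP[_ sb]; apply: (sg_norm cS).
  by rewrite subr_ge0 (le_trans sb).
Qed.

Definition increment (s t : R) : H := wint `[s, t] (fun r => S (t - r) (g r)).

Lemma increment_norm s t : 0 <= s -> s <= t -> rnorm (increment s t) <= N1 s t.
Proof. by move=> s0 st; exact: wint_norm (sg_forcing_dominated s0 st (lexx t)). Qed.

Variable x0 : H.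
Local Notation x := (trajectory x0 g).

Lemma trajectory0 : x 0 = x0.
Proof.
rewrite /trajectory (sg0 cS) (_ : wint _ _ = 0) ?addr0//.
apply/rnorm_eq0/eqP; rewrite eq_le rnorm_ge0 andbT.
apply: le_trans (increment_norm (lexx 0) (lexx 0)) _.
by rewrite /forcing_norm set_itv1 Rintegral_set1.
Qed.

Lemma trajectory_cocycle s t : 0 <= s -> s <= t ->
  x t = S (t - s) (x s) + increment s t.
Proof.
move=> s0 st; have ts0 : 0 <= t - s by rewrite subr_ge0.
rewrite /trajectory (linear_add (sg_linear cS ts0)) -(sgD cS)// subrK -addrA; congr (_ + _).
rewrite (@wint_itv_cat _ _ _ s _ _ (fun r => rnorm (g r)))//; last first.
  by apply: sg_forcing_dominated => //; exact: le_trans st.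
congr (_ + _).
rewrite (wint_op (sg_linear cS ts0) (fun y => sg_norm1 cS y ts0) ler01
  (sg_forcing_dominated (lexx 0) s0 (lexx s))).
apply: eq_wint => r /=; rewrite in_itv/= => /andP[r0 rs].
by rewrite -(sgD cS) ?subr_ge0// subrKA.
Qed.

Lemma trajectory_norm T t : 0 <= t -> t <= T -> rnorm (x t) <= rnorm x0 + N1 0 T.
Proof.
move=> t0 tT; apply: le_trans (rnormD _ _) _; rewrite lerD ?(sg_norm cS)//.
by apply: le_trans (increment_norm (lexx 0) t0) _; exact: forcing_norm_le.
Qed.

(** With [g] only square integrable, increments of a regularized trajectory need not be of order
    [t - s]; they are of the order of the increase of this function. *)
Definition clock (t : R) : R := t + N1 0 t.

Lemma clockB s t : 0 <= s -> s <= t -> clock t - clock s = (t - s) + N1 s t.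
Proof.
move=> s0 st; rewrite /clock opprD addrACA; congr (_ + _).
have [gi _] := forcing_integrable (lexx 0) (le_trans s0 st).
by rewrite /forcing_norm (Rintegral_itv_cat s0 st gi) addrC addKr.
Qed.

(** The two terms of the constant come from [t - s <= sqrt T * sqrt (t - s)] and from Cauchy-Schwarz
    for the integral of [|g|]. *)
Lemma clock_holder T : 0 <= T -> exists2 D, 0 <= D & forall s t,
  0 <= s -> s <= t -> t <= T -> 0 <= clock t - clock s <= D * Num.sqrt (t - s).
Proof.
move=> T0; exists (Num.sqrt T + Num.sqrt (\int[mu]_(t in `[0, T]) rnorm (g t) ^+ 2)).
  by rewrite addr_ge0 ?sqrtr_ge0.
move=> s t s0 st tT; rewrite clockB//.
have ts : 0 <= t - s by rewrite subr_ge0.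
rewrite addr_ge0 ?forcing_norm_ge0//= mulrDl lerD//.
  rewrite -{1}[t - s]sqr_sqrtr// expr2 ler_wpM2r ?sqrtr_ge0// ler_wsqrtr//.
  lra.
rewrite -(@ler_pXn2r _ 2) ?nnegrE ?forcing_norm_ge0 ?mulr_ge0 ?sqrtr_ge0//.
rewrite exprMn !sqr_sqrtr//; last by apply: Rintegral_ge0 => r _; rewrite sqr_ge0.
have [_ h] := forcing_integrable s0 st; apply: le_trans h _.
rewrite mulrC ler_wpM2r//; apply: Rintegral_set_le => //.
- by apply: subset_itv; rewrite bnd_simp.
- by have [] := g2 T0.
- by move=> r _; rewrite sqr_ge0.
Qed.

(** By the cocycle law the increment is [(S (t - s) - 1) W x(s)], at most [(t - s) |W1 x(s)|], plus
    [W] of the forcing integral, at most [C] times the integral of [|g|]. It is applied to the pairs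
    [W], [W1] and [W1], [W2]. *)
Lemma bounded_trajectory_dist (W W1 : H -> H) (C T M : R) :
  linear W -> 0 <= C -> (forall y, rnorm (W y) <= C * rnorm y) ->
  (forall y, rnorm (W1 y) <= C * rnorm y) ->
  (forall t y, 0 <= t -> S t (W y) = W (S t y)) ->
  (forall y, gen_rel (S := S) (W y) (W1 y)) ->
  (forall t, 0 <= t -> t <= T -> rnorm (x t) <= M) ->
  forall s t, 0 <= s -> s <= t -> t <= T ->
  rnorm (W (x t) - W (x s)) <= C * (M + 1) * (clock t - clock s).
Proof.
move=> Wl C0 Wb W1b Ws Wg hM s t s0 st tT.
have ts : 0 <= t - s by rewrite subr_ge0.
have M0 : 0 <= M by apply: le_trans (rnorm_ge0 _) (hM _ s0 (le_trans st tT)).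
rewrite (trajectory_cocycle s0 st) (linear_add Wl) -Ws// addrAC.
apply: le_trans (rnormD _ _) _.
have h1 := gen_dist cS (Wg (x s)) ts.
have h2 := W1b (x s).
have h3 := hM _ s0 (le_trans st tT).
have h4 := Wb (increment s t).
have h5 := increment_norm s0 st.
have h6 : (t - s) * rnorm (W1 (x s)) <= (t - s) * (C * M).
  by rewrite ler_wpM2l//; apply: le_trans h2 _; rewrite ler_wpM2l.
have h7 : rnorm (W (increment s t)) <= C * N1 s t.
  by apply: le_trans h4 _; rewrite ler_wpM2l.
apply: le_trans (lerD (le_trans h1 h6) h7) _.
rewrite clockB//; have h8 : 0 <= C * (t - s) by rewrite mulr_ge0.
have h9 : 0 <= C * M * N1 s t by rewrite !mulr_ge0 ?forcing_norm_ge0.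
rewrite -subr_ge0 (_ : _ - _ = C * (t - s) + C * M * N1 s t); last by ring.
exact: addr_ge0.
Qed.

Section energy.
Variables (W W1 W2 : H -> H) (C : R).
Hypothesis rW : regularizer (S := S) W W1 W2 C.

Let C0 : 0 <= C := reg_ge0 rW.

Lemma reg_dist T s t : 0 <= s -> s <= t -> t <= T ->
  rnorm (W (x t) - W (x s)) <= C * (rnorm x0 + N1 0 T + 1) * (clock t - clock s).
Proof.
apply: (bounded_trajectory_dist (W1 := W1)); try by case: rW.
exact: trajectory_norm.
Qed.

Lemma reg_dist1 T s t : 0 <= s -> s <= t -> t <= T ->
  rnorm (W1 (x t) - W1 (x s)) <= C * (rnorm x0 + N1 0 T + 1) * (clock t - clock s).
Proof.
apply: (bounded_trajectory_dist (W1 := W2)); try by case: rW.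
exact: trajectory_norm.
Qed.

Lemma clock_simple_approx {V : normedModType R[i]} (f : R -> V) :
  (forall T, 0 <= T -> exists2 K, 0 <= K & forall s t, 0 <= s -> s <= t -> t <= T ->
    rnorm (f t - f s) <= K * (clock t - clock s)) -> simple_approx f.
Proof.
move=> hf; apply: holder_simple_approx => T T0.
have [K K0 hK] := hf T T0; have [D D0 hD] := clock_holder T0.
exists (K * D); first exact: mulr_ge0.
move=> s t s0 st tT; apply: le_trans (hK _ _ s0 st tT) _.
by rewrite -mulrA ler_wpM2l//; have /andP[] := hD _ _ s0 st tT.
Qed.

Let K0 T : 0 <= C * (rnorm x0 + N1 0 T + 1).
Proof. by rewrite mulr_ge0// !addr_ge0 ?rnorm_ge0 ?forcing_norm_ge0. Qed.

Lemma reg_simple_approx : simple_approx (fun t => W (x t)).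
Proof.
apply: clock_simple_approx => T _.
by exists (C * (rnorm x0 + N1 0 T + 1)); [exact: K0|exact: reg_dist].
Qed.

Lemma reg_simple_approx1 : simple_approx (fun t => W1 (x t)).
Proof.
apply: clock_simple_approx => T _.
by exists (C * (rnorm x0 + N1 0 T + 1)); [exact: K0|exact: reg_dist1].
Qed.

Lemma reg_measurable T : strongly_measurable (itv0 T) (fun t => W (x t)).
Proof.
exact: strongly_measurable_sub (@subset_itv0T R T) (simple_approx_measurable reg_simple_approx).
Qed.

Lemma reg_measurable1 T : strongly_measurable (itv0 T) (fun t => W1 (x t)).
Proof.
exact: strongly_measurable_sub (@subset_itv0T R T) (simple_approx_measurable reg_simple_approx1).
Qed.

Lemma reg_supply_integrable T : 0 <= T ->
  mu.-integrable (itv0 T) (EFin \o (fun t => rin (W (g t)) (W (x t)))).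
Proof.
move=> T0; have [mg _] := g2 T0.
have [gi _] := forcing_integrable (lexx 0) T0.
apply: (@integrable_le _ _ _ (fun t => C ^+ 2 * (rnorm x0 + N1 0 T) * rnorm (g t))) => //.
- apply: strongly_measurable_rin => //; last exact: reg_measurable.
  exact: (strongly_measurable_op (reg_linear rW) (reg_bound rW)).
- exact: integrable_mull.
- move=> t /=; rewrite in_itv/= => /andP[t0 tT].
  apply: le_trans (hf_le_norm hH _ _) _.
  rewrite mulrC (_ : _ * rnorm (g t) = C * (rnorm x0 + N1 0 T) * (C * rnorm (g t))); last by ring.
  apply: ler_pM (reg_bound rW _); rewrite ?rnorm_ge0//.
  by apply: le_trans (reg_bound rW _) _; rewrite ler_wpM2l// trajectory_norm.
Qed.

Lemma reg_dissipation_integrable T : 0 <= T ->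
  mu.-integrable (itv0 T) (EFin \o (fun t => rin (W1 (x t)) (W (x t)))).
Proof.
move=> T0.
apply: (@integrable_le _ _ _ (fun=> (C * (rnorm x0 + N1 0 T)) ^+ 2)) => //.
- apply: strongly_measurable_rin => //; [exact: reg_measurable1|exact: reg_measurable].
- by apply: integrable_cstr => //; exact: lebesgue_itvcc_fin.
- move=> t /=; rewrite in_itv/= => /andP[t0 tT].
  apply: le_trans (hf_le_norm hH _ _) _; rewrite expr2.
  have h := trajectory_norm t0 tT.
  apply: ler_pM; rewrite ?rnorm_ge0//.
    by apply: le_trans (reg_bound1 rW _) _; rewrite ler_wpM2l.
  by apply: le_trans (reg_bound rW _) _; rewrite ler_wpM2l.
Qed.

Let power t := rin (W (g t)) (W (x t)) + rin (W1 (x t)) (W (x t)).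

Lemma power_integrable T : 0 <= T -> mu.-integrable (itv0 T) (EFin \o power).
Proof.
move=> T0; apply: integrable_addr => //; first exact: reg_supply_integrable.
exact: reg_dissipation_integrable.
Qed.

(** The balance to be proved says that this defect is constant in time. *)
Let energy t := 2^-1 * rnorm (W (x t)) ^+ 2 - \int[mu]_(r in `[0, t]) power r.

(** The state is frozen at the left end [s]; what remains is of second order in the clock increment
    [w]. *)
Lemma energy_increment T : exists2 K, 0 <= K & forall s t, 0 <= s -> s <= t -> t <= T ->
  `|energy t - energy s| <= K * (clock t - clock s) ^+ 2.
Proof.
pose M := rnorm x0 + N1 0 T; pose M1 := C * (M + 1).
have M0 : 0 <= M by rewrite addr_ge0 ?rnorm_ge0 ?forcing_norm_ge0.
have M10 : 0 <= M1 by exact: K0.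
(* [K1] collects the coefficients of the bounds [t1] to [t4]; the three summands of the final
   constant belong to [h1], [h2] and [h3]. *)
pose K1 := 2 * M1 * C * M + C ^+ 2 * M + C * M1.
have K10 : 0 <= K1.
  by rewrite /K1; do ?[by []|exact: sqr_ge0|apply: addr_ge0|apply: mulr_ge0].
exists (C ^+ 2 * M ^+ 2 + 2^-1 * M1 ^+ 2 + K1).
  by do ?[by []|exact: sqr_ge0|apply: addr_ge0|apply: mulr_ge0].
move=> s t s0 st tT; have t0 := le_trans s0 st; have sT := le_trans st tT.
have ts : 0 <= t - s by rewrite subr_ge0.
set w := clock t - clock s.
have wE : w = (t - s) + N1 s t by exact: clockB.
have N0 : 0 <= N1 s t by exact: forcing_norm_ge0.
have tsw : t - s <= w by rewrite wE lerDl.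
have w0 : 0 <= w by exact: le_trans tsw.
(* [q] is the second-order Taylor remainder of the orbit of [a]. *)
set a := W (x s); set a1 := W1 (x s); set q := S (t - s) a - a - (t - s)%:C *: a1.
have aM r : 0 <= r -> r <= T -> rnorm (W (x r)) <= C * M.
  move=> r0 rT; apply: le_trans (reg_bound rW _) _.
  by rewrite ler_wpM2l// trajectory_norm.
have a1M r : 0 <= r -> r <= T -> rnorm (W1 (x r)) <= C * M.
  move=> r0 rT; apply: le_trans (reg_bound1 rW _) _.
  by rewrite ler_wpM2l// trajectory_norm.
have clock_mono r : s <= r -> r <= t -> clock r - clock s <= w.
  move=> sr rt; rewrite /w clockB// clockB//.
  rewrite lerD ?lerB//; apply: Rintegral_set_le => //.
  - by apply: subset_itv; rewrite bnd_simp.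
  - by have [] := forcing_integrable s0 st.
  - by move=> u _; exact: rnorm_ge0.
have [gi _] := forcing_integrable s0 st.
have bE : rin (W (increment s t)) a = \int[mu]_(r in `[s, t]) rin (S (t - r) (W (g r))) a.
  rewrite (wint_op (reg_linear rW) (reg_bound rW) C0 (sg_forcing_dominated s0 st (lexx t))).
  rewrite (wintE (dominated_op (reg_linear rW) (reg_bound rW) C0
    (sg_forcing_dominated s0 st (lexx t)))).
  apply: eq_Rintegral => r /set_mem/=; rewrite in_itv/= => /andP[_ rt].
  by rewrite (reg_sg rW)// subr_ge0.
have bi : mu.-integrable (`[s, t]%classic : set (measurableTypeR R))
    (EFin \o (fun r => rin (S (t - r) (W (g r))) a)).
  have := dominated_integrable a (dominated_op (reg_linear rW) (reg_bound rW) C0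
    (sg_forcing_dominated s0 st (lexx t))).
  apply: eq_integrable => // r /set_mem/=; rewrite in_itv/= => /andP[_ rt].
  by rewrite (reg_sg rW)// subr_ge0.
have ci : mu.-integrable (`[s, t]%classic : set (measurableTypeR R)) (EFin \o (fun=> rin a1 a)).
  by apply: integrable_cstr => //; exact: lebesgue_itvcc_fin.
have pi : mu.-integrable (`[s, t]%classic : set (measurableTypeR R)) (EFin \o power).
  exact: (integrable_itv s0 (lexx t) (power_integrable t0)).
(* The power with the state frozen at [s] and the forcing transported to time [t], less the actual
   power. *)
pose psi r := (rin a1 a + rin (S (t - r) (W (g r))) a) - power r.
have psiE : \int[mu]_(r in `[s, t]) psi r =
    (t - s) * rin a1 a + rin (W (increment s t)) a - \int[mu]_(r in `[s, t]) power r.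
  rewrite RintegralB//; last exact: integrable_addr.
  by rewrite RintegralD// Rintegral_itv_cst// bE mulrC.
have psii : mu.-integrable (`[s, t]%classic : set (measurableTypeR R)) (EFin \o psi).
  by apply: integrable_subr => //; exact: integrable_addr.
(* With [b = W (x t)], [|b|^2 / 2 - |a|^2 / 2] is the pairing of [b - a] with [a] plus
   [|b - a|^2 / 2], and [b - a] is the sum of [q], [(t - s) a1] and [W] of the forcing increment. *)
have eE : energy t - energy s = rin q a + 2^-1 * rnorm (W (x t) - a) ^+ 2 +
    \int[mu]_(r in `[s, t]) psi r.
  rewrite psiE /energy (Rintegral_itv_cat s0 st (power_integrable t0)).
  rewrite (hf_normB hH) (trajectory_cocycle s0 st) (linear_add (reg_linear rW)) -(reg_sg rW)//.
  rewrite -/a /q !(hfB hH) (hfZ hH) (hfD hH) (hf_norm hH).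
  by move: (\int[mu]_(r in _) _) (\int[mu]_(r in _) _) => u v; field.
have h1 : `|rin q a| <= C ^+ 2 * M ^+ 2 * w ^+ 2.
  apply: le_trans (hf_le_norm hH _ _) _.
  have hq : rnorm q <= w ^+ 2 * (C * M).
    apply: le_trans (gen_dist2 cS (reg_gen rW (x s)) (reg_gen1 rW (x s)) ts) _.
    rewrite ler_pM ?rnorm_ge0 ?sqr_ge0 ?lerXn2r ?nnegrE//.
    apply: le_trans (reg_bound2 rW _) _.
    by rewrite ler_wpM2l// trajectory_norm.
  rewrite (_ : C ^+ 2 * M ^+ 2 * w ^+ 2 = (w ^+ 2 * (C * M)) * (C * M)); last by ring.
  by rewrite ler_pM ?rnorm_ge0// aM.
have h2 : `|2^-1 * rnorm (W (x t) - a) ^+ 2| <= 2^-1 * M1 ^+ 2 * w ^+ 2.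
  have i2 : 0 <= 2^-1 :> R by rewrite invr_ge0.
  rewrite (ger0_norm (mulr_ge0 i2 (sqr_ge0 _))) -mulrA ler_wpM2l// -exprMn.
  rewrite lerXn2r ?nnegrE ?rnorm_ge0 ?(mulr_ge0 M10 w0)//; exact: (reg_dist s0 st tT).
have psi_le r : s <= r -> r <= t -> `|psi r| <= K1 * w * (1 + rnorm (g r)).
  move=> sr rt; have r0 := le_trans s0 sr; have rT := le_trans rt tT.
  have tr : 0 <= t - r by rewrite subr_ge0.
  have gr0 := rnorm_ge0 (g r).
  have d0 : rnorm (W (x r) - a) <= M1 * w.
    apply: le_trans (reg_dist s0 sr rT) _; rewrite ler_wpM2l//; exact: clock_mono.
  have d1 : rnorm (W1 (x r) - a1) <= M1 * w.
    apply: le_trans (reg_dist1 s0 sr rT) _; rewrite ler_wpM2l//; exact: clock_mono.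
  (* Each of the four terms carries one difference of order [w], up to a factor [|g r|] in the last
     two. *)
  have -> : psi r = rin (a1 - W1 (x r)) a + rin (W1 (x r)) (a - W (x r)) +
      (rin (S (t - r) (W (g r)) - W (g r)) a + rin (W (g r)) (a - W (x r))).
    by rewrite /psi /power !(hfB hH) !(hfBr hH); ring.
  have t1 : `|rin (a1 - W1 (x r)) a| <= M1 * w * (C * M).
    apply: le_trans (hf_le_norm hH _ _) _; rewrite rnormBC.
    by rewrite ler_pM ?rnorm_ge0// aM.
  have t2 : `|rin (W1 (x r)) (a - W (x r))| <= C * M * (M1 * w).
    apply: le_trans (hf_le_norm hH _ _) _; rewrite [rnorm (a - _)]rnormBC.
    by rewrite ler_pM ?rnorm_ge0// a1M.
  have t3 : `|rin (S (t - r) (W (g r)) - W (g r)) a| <= w * (C * rnorm (g r)) * (C * M).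
    apply: le_trans (hf_le_norm hH _ _) _; rewrite ler_pM ?rnorm_ge0// ?aM//.
    apply: le_trans (gen_dist cS (reg_gen rW (g r)) tr) _.
    rewrite ler_pM ?rnorm_ge0 ?(reg_bound1 rW)//.
    by apply: le_trans tsw; rewrite lerB.
  have t4 : `|rin (W (g r)) (a - W (x r))| <= C * rnorm (g r) * (M1 * w).
    apply: le_trans (hf_le_norm hH _ _) _; rewrite [rnorm (a - _)]rnormBC.
    by rewrite ler_pM ?rnorm_ge0// (reg_bound rW).
  apply: le_trans (ler_normD _ _) _.
  apply: le_trans (lerD (ler_normD _ _) (ler_normD _ _)) _.
  apply: le_trans (lerD (lerD t1 t2) (lerD t3 t4)) _.
  rewrite -subr_ge0 (_ : _ - _ = 2 * M1 * C * M * w * rnorm (g r) +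
     (C ^+ 2 * M + C * M1) * w); last by rewrite /K1; ring.
  by do ?[by []|exact: sqr_ge0|apply: addr_ge0|apply: mulr_ge0].
have gi1 : mu.-integrable (`[s, t]%classic : set (measurableTypeR R))
    (EFin \o (fun r => 1 + rnorm (g r))).
  by apply: integrable_addr => //; apply: integrable_cstr => //; exact: lebesgue_itvcc_fin.
have h3 : `|\int[mu]_(r in `[s, t]) psi r| <= K1 * w ^+ 2.
  (* The integral of [1 + |g|] over [[s, t]] is [w] itself, whence the second factor [w]. *)
  have -> : K1 * w ^+ 2 = \int[mu]_(r in `[s, t]) (K1 * w * (1 + rnorm (g r))).
    rewrite RintegralZl// RintegralD//; last first.
      by apply: integrable_cstr => //; exact: lebesgue_itvcc_fin.
    by rewrite Rintegral_itv_cst// mul1r -/(N1 s t) -wE expr2 mulrA.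
  apply: Rintegral_norm_le => //.
  - by have := measurable_int _ psii => /measurable_EFinP.
  - exact: integrable_mull.
  - by move=> r /=; rewrite in_itv/= => /andP[sr rt]; exact: psi_le.
rewrite eE mulrDl [X in _ <= X + _]mulrDl; apply: le_trans (ler_normD _ _) _; rewrite lerD//.
by apply: le_trans (ler_normD _ _) _; rewrite lerD.
Qed.

Lemma regularized_energy T : 0 <= T ->
  2^-1 * rnorm (W (x T)) ^+ 2 - 2^-1 * rnorm (W x0) ^+ 2 =
  \int[mu]_(t in `[0, T]) rin (W (g t)) (W (x t)) +
  \int[mu]_(t in `[0, T]) rin (W1 (x t)) (W (x t)).
Proof.
move=> T0; have [K K0' hK] := energy_increment T; have [D D0 hD] := clock_holder T0.
have := telescoping_eq T0 K0' D0 hD hK.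
rewrite /energy set_itv1 Rintegral_set1 trajectory0 subr0.
rewrite RintegralD//; [|exact: reg_supply_integrable|exact: reg_dissipation_integrable].
by move=> /eqP; rewrite subr_eq => /eqP ->; rewrite addrAC subrr add0r.
Qed.

End energy.

End controlled_trajectory.

(** * The graph space and the square root of the dissipation form *)

Section maximal_dissipative.
Context {R : realType} {H : hilbertType R} {A : linop H}.
Hypothesis mA : maximal_dissipative A.
Local Notation S := (semigroup_of A).
Local Notation hH := (@hilbert_rin R H).

Lemma semigroup_ofP : contraction_semigroup S /\ generator A S.
Proof.
exact: (@xgetPex _ _ [set S | contraction_semigroup S /\ generator A S]).
Qed.

Let cS : contraction_semigroup S := semigroup_ofP.1.

Lemma opdom_gen (x : graph_space A) : gen_rel (S := S) (submodule_val x) (A x).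
Proof. by apply: (cvg_gen_rel cS); have [_ [_]] := semigroup_ofP; exact. Qed.

(** A generator has the maximal domain, so together with [opdom_gen] the integrated relation is
    exactly the graph of [A]. *)
Lemma gen_opdom (x y : H) : gen_rel (S := S) x y ->
  exists z : graph_space A, submodule_val z = x /\ A z = y.
Proof.
move=> xy; have [_ [hd hA]] := semigroup_ofP.
have xd : x \in opdom A by apply/hd; exists y; exact: gen_rel_cvg.
exists (Submodule xd); split => //.
have := hA (Submodule xd) => /= c1; have c2 := gen_rel_cvg cS xy.
exact: (cvg_unique (@norm_hausdorff _ H) c1 c2).
Qed.

Lemma graph_valD (x y : graph_space A) :
  submodule_val (x + y) = submodule_val x + submodule_val y.
Proof. by []. Qed.

Lemma graph_valZ a (x : graph_space A) : submodule_val (a *: x) = a *: submodule_val x.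
Proof. by []. Qed.

Lemma graph_valB (x y : graph_space A) :
  submodule_val (x - y) = submodule_val x - submodule_val y.
Proof. by []. Qed.

Lemma graph_opD (x y : graph_space A) : A (x + y) = A x + A y.
Proof. exact: linearD. Qed.

Lemma graph_opZ a (x : graph_space A) : A (a *: x) = a *: A x.
Proof. exact: linearZ. Qed.

Lemma graph_opB (x y : graph_space A) : A (x - y) = A x - A y.
Proof. exact: linearB. Qed.

Definition graph_form (x y : graph_space A) : R :=
  rin (submodule_val x) (submodule_val y) + rin (A x) (A y).

Lemma graph_norm_le (x : graph_space A) : rnorm (submodule_val x) <= rnorm x.
Proof.
rewrite rnorm_graphE -(@ler_pXn2r _ 2) ?nnegrE ?sqrtr_ge0 ?rnorm_ge0//.
by rewrite sqr_sqrtr ?addr_ge0 ?sqr_ge0// lerDl sqr_ge0.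
Qed.

Lemma graph_norm_le1 (x : graph_space A) : rnorm (A x) <= rnorm x.
Proof.
rewrite rnorm_graphE -(@ler_pXn2r _ 2) ?nnegrE ?sqrtr_ge0 ?rnorm_ge0//.
by rewrite sqr_sqrtr ?addr_ge0 ?sqr_ge0// lerDr sqr_ge0.
Qed.

Lemma graph_norm_ge (x : graph_space A) : rnorm x <= rnorm (submodule_val x) + rnorm (A x).
Proof.
have n1 := rnorm_ge0 (submodule_val x); have n2 := rnorm_ge0 (A x).
rewrite rnorm_graphE -(@ler_pXn2r _ 2) ?nnegrE ?sqrtr_ge0 ?addr_ge0//.
rewrite sqr_sqrtr ?addr_ge0 ?sqr_ge0//; nra.
Qed.

Lemma hilbert_graph : hilbert_form graph_form.
Proof.
split.
- by move=> x y z; rewrite /graph_form graph_valD graph_opD !(hfD hH) addrACA.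
- by move=> a x y; rewrite /graph_form graph_valZ graph_opZ !(hfZ hH) mulrDr.
- by move=> x y; rewrite /graph_form !graph_valZ !graph_opZ !(hfi hH) opprD.
- by move=> x y; rewrite /graph_form (hfC hH (submodule_val x)) (hfC hH (A x)).
- by move=> x; rewrite /graph_form !(hf_norm hH) rnorm_graphE sqr_sqrtr// addr_ge0 ?sqr_ge0.
(* Completeness amounts to the closedness of [A], supplied by [gen_rel_closed]. *)
- move=> u cu.
  have [|x ux] := hf_complete hH (u := fun n => submodule_val (u n)).
    move=> e /cu[N hN]; exists N => m n Nm Nn; apply: le_trans (hN m n Nm Nn).
    exact: (graph_norm_le (u m - u n)).
  have [|y uy] := hf_complete hH (u := fun n => A (u n)).
    move=> e /cu[N hN]; exists N => m n Nm Nn; apply: le_trans (hN m n Nm Nn).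
    by rewrite -graph_opB; exact: (graph_norm_le1 (u m - u n)).
  have [z [zx zy]] := gen_opdom (gen_rel_closed cS (fun n => opdom_gen (u n)) ux uy).
  exists z; have c : rnorm (submodule_val (u n) - x) + rnorm (A (u n) - y) @[n --> \oo] --> (0 : R).
    by rewrite -[X in _ --> X](addr0 (0 : R)); apply: cvgD.
  apply: cvgR0_le c; apply: nearW => n; rewrite ger0_norm ?rnorm_ge0//.
  by apply: le_trans (graph_norm_ge _) _; rewrite graph_valB graph_opB zx zy.
Qed.

(** [b] is the polarized form of [- Re <A x, x>]: dissipativity makes it nonnegative, and
    [|A x| |x|] is at most the squared graph norm. *)
Lemma dissipation_root : exists L : graph_space A -> graph_space A, linear L /\
  forall x, rnorm (L x) ^+ 2 = - rin (A x) (submodule_val x).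
Proof.
pose b (x y : graph_space A) :=
  - 2^-1 * (rin (A x) (submodule_val y) + rin (submodule_val x) (A y)).
have bE x : b x x = - rin (A x) (submodule_val x).
  by rewrite /b [rin (submodule_val x) _](hfC hH); field.
have [|||||L [Ll hL]] := form_square_root hilbert_graph (b := b).
- by move=> x y z; rewrite /b graph_valD graph_opD !(hfD hH); ring.
- by move=> a x y; rewrite /b !graph_valZ !graph_opZ !(hfZ hH); ring.
- by move=> x y; rewrite /b !graph_valZ !graph_opZ !(hfi hH); ring.
- by move=> x y; rewrite /b (hfC hH (submodule_val x)) (hfC hH (A x)) addrC.
- move=> x; rewrite bE; have := gen_rel_dissipative cS (opdom_gen x) => h.
  rewrite oppr_ge0 h/=; apply: le_trans (ler_norm _) _; rewrite normrN.
  apply: le_trans (hf_le_norm hH _ _) _.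
  by rewrite expr2 ler_pM ?rnorm_ge0 ?graph_norm_le ?graph_norm_le1.
by exists L; split => // x; rewrite hL bE.
Qed.

(** [G] lifts [W n x] to the domain and is linear because the embedding into [H] is injective.
    Linearity of [L] turns differences of [F] into the form at [W m x - W n x]. *)
Lemma regularizer_root (W W1 W2 : nat -> H -> H) (C : nat -> R) :
  (forall n, regularizer (S := S) (W n) (W1 n) (W2 n) (C n)) ->
  exists F : nat -> H -> graph_space A,
    [/\ forall n, linear (F n),
        forall n x, rnorm (F n x) ^+ 2 = - rin (W1 n x) (W n x) &
        forall m n x, rnorm (F m x - F n x) ^+ 2 =
          - rin (W1 m x - W1 n x) (W m x - W n x)].
Proof.
move=> rW; have [L [Ll hL]] := dissipation_root.
have /choice[G hG] (p : nat * H) :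
    exists z : graph_space A, submodule_val z = W p.1 p.2 /\ A z = W1 p.1 p.2.
  exact: gen_opdom (reg_gen (rW p.1) p.2).
have Glin n : linear (fun x => G (n, x)).
  move=> a x y; apply: val_inj => /=.
  have [e _] := hG (n, a *: x + y); have [e1 _] := hG (n, x); have [e2 _] := hG (n, y).
  by rewrite e/= (reg_linear (rW n)) -e1 -e2.
exists (fun n x => L (G (n, x))); split.
- by move=> n a x y; rewrite Glin Ll.
- by move=> n x; rewrite hL; have [-> ->] := hG (n, x).
- move=> m n x; rewrite -(linear_sub Ll) hL graph_opB graph_valB.
  have [e1 e2] := hG (m, x); have [e3 e4] := hG (n, x).
  by rewrite e1 e2 e3 e4.
Qed.

End maximal_dissipative.

(** * Limits in L^2_loc *)

Section square_integrable_limit.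
Context {R : realType} {V : normedModType R[i]}.
Local Notation mu := (@lebesgue_measure R).
Local Notation itv0 T := (`[0, T]%classic : set (measurableTypeR R)).
Implicit Types (f g : R -> V) (T : R).

Definition sq_dist (T : R) f g : R := \int[mu]_(t in `[0, T]) rnorm (f t - g t) ^+ 2.

Lemma sq_dist_ge0 T f g : 0 <= sq_dist T f g.
Proof. by apply: Rintegral_ge0 => t _; exact: sqr_ge0. Qed.

Lemma sqr_rnormD_le (x y : V) : rnorm (x + y) ^+ 2 <= 2 * rnorm x ^+ 2 + 2 * rnorm y ^+ 2.
Proof.
have h : rnorm (x + y) ^+ 2 <= (rnorm x + rnorm y) ^+ 2.
  by rewrite lerXn2r ?nnegrE ?addr_ge0 ?rnorm_ge0// rnormD.
have := sqr_ge0 (rnorm x - rnorm y); nra.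
Qed.

Lemma locally_sq_integrableB f g : locally_sq_integrable f -> locally_sq_integrable g ->
  locally_sq_integrable (fun t => f t - g t).
Proof.
move=> hf hg T T0; have [mf fi] := hf T T0; have [mg gi] := hg T T0.
have m : strongly_measurable (itv0 T) (fun t => f t - g t).
  exact: strongly_measurableB.
split => //.
apply: (@integrable_le _ _ _ (fun t => 2 * rnorm (f t) ^+ 2 + 2 * rnorm (g t) ^+ 2)) => //.
- by apply: measurable_funX; exact: (strongly_measurable_rnorm _ m).
- by apply: integrable_addr => //; exact: integrable_mull.
- move=> t _; rewrite ger0_norm ?sqr_ge0//.
  by rewrite -(rnormN (g t)) sqr_rnormD_le.
Qed.

Lemma sq_dist_triangle T f g h : 0 <= T -> locally_sq_integrable f ->
  locally_sq_integrable g -> locally_sq_integrable h ->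
  sq_dist T f h <= 2 * sq_dist T f g + 2 * sq_dist T g h.
Proof.
move=> T0 hf hg hh.
have [_ i1] := locally_sq_integrableB hf hg T0; have [_ i2] := locally_sq_integrableB hg hh T0.
have [_ i3] := locally_sq_integrableB hf hh T0.
rewrite /sq_dist -RintegralZl// -[X in _ <= _ + X]RintegralZl// -RintegralD//;
  try exact: integrable_mull.
apply: le_Rintegral => //; first by apply: integrable_addr => //; exact: integrable_mull.
by move=> t _; rewrite -[f t - h t](subrKA (g t)) sqr_rnormD_le.
Qed.

Lemma simple_approx_sq_integrable f : simple_approx f -> locally_sq_integrable f.
Proof.
move=> hf T T0.
have m : strongly_measurable (itv0 T) f.
  exact: strongly_measurable_sub (@subset_itv0T R T) (simple_approx_measurable hf).
split => //; have [s [ss hs]] := hf T 1 ltr01; have [c hc] := simple_fun_bounded ss.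
apply: (@integrable_le _ _ _ (fun=> (1 + c) ^+ 2)) => //.
- by apply: measurable_funX; exact: (strongly_measurable_rnorm _ m).
- by apply: integrable_cstr => //; exact: lebesgue_itvcc_fin.
- move=> t /=; rewrite in_itv/= => /andP[t0 tT]; rewrite ger0_norm ?sqr_ge0//.
  have c0 : 0 <= c by apply: le_trans (rnorm_ge0 _) (hc 0).
  have h : rnorm (f t) <= 1 + c.
    have := rnorm_trans (s t) (f t) 0; rewrite !subr0 => h.
    by apply: le_trans h _; rewrite lerD ?hs.
  by rewrite lerXn2r ?nnegrE ?rnorm_ge0 ?addr_ge0.
Qed.

Hypothesis Vcomplete : seq_complete V.

Lemma cvg_half : (2^-1 : R) ^+ k @[k --> \oo] --> (0 : R).
Proof. by apply: cvg_expr; rewrite ger0_norm ?invr_ge0// invf_lt1// ltr1n. Qed.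

Lemma geometric_cauchy (u : nat -> V) (K : nat) :
  (forall k, (K <= k)%N -> rnorm (u k.+1 - u k) <= (2^-1 : R) ^+ k) ->
  exists l, rnorm (u n - l) @[n --> \oo] --> (0 : R).
Proof.
move=> hu; apply: Vcomplete => e e0.
have step n k : (K <= n)%N ->
    rnorm (u (n + k)%N - u n) <= 2 * (2^-1 : R) ^+ n - 2 * (2^-1 : R) ^+ (n + k).
  move=> Kn; elim: k => [|k IH]; first by rewrite addn0 !subrr rnorm0.
  rewrite addnS; apply: le_trans (rnorm_trans (u (n + k)%N) _ _) _.
  apply: le_trans (lerD (hu _ (leq_trans Kn (leq_addr _ _))) IH) _.
  rewrite exprS; lra.
have e2 : 0 < e / 2 by rewrite divr_gt0.
have /cvgrPdist_lt/(_ _ e2)[N _ hN] := cvg_half.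
have {}hN n : (N <= n)%N -> (2^-1 : R) ^+ n < e / 2.
  move=> /hN; rewrite sub0r normrN ger0_norm ?exprn_ge0 ?invr_ge0//.
exists (maxn N K).
have aux m n : (maxn N K <= n)%N -> (n <= m)%N -> rnorm (u m - u n) <= e.
  rewrite geq_max => /andP[Nn Kn] nm; rewrite -(subnKC nm).
  apply: le_trans (step _ _ Kn) _; have := hN _ Nn.
  have : 0 <= (2^-1 : R) ^+ (n + (m - n)) by rewrite exprn_ge0 ?invr_ge0.
  lra.
move=> m n Nm Nn; have [nm|/ltnW mn] := leqP n m; first exact: aux.
by rewrite rnormBC; exact: aux.
Qed.

Lemma chebyshev_sq (D : set (measurableTypeR R)) (d : R -> R) (c e : R) :
  measurable D -> measurable_fun D d -> (forall t, 0 <= d t) -> 0 < c ->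
  mu.-integrable D (EFin \o (fun t => d t ^+ 2)) ->
  \int[mu]_(t in D) d t ^+ 2 <= c ^+ 2 * e ->
  (mu (D `&` [set t | (c <= d t)%R]) <= e%:E)%E.
Proof.
move=> mD md d0 c0 di h; have c20 : 0 < c ^+ 2 by rewrite exprn_gt0.
have m2 : measurable_fun D (fun t => (d t ^+ 2)%:E) by exact: measurable_int di.
have := @le_integral_abse _ _ R mu D mD _ _ m2 c20.
have -> : D `&` [set t | ((c ^+ 2)%:E <= `|(d t ^+ 2)%:E|)%E] = D `&` [set t | (c <= d t)%R].
  apply/seteqP; split => t [h1 h2]; split => //; move: h2 => /=;
    by rewrite lee_fin ger0_norm ?sqr_ge0// ler_pXn2r ?nnegrE ?(ltW c0).
have -> : (\int[mu]_(t in D) `|(d t ^+ 2)%:E| = (\int[mu]_(t in D) d t ^+ 2)%:E)%E.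
  rewrite /Rintegral fineK; last exact: integrable_fin_num.
  by apply: eq_integral => t _; rewrite gee0_abs// lee_fin sqr_ge0.
move=> h2; rewrite -(@lee_pmul2l _ (c ^+ 2)%:E) ?lte_fin// -EFinM.
by apply: le_trans h2 _; rewrite lee_fin.
Qed.

(** Riesz-Fischer by a fast subsequence, with two additions: one subsequence serves all [T], its
    [k]-th step being measured on [[0, k]], and [F] is a limit of simple functions at every point of
    the half-line. *)
Lemma sq_integrable_limit (f : nat -> R -> V) :
  (forall n, simple_approx (f n)) ->
  (forall T e : R, 0 <= T -> 0 < e -> exists N, forall m n, (N <= m)%N -> (N <= n)%N ->
     sq_dist T (f m) (f n) <= e) ->
  exists F, [/\ strongly_measurable (`[0, +oo[%classic : set (measurableTypeR R)) F,
    locally_sq_integrable F &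
    forall T e : R, 0 <= T -> 0 < e -> exists N, forall n, (N <= n)%N ->
      sq_dist T F (f n) <= e].
Proof.
move=> hf cf.
have fl n := simple_approx_sq_integrable (hf n).
have h0 k : 0 < (2^-1 : R) ^+ k by rewrite exprn_gt0 ?invr_gt0.
(* Chebyshev at height [2 ^- k] then leaves an exceptional set of measure at most [2 ^- (k + 1)],
   which is summable. *)
pose del k : R := ((2^-1) ^+ k) ^+ 2 * (1 / (2 ^ (k + 1))%:R).
have del0 k : 0 < del k by rewrite mulr_gt0 ?exprn_gt0 ?divr_gt0// ltr0n expn_gt0.
have /choice[N hN] k : exists N, forall m n, (N <= m)%N -> (N <= n)%N ->
    sq_dist k%:R (f m) (f n) <= del k by exact: cf.
pose nn := fix nn k := if k is j.+1 then (nn j + (N k).+1)%N else N 0.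
have nnS k : (nn k < nn k.+1)%N by rewrite /= -[ltnLHS]addn0 ltn_add2l.
have nnN k : (N k <= nn k)%N.
  by case: k => //= k; apply: leq_trans (leqnSn _) _; exact: leq_addl.
have nnk k : (k <= nn k)%N by elim: k => // k IH; exact: leq_ltn_trans IH (nnS k).
pose d k t := rnorm (f (nn k.+1) t - f (nn k) t).
pose B k : set (measurableTypeR R) := itv0 k%:R `&` [set t | (2^-1) ^+ k <= d k t].
have md k : measurable_fun (itv0 k%:R) (d k).
  have [m _] := locally_sq_integrableB (fl (nn k.+1)) (fl (nn k)) (ler0n R k).
  exact: (strongly_measurable_rnorm _ m).
have mB k : measurable (B k).
  by apply: measurable_fun_le => //; exact: measurable_cst.
have Bsmall k : (mu (B k) <= (1 / (2 ^ (k + 1))%:R)%:E)%E.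
  apply: chebyshev_sq => //.
  - by move=> t; exact: rnorm_ge0.
  - by have [_] := locally_sq_integrableB (fl (nn k.+1)) (fl (nn k)) (ler0n R k).
  - by apply: hN => //; exact: leq_trans (nnN k) (ltnW (nnS k)).
(* Borel-Cantelli: outside the null set [L], consecutive terms of the subsequence are eventually
   closer than [2 ^- k]. *)
pose L := lim_sup_set B.
have L0 : mu L = 0.
  apply: lim_sup_set_cvg0 => //; apply: (@le_lt_trans _ _ 1%E); last exact: ltry.
  apply: (@le_trans _ _ (\sum_(0 <= k <oo) (1 / (2 ^ (k + 1))%:R : R)%:E)%E).
    by apply: lee_nneseries => [n _ _|n _]; [exact: measure_ge0|exact: Bsmall].
  have /cvg_lim -> // := @cvg_geometric_eseries_half R 1 0.
  by rewrite expr0 divr1.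
have mL : measurable L.
  by apply: bigcapT_measurable => n; apply: bigcup_measurable => k _; exact: mB.
pose E : set (measurableTypeR R) := `[0, +oo[%classic `\` L.
have mE : measurable E by apply: measurableD.
have tk (t : R) : 0 <= t -> exists K, forall k, (K <= k)%N -> t <= k%:R.
  move=> t0; exists (Num.truncn t).+1 => k tk; apply: ltW.
  by rewrite -truncn_lt_nat.
(* Off [E] the value is 0, to match the simple functions that are cut off to [E] below. *)
have /choice[F hF] t : exists l, (E t -> rnorm (f (nn k) t - l) @[k --> \oo] --> (0 : R)) /\
    (~ E t -> l = 0).
  have [Et|nEt] := pselect (E t); last by exists 0.
  suff [l hl] : exists l, rnorm (f (nn k) t - l) @[k --> \oo] --> (0 : R).
    by exists l; split => // /(_ Et).
  have [/=] := Et; rewrite in_itv/= andbT => t0 nLt.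
  have [K1 hK1] := tk t t0.
  have [K2 hK2] : exists K, forall k, (K <= k)%N -> ~ B k t.
    apply: contrapT => h; apply: nLt => n _; apply: contrapT => hn; apply: h.
    by exists n => k nk Bk; apply: hn; exists k.
  apply: (@geometric_cauchy (fun k => f (nn k) t) (maxn K1 K2)) => k.
  rewrite geq_max => /andP[k1 k2]; apply: ltW; rewrite ltNge; apply/negP => hd.
  by apply: (hK2 k k2); split => //=; rewrite in_itv/= t0 hK1.
have /choice[s hs] k : exists s : R -> V, simple_fun (s : measurableTypeR R -> V) /\
    forall t, 0 <= t -> t <= k%:R -> rnorm (f (nn k) t - s t) <= (2^-1 : R) ^+ k.
  by apply: hf.
have mF : strongly_measurable (`[0, +oo[%classic : set (measurableTypeR R)) F.
  exists (fun k t => if t \in E then s k t else 0); split.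
    by move=> k; apply: simple_fun_if mE _; have [] := hs k.
  move=> t /=; rewrite in_itv/= andbT => t0; have [h1 h2] := hF t.
  have [Et|nEt] := pselect (E t); last first.
    by rewrite memNset// h2//; exact: cvg_cst.
  rewrite mem_set//; apply/cvg_rnormP.
  have c : (2^-1 : R) ^+ k + rnorm (f (nn k) t - F t) @[k --> \oo] --> (0 : R).
    by rewrite -[X in _ --> X](addr0 (0 : R)); apply: cvgD (h1 Et); exact: cvg_half.
  have [K hK] := tk t t0.
  apply: cvgR0_le c; exists K => // k /= Kk; rewrite ger0_norm ?rnorm_ge0//.
  apply: le_trans (rnorm_trans (f (nn k) t) _ _) _; rewrite lerD2r rnormBC.
  by have [_] := hs k; apply => //; exact: hK.
have mFT T : strongly_measurable (itv0 T) F.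
  exact: strongly_measurable_sub (@subset_itv0T R T) mF.
have mFf T n : 0 <= T -> strongly_measurable (itv0 T) (fun t => F t - f n t).
  by move=> T0; have [mf _] := fl n T T0; exact: strongly_measurableB.
have key (T e : R) : 0 <= T -> 0 < e -> exists N, forall n, (N <= n)%N ->
    (\int[mu]_(t in itv0 T) (rnorm (F t - f n t) ^+ 2)%:E <= e%:E)%E.
  move=> T0 e0; have [M hM] := cf T e T0 e0; exists M => n Mn.
  have mr : measurable_fun (itv0 T) (fun t => (rnorm (F t - f n t) ^+ 2)%:E).
    apply/measurable_EFinP/measurable_funX.
    exact: (strongly_measurable_rnorm _ (mFf T n T0)).
  rewrite (ge0_negligible_integral mL)//; last by move=> t _; rewrite lee_fin sqr_ge0.
  (* The shift by [M] puts every index of the subsequence beyond the Cauchy threshold; Fatou carries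
     the bound to the limit. *)
  pose G k t := (rnorm (f (nn (k + M)%N) t - f n t) ^+ 2)%:E.
  have GiT k : mu.-integrable (itv0 T) (G k).
    by have [_] := locally_sq_integrableB (fl (nn (k + M)%N)) (fl n) T0.
  have mD : measurable (itv0 T `\` L) by exact: measurableD.
  have sD : itv0 T `\` L `<=` itv0 T by move=> t [].
  have mG k : measurable_fun (itv0 T `\` L) (G k).
    exact: measurable_funS sD (measurable_int _ (GiT k)).
  have G0 k t : (itv0 T `\` L) t -> (0 <= G k t)%E by rewrite lee_fin sqr_ge0.
  have -> : (\int[mu]_(t in itv0 T `\` L) (rnorm (F t - f n t) ^+ 2)%:E =
      \int[mu]_(t in itv0 T `\` L) limn_einf (G^~ t))%E.
    apply: eq_integral => t /set_mem[tT nLt].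
    have Et : E t by split => //; exact: (subset_itv0T tT).
    have [/(_ Et) c _] := hF t; apply/esym/(cvg_limn_einf_sup _).1.
    have c1 : f (nn (k + M)%N) t @[k --> \oo] --> F t.
      have c0 : f (nn k) t @[k --> \oo] --> F t by exact/cvg_rnormP.
      exact: (cvg_comp (fun k => k + M)%N (fun k => f (nn k) t) (cvg_addnr M) c0).
    have c2 : rnorm (f (nn (k + M)%N) t - f n t) @[k --> \oo] --> rnorm (F t - f n t).
      by apply: cvg_rnorm; apply: cvgB c1 _; exact: cvg_cst.
    by apply: cvg_EFin; [exact: nearW|apply: cvgM].
  apply: le_trans (fatou mu mD mG G0) _; rewrite limn_einf_lim.
  apply: lime_le; first exact: is_cvg_einfs.
  apply: nearW => k; apply: (@le_trans _ _ (\int[mu]_(t in itv0 T `\` L) G k t)%E).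
    by apply: ereal_inf_lbound; exists k => /=.
  apply: (@le_trans _ _ (\int[mu]_(t in itv0 T) G k t)%E).
    apply: ge0_subset_integral => //; first exact: measurable_int (GiT k).
    by move=> t _; rewrite lee_fin sqr_ge0.
  have := hM (nn (k + M)%N) n (leq_trans (leq_addl k M) (nnk _)) Mn.
  by rewrite -lee_fin /sq_dist /Rintegral fineK//; exact: (integrable_fin_num _ (GiT k)).
have FfiT T n e : 0 <= T ->
    (\int[mu]_(t in itv0 T) (rnorm (F t - f n t) ^+ 2)%:E <= e%:E)%E ->
    mu.-integrable (itv0 T) (EFin \o (fun t => rnorm (F t - f n t) ^+ 2)).
  move=> T0 h; apply/integrableP; split.
    apply/measurable_EFinP/measurable_funX.
    exact: (strongly_measurable_rnorm _ (mFf T n T0)).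
  apply: (@le_lt_trans _ _ e%:E); last exact: ltry.
  apply: le_trans h; rewrite le_eqVlt; apply/orP; left; apply/eqP.
  by apply: eq_integral => t _; rewrite gee0_abs// lee_fin sqr_ge0.
exists F; split => //.
- move=> T T0; split; first exact: mFT.
  have [M hM] := key T 1 T0 ltr01.
  have i1 := FfiT T M 1 T0 (hM M (leqnn M)).
  have [_ i2] := fl M T T0.
  apply: (@integrable_le _ _ _
    (fun t => 2 * rnorm (F t - f M t) ^+ 2 + 2 * rnorm (f M t) ^+ 2)) => //.
  + by apply: measurable_funX; exact: (strongly_measurable_rnorm _ (mFT T)).
  + by apply: integrable_addr => //; exact: integrable_mull.
  + move=> t _; rewrite ger0_norm ?sqr_ge0//.
    by rewrite -{1}[F t](subrK (f M t)) sqr_rnormD_le.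
- move=> T e T0 e0; have [M hM] := key T e T0 e0; exists M => n Mn.
  have h := hM n Mn; have i1 := FfiT T n e T0 h.
  by rewrite -lee_fin /sq_dist /Rintegral fineK//; exact: (integrable_fin_num _ i1).
Qed.

End square_integrable_limit.

Section ae_equality.
Context {R : realType} {V : lmodType R[i]}.
Local Notation mu := (@lebesgue_measure R).
Local Notation aeF := (ae_filter_ringOfSetsType mu).
Implicit Types (I J : set R) (f g h : R -> V).

Lemma aeE_sym I f g : f = g %[ae mu in I] -> g = f %[ae mu in I].
Proof. by apply: (@filterS _ _ aeF) => t e It; rewrite e. Qed.

Lemma aeE_trans I g f h :
  f = g %[ae mu in I] -> g = h %[ae mu in I] -> f = h %[ae mu in I].
Proof. by apply: (@filterS2 _ _ aeF) => t e1 e2 It; rewrite e1// e2. Qed.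

Lemma aeE_linear I (a : R[i]) f f' g g' :
  f = f' %[ae mu in I] -> g = g' %[ae mu in I] ->
  (fun t => a *: f t + g t) = (fun t => a *: f' t + g' t) %[ae mu in I].
Proof. by apply: (@filterS2 _ _ aeF) => t e1 e2 It; rewrite e1// e2. Qed.

Lemma aeE_sub I J f g : I `<=` J -> f = g %[ae mu in J] -> f = g %[ae mu in I].
Proof. by move=> IJ; apply: (@filterS _ _ aeF) => t e /IJ; exact: e. Qed.

Lemma aeE_refl I f g : (forall t, I t -> f t = g t) -> f = g %[ae mu in I].
Proof. by move=> fg; apply: aeW. Qed.

End ae_equality.

(** * Representatives of classes, restriction and extension by zero *)

Section L2loc_theory.
Context {R : realType} (I : set R) (V : normedModType R[i]).
Local Notation mu := (@lebesgue_measure R).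
Local Notation aeF := (ae_filter_ringOfSetsType mu).

Lemma l2repr_pi (f : l2fun I V) :
  l2repr (\pi_(L2loc I V) f)%qT = (f : R -> V) %[ae mu in I].
Proof.
have : repr (\pi_(L2loc I V) f)%qT - f \in @l2null R I V.
  by rewrite Quotient.idealrBE reprK.
move=> /asboolP; apply: (@filterS _ _ aeF) => t h It.
by apply/eqP; rewrite -subr_eq0; apply/eqP; exact: h.
Qed.

Lemma l2loc_eq (u v : L2loc I V) : l2repr u = l2repr v %[ae mu in I] -> u = v.
Proof.
move=> uv; rewrite -[u]reprK -[v]reprK; apply/eqP; rewrite -Quotient.idealrBE.
apply/asboolP; apply: (@filterS _ _ aeF) uv => t h It.
by rewrite -[LHS]/(repr u t - repr v t) -[repr u t]/(l2repr u t) h// subrr.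
Qed.

Lemma l2repr_linear (a : R[i]) (u v : L2loc I V) :
  l2repr (a *: u + v) = (fun t => a *: l2repr u t + l2repr v t) %[ae mu in I].
Proof.
have -> : a *: u + v = (\pi_(L2loc I V) (a *: repr u + repr v))%qT.
  have piZ : (\pi_(L2loc I V) (a *: repr u))%qT = a *: (\pi_(L2loc I V) (repr u))%qT.
    exact: l2scale_pi.
  by rewrite Quotient.pi_add piZ !reprK.
exact: l2repr_pi.
Qed.

End L2loc_theory.

Section L2loc_halfline.
Context {R : realType} {V : normedModType R[i]}.
Local Notation mu := (@lebesgue_measure R).
Local Notation aeF := (ae_filter_ringOfSetsType mu).
Local Notation itv0 T := (`[0, T]%classic : set (measurableTypeR R)).

Lemma sq_integrableE (T : R) (f : R -> V) : strongly_measurable (itv0 T) f ->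
  (\int[mu]_(t in `[0%R, T]) (rnorm (f t) ^+ 2)%:E < +oo)%E ->
  mu.-integrable (itv0 T) (EFin \o (fun t => rnorm (f t) ^+ 2)).
Proof.
move=> mf fi; apply/integrableP; split.
  apply/measurable_EFinP/measurable_funX.
  exact: (strongly_measurable_rnorm _ mf).
apply: le_lt_trans fi; rewrite le_eqVlt; apply/orP; left; apply/eqP.
by apply: eq_integral => t _; rewrite gee0_abs// lee_fin sqr_ge0.
Qed.

Lemma l2loc_locally_sq_integrable (f : R -> V) : f \in @l2loc R `[0, +oo[%classic V ->
  locally_sq_integrable f.
Proof.
move=> /asboolP[mf fi] T T0.
have m : strongly_measurable (itv0 T) f by exact: strongly_measurable_sub (@subset_itv0T R T) mf.
split => //; apply: sq_integrableE => //; apply: fi; first exact: segment_compact.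
exact: subset_itv0T.
Qed.

Lemma locally_sq_integrable_l2loc (f : R -> V) :
  strongly_measurable (`[0, +oo[%classic : set (measurableTypeR R)) f ->
  locally_sq_integrable f -> f \in @l2loc R `[0, +oo[%classic V.
Proof.
move=> mf fi; apply/asboolP; split => // K cK K0.
have [M hM] : exists M : R, 0 <= M /\ forall t, K t -> t <= M.
  have [M' [_ hM']] := compact_bounded cK.
  have := hM' (M' + 1); rewrite ltrDl ltr01 => /(_ isT); set M := M' + 1 => hM.
  exists (Num.max 0 M); split; first by rewrite le_max lexx.
  by move=> t Kt; rewrite le_max; apply/orP; right; apply: le_trans (hM _ Kt); exact: ler_norm.
have [M0 KM] := hM; have [m i] := fi M M0.
apply: (@le_lt_trans _ _ (\int[mu]_(t in itv0 M) (rnorm (f t) ^+ 2)%:E)%E).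
  apply: ge0_subset_integral => //.
  - exact: compact_measurable.
  - exact: measurable_int i.
  - by move=> t _; rewrite lee_fin sqr_ge0.
  - by move=> t Kt /=; rewrite in_itv/= KM// andbT; have := K0 _ Kt; rewrite /= in_itv/= andbT.
have mI : measurable (itv0 M) by [].
by rewrite ltey_eq (integrable_fin_num mI i).
Qed.

Lemma l2restrE (T : R) (u : L2loc_pos V) :
  l2repr (l2restr T u) = l2repr u %[ae mu in `[0, T]%classic].
Proof. exact: l2repr_pi. Qed.

Lemma l2restr_linear (T : R) : linear (@l2restr R V T).
Proof.
move=> a u v; apply: l2loc_eq.
apply: aeE_trans (l2restrE T _) _.
apply: aeE_trans (aeE_sub (@subset_itv0T R T) (l2repr_linear a u v)) _.
apply: aeE_trans (aeE_sym (l2repr_linear a _ _)).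
by apply: aeE_linear; apply: aeE_sym; exact: l2restrE.
Qed.

(** Extension by zero is a right inverse of the restriction to [[0, T]], through which [R_T] is
    obtained from the operator on the half-line. *)
Definition l2ext_fun (T : R) (f : R -> V) (t : R) : V :=
  if t \in itv0 T then f t else 0.

Lemma l2ext_fun_l2loc (T : R) (f : R -> V) : 0 <= T -> f \in @l2loc R `[0, T]%classic V ->
  l2ext_fun T f \in @l2loc R `[0, +oo[%classic V.
Proof.
move=> T0 /asboolP[[s [ss sf]] fi].
have mI : measurable (itv0 T) by [].
have me : strongly_measurable (`[0, +oo[%classic : set (measurableTypeR R)) (l2ext_fun T f).
  exists (fun n => l2ext_fun T (s n)); split.
    by move=> n; exact: simple_fun_if (ss n).
  move=> t _; rewrite /l2ext_fun; case: ifPn => [/set_mem tT|_]; first exact: sf.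
  exact: cvg_cst.
apply: locally_sq_integrable_l2loc => // T' T'0.
have m' : strongly_measurable (itv0 T') (l2ext_fun T f).
  exact: strongly_measurable_sub (@subset_itv0T R T') me.
split => //; apply: sq_integrableE => //.
have hT : (\int[mu]_(t in itv0 T) (rnorm (f t) ^+ 2)%:E < +oo)%E.
  by apply: fi => //; exact: segment_compact.
have mf : strongly_measurable (itv0 T) f by exists s.
have mT : measurable_fun (itv0 T) (fun t => (rnorm (f t) ^+ 2)%:E).
  apply/measurable_EFinP/measurable_funX; exact: (strongly_measurable_rnorm _ mf).
apply: le_lt_trans hT.
have -> : (\int[mu]_(t in itv0 T') (rnorm (l2ext_fun T f t) ^+ 2)%:E =
    \int[mu]_(t in itv0 T') ((fun t => (rnorm (f t) ^+ 2)%:E) \_ (itv0 T)) t)%E.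
  apply: eq_integral => t _; rewrite patchE /l2ext_fun; case: ifP => // _.
  by rewrite rnorm0 expr0n.
rewrite -integral_mkcondr; apply: ge0_subset_integral => //; first exact: measurableI.
by move=> t _; rewrite lee_fin sqr_ge0.
Qed.

Definition l2ext_l2fun (T : R) (T0 : 0 <= T) (f : l2fun `[0, T]%classic V) :
    l2fun `[0, +oo[%classic V :=
  L2fun (l2ext_fun_l2loc T0 (valP f)).

Definition l2ext (T : R) (T0 : 0 <= T) (u : L2 T V) : L2loc_pos V :=
  (\pi_(L2loc_pos V) (l2ext_l2fun T0 (repr u)))%qT.

Lemma l2extE (T : R) (T0 : 0 <= T) (u : L2 T V) :
  l2repr (l2ext T0 u) = l2ext_fun T (l2repr u) %[ae mu in `[0, +oo[%classic].
Proof. exact: l2repr_pi. Qed.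

Lemma l2ext_itv (T : R) (T0 : 0 <= T) (u : L2 T V) :
  l2repr (l2ext T0 u) = l2repr u %[ae mu in `[0, T]%classic].
Proof.
apply: aeE_trans (aeE_sub (@subset_itv0T R T) (l2extE T0 u)) _.
by apply: aeE_refl => t tT; rewrite /l2ext_fun mem_set.
Qed.

Lemma l2ext_linear (T : R) (T0 : 0 <= T) : linear (l2ext T0).
Proof.
move=> a u v; apply: l2loc_eq.
apply: aeE_trans (l2extE T0 _) _.
apply: aeE_trans (aeE_sym (l2repr_linear a _ _)).
apply: (aeE_trans (g := fun t => a *: l2ext_fun T (l2repr u) t + l2ext_fun T (l2repr v) t)).
  apply: (@filterS _ _ aeF) (l2repr_linear a u v) => t e _.
  by rewrite /l2ext_fun; case: ifPn => [/set_mem/e//|_]; rewrite scaler0 addr0.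
by apply: aeE_linear; apply: aeE_sym; exact: l2extE.
Qed.

End L2loc_halfline.

Section square_integrable_limits.
Context {R : realType} {V : normedModType R[i]}.
Local Notation mu := (@lebesgue_measure R).
Local Notation itv0 T := (`[0, T]%classic : set (measurableTypeR R)).

Lemma Rintegral_dominated_cvg (D : set (measurableTypeR R)) (fn : nat -> R -> R) (f g : R -> R) :
  measurable D -> (forall n, measurable_fun D (fn n)) -> mu.-integrable D (EFin \o g) ->
  (forall n t, D t -> `|fn n t| <= g t) ->
  (forall t, D t -> fn n t @[n --> \oo] --> f t) ->
  \int[mu]_(t in D) fn n t @[n --> \oo] --> \int[mu]_(t in D) f t.
Proof.
move=> mD mfn gi hfn cfn.
have mf : measurable_fun D f by exact: measurable_fun_cvg mfn cfn.
have := @dominated_convergence _ _ R mu D mD (fun n t => (fn n t)%:E) (EFin \o f) (EFin \o g).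
case.
- by move=> n; exact/measurable_EFinP.
- exact/measurable_EFinP.
- by apply: aeW => t Dt; apply: cvg_EFin; [exact: nearW|exact: cfn].
- exact: gi.
- by apply: aeW => t n Dt; rewrite lee_fin; exact: hfn.
move=> fi _ h; apply: fine_cvg; rewrite fineK//; exact: (integrable_fin_num mD fi).
Qed.

(** Pointwise [(d + b) ^ 2 <= (1 + h) b ^ 2 + (1 + 1 / h) d ^ 2], the difference being
    [(h b - d) ^ 2 / h]. With [h] free this does the work of the triangle inequality in [L^2]. *)
Lemma sq_integral_perturb (T h : R) (f g : R -> V) : 0 <= T -> 0 < h ->
  locally_sq_integrable f -> locally_sq_integrable g ->
  \int[mu]_(t in `[0, T]) rnorm (f t) ^+ 2 <=
  (1 + h) * (\int[mu]_(t in `[0, T]) rnorm (g t) ^+ 2) + (1 + h^-1) * sq_dist T f g.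
Proof.
move=> T0 h0 hf hg; have [_ i1] := hf T T0; have [_ i2] := hg T T0.
have [_ i3] := locally_sq_integrableB hf hg T0.
rewrite /sq_dist -RintegralZl// -[X in _ <= _ + X]RintegralZl// -RintegralD//;
    try exact: integrable_mull.
apply: le_Rintegral => //; first by apply: integrable_addr => //; exact: integrable_mull.
move=> t _; have := rnormD (f t - g t) (g t); rewrite subrK.
set a := rnorm (f t); set b := rnorm (g t); set d := rnorm (f t - g t).
have a0 : 0 <= a by exact: rnorm_ge0.
have b0 : 0 <= b by exact: rnorm_ge0.
have d0 : 0 <= d by exact: rnorm_ge0.
move=> abd; apply: (@le_trans _ _ ((d + b) ^+ 2)).
  by rewrite lerXn2r ?nnegrE ?addr_ge0.
rewrite -subr_ge0 (_ : _ - _ = h^-1 * (h * b - d) ^+ 2); last by field; rewrite gt_eqF.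
by rewrite mulr_ge0 ?invr_ge0 ?sqr_ge0 ?(ltW h0).
Qed.

Record sq_limit (f : nat -> R -> V) (F : R -> V) : Prop := SqLimit {
  sl_measurable : strongly_measurable (`[0, +oo[%classic : set (measurableTypeR R)) F ;
  sl_integrable : locally_sq_integrable F ;
  sl_cvg : forall T e : R, 0 <= T -> 0 < e -> exists N, forall n, (N <= n)%N ->
      sq_dist T F (f n) <= e }.

Lemma sq_distC T (f g : R -> V) : sq_dist T f g = sq_dist T g f.
Proof. by apply: eq_Rintegral => t _; rewrite rnormBC. Qed.

Lemma sq_dist_eq0 T (f g : R -> V) : 0 <= T -> locally_sq_integrable f ->
  locally_sq_integrable g -> sq_dist T f g = 0 -> f = g %[ae mu in `[0, T]%classic].
Proof.
move=> T0 hf hg h; have mI : measurable (itv0 T) by [].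
have [_ i] := locally_sq_integrableB hf hg T0.
have e0 : (\int[mu]_(t in itv0 T) `|(rnorm (f t - g t) ^+ 2)%:E| = 0)%E.
  transitivity (\int[mu]_(t in itv0 T) (rnorm (f t - g t) ^+ 2)%:E)%E.
    by apply: eq_integral => t _; rewrite gee0_abs// lee_fin sqr_ge0.
  by rewrite -(fineK (integrable_fin_num mI i)) -[X in X%:E]/(sq_dist T f g) h.
have := (ae_eq_integral_abs mu mI (measurable_int _ i)).1 e0.
apply: (@filterS _ _ (ae_filter_ringOfSetsType mu)) => t e tT.
have := e tT => /= -[/eqP]; rewrite sqrf_eq0 => /eqP/rnorm_eq0/eqP.
by rewrite subr_eq0 => /eqP.
Qed.

(** Two sequences that agree on [[0, T]] only are allowed, so that causality follows as well as
    linearity. *)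
Lemma sq_limit_unique T (f g : nat -> R -> V) F G : 0 <= T ->
  (forall n, locally_sq_integrable (f n)) -> (forall n, locally_sq_integrable (g n)) ->
  (forall n t, 0 <= t -> t <= T -> f n t = g n t) ->
  sq_limit f F -> sq_limit g G -> F = G %[ae mu in `[0, T]%classic].
Proof.
move=> T0 hf hg fg [_ hF cF] [_ hG cG]; apply: sq_dist_eq0 => //.
apply/eqP; rewrite eq_le sq_dist_ge0 andbT; apply/ler_addgt0Pl => e e0; rewrite addr0.
have e4 : 0 < e / 4 by rewrite divr_gt0.
have [N hN] := cF T _ T0 e4; have [M hM] := cG T _ T0 e4.
apply: le_trans (sq_dist_triangle T0 hF (hf (maxn N M)) hG) _.
have h1 := hN _ (leq_maxl N M); have h2 := hM _ (leq_maxr N M).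
rewrite (_ : sq_dist T (f (maxn N M)) G = sq_dist T G (g (maxn N M))); first lra.
rewrite sq_distC; apply: eq_Rintegral => t /set_mem/=; rewrite in_itv/= => /andP[t0 tT].
by rewrite fg.
Qed.

Lemma sq_limit_linear (a : R[i]) (f g : nat -> R -> V) F G :
  (forall n, locally_sq_integrable (f n)) -> (forall n, locally_sq_integrable (g n)) ->
  (forall n, locally_sq_integrable (fun t => a *: f n t + g n t)) ->
  locally_sq_integrable (fun t => a *: F t + G t) ->
  sq_limit f F -> sq_limit g G ->
  sq_limit (fun n t => a *: f n t + g n t) (fun t => a *: F t + G t).
Proof.
move=> hf hg hfg hFG [mF hF cF] [mG hG cG]; split => //.
  exact: (strongly_measurableD (strongly_measurableZ a mF) mG).
move=> T e T0 e0; pose c := complex.Re `|a| ^+ 2 + 1.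
have c0 : 0 < c by rewrite ltr_wpDl ?sqr_ge0.
have e4 : 0 < e / (4 * c) by rewrite divr_gt0// mulr_gt0.
have e4' : 0 < e / 4 by rewrite divr_gt0.
have [N hN] := cF T _ T0 e4; have [M hM] := cG T _ T0 e4'.
exists (maxn N M) => n; rewrite geq_max => /andP[Nn Mn].
have [_ i1] := locally_sq_integrableB hF (hf n) T0.
have [_ i2] := locally_sq_integrableB hG (hg n) T0.
have [_ i3] := locally_sq_integrableB hFG (hfg n) T0.
apply: (@le_trans _ _ (2 * c * sq_dist T F (f n) + 2 * sq_dist T G (g n))).
  rewrite /sq_dist -[X in _ <= X + _]RintegralZl// -[X in _ <= _ + X]RintegralZl// -RintegralD//;
    try exact: integrable_mull.
  apply: le_Rintegral => //; first by apply: integrable_addr => //; exact: integrable_mull.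
  move=> t _; rewrite opprD addrACA -scalerBr.
  apply: le_trans (sqr_rnormD_le _ _) _; rewrite lerD2r rnormZ exprMn mulrA.
  by rewrite ler_wpM2r ?sqr_ge0// ler_wpM2l// lerDl.
have := hN n Nn; have := hM n Mn => h1 h2.
have : 2 * c * sq_dist T F (f n) <= 2 * c * (e / (4 * c)).
  by rewrite ler_wpM2l// mulr_ge0// ltW.
rewrite (_ : 2 * c * (e / (4 * c)) = e / 2); first lra.
by field; rewrite gt_eqF.
Qed.

(** The perturbation bound is used in both directions, letting [n] grow before [h] shrinks. *)
Lemma sq_limit_norm T (f : nat -> R -> V) F q : 0 <= T ->
  (forall n, locally_sq_integrable (f n)) -> sq_limit f F ->
  \int[mu]_(t in `[0, T]) rnorm (f n t) ^+ 2 @[n --> \oo] --> q ->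
  \int[mu]_(t in `[0, T]) rnorm (F t) ^+ 2 = q.
Proof.
move=> T0 hf [_ hF cF] cq; set P := \int[mu]_(t in _) _.
have P0 : 0 <= P by apply: Rintegral_ge0 => t _; exact: sqr_ge0.
have q0 : 0 <= q.
  apply: (cvgr_to_ge cq); apply: nearW => n; apply: Rintegral_ge0 => t _; exact: sqr_ge0.
have cd : sq_dist T F (f n) @[n --> \oo] --> (0 : R).
  apply/cvgrPdist_le => e e0; have [N hN] := cF T e T0 e0.
  exists N => // n /= Nn; rewrite sub0r normrN ger0_norm ?sq_dist_ge0//; exact: hN.
have h1 h : 0 < h -> P <= (1 + h) * q.
  move=> h0; have c : (1 + h) * (\int[mu]_(t in `[0, T]) rnorm (f n t) ^+ 2) +
      (1 + h^-1) * sq_dist T F (f n) @[n --> \oo] --> (1 + h) * q + (1 + h^-1) * 0.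
    by apply: cvgD; (apply: cvgM; [exact: cvg_cst|]).
  rewrite mulr0 addr0 in c; apply: (cvgr_to_ge c); apply: nearW => n.
  exact: sq_integral_perturb.
have h2 h : 0 < h -> q <= (1 + h) * P.
  move=> h0; have c : (1 + h) * P + (1 + h^-1) * sq_dist T F (f n) -
      (\int[mu]_(t in `[0, T]) rnorm (f n t) ^+ 2) @[n --> \oo] -->
      (1 + h) * P + (1 + h^-1) * 0 - q.
    apply: cvgB => //; apply: cvgD; first exact: cvg_cst.
    by apply: cvgM => //; exact: cvg_cst.
  rewrite -subr_ge0; rewrite mulr0 addr0 in c; apply: (cvgr_to_ge c); apply: nearW => n.
  by rewrite subr_ge0 sq_distC; exact: sq_integral_perturb.
apply/eqP; rewrite eq_le; apply/andP; split; apply/ler_addgt0Pl => e e0.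
  have q1 : 0 < q + 1 by rewrite ltr_wpDl.
  (* The choice [h = e / (q + 1)] makes [h q] at most [e], also for [q = 0]. *)
  apply: le_trans (h1 _ (divr_gt0 e0 q1)) _.
  rewrite mulrDl mul1r addrC lerD2r mulrAC ler_pdivrMr// ler_wpM2l ?(ltW e0)//; lra.
have P1 : 0 < P + 1 by rewrite ltr_wpDl.
apply: le_trans (h2 _ (divr_gt0 e0 P1)) _.
rewrite mulrDl mul1r addrC lerD2r mulrAC ler_pdivrMr// ler_wpM2l ?(ltW e0)//; lra.
Qed.

End square_integrable_limits.

(** * The dissipation operator *)

Section dissipation.
Context {R : realType} {H : hilbertType R} {S : R -> H -> H} {V : normedModType R[i]}.
Hypothesis cS : contraction_semigroup S.
Local Notation mu := (@lebesgue_measure R).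
Local Notation hH := (@hilbert_rin R H).
Local Notation itv0 T := (`[0, T]%classic : set (measurableTypeR R)).

Hypothesis Vcomplete : seq_complete V.

Variables (W W1 W2 : nat -> H -> H) (C : nat -> R) (F : nat -> H -> V).
Hypothesis rW : forall n, regularizer (S := S) (W n) (W1 n) (W2 n) (C n).
Hypothesis W_norm : forall n x, rnorm (W n x) <= rnorm x.
Hypothesis W_cvg : forall x, rnorm (W n x - x) @[n --> \oo] --> (0 : R).
(* [F n] stands for [sqrt (- Re A) W n]. *)
Hypothesis F_linear : forall n, linear (F n).
Hypothesis F_norm : forall n x, rnorm (F n x) ^+ 2 = - rin (W1 n x) (W n x).
Hypothesis F_dist : forall m n x, rnorm (F m x - F n x) ^+ 2 =
  - rin (W1 m x - W1 n x) (W m x - W n x).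

Section fixed_forcing.
Variables (x0 : H) (g : R -> H).
Hypothesis g2 : locally_sq_integrable g.
Local Notation x := (trajectory (S := S) x0 g).
Local Notation fn := (fun n t => F n (x t)).

(** [F_norm] bounds [|F n z|^2] by [|W1 n z| |W n z|]; at [z = x t - x s] both factors are
    controlled by the clock. *)
Lemma dissipation_simple_approx n : simple_approx (fn n).
Proof.
apply: (clock_simple_approx g2) => T T0.
pose K := C n * (rnorm x0 + forcing_norm g 0 T + 1).
have C0 := reg_ge0 (rW n).
have K0 : 0 <= K by rewrite mulr_ge0// !addr_ge0 ?rnorm_ge0 ?forcing_norm_ge0.
exists K => // s t s0 st tT.
have w0 : 0 <= clock g t - clock g s.
  by rewrite (clockB g2)// addr_ge0 ?subr_ge0 ?forcing_norm_ge0.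
rewrite -(linear_sub (F_linear n)) -(@ler_pXn2r _ 2) ?nnegrE ?rnorm_ge0 ?(mulr_ge0 K0 w0)//.
rewrite F_norm (linear_sub (reg_linear (rW n))) (linear_sub (reg_linear1 (rW n))).
apply: le_trans (ler_norm _) _; rewrite normrN.
apply: le_trans (hf_le_norm hH _ _) _; rewrite expr2 ler_pM ?rnorm_ge0//.
  exact: (reg_dist1 cS g2 x0 (rW n) s0 st tT).
exact: (reg_dist cS g2 x0 (rW n) s0 st tT).
Qed.

Let fl n : locally_sq_integrable (fn n).
Proof. exact: simple_approx_sq_integrable (dissipation_simple_approx n). Qed.

(** The clock estimates are available for [W n x]; [x] is reached as the pointwise limit. *)
Lemma trajectory_measurable :
  strongly_measurable (`[0, +oo[%classic : set (measurableTypeR R)) x.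
Proof.
apply: (@simple_approx_cvg _ _ (fun n t => W n (x t))) => [n|t _]; last exact: W_cvg.
exact: (reg_simple_approx cS g2 x0 (rW n)).
Qed.

Lemma supply_integrable T : 0 <= T -> mu.-integrable (itv0 T) (EFin \o (fun t => rin (g t) (x t))).
Proof.
move=> T0; have [mg _] := g2 T0; have [gi _] := forcing_integrable g2 (lexx 0) T0.
apply: (@integrable_le _ _ _ (fun t => (rnorm x0 + forcing_norm g 0 T) * rnorm (g t))) => //.
- apply: strongly_measurable_rin => //.
  exact: strongly_measurable_sub (@subset_itv0T R T) trajectory_measurable.
- exact: integrable_mull.
- move=> t /=; rewrite in_itv/= => /andP[t0 tT].
  apply: le_trans (hf_le_norm hH _ _) _; rewrite mulrC ler_wpM2r ?rnorm_ge0//.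
  exact: trajectory_norm.
Qed.

Lemma dissipation_energy_approx n T : 0 <= T ->
  2^-1 * rnorm (W n (x T)) ^+ 2 - 2^-1 * rnorm (W n x0) ^+ 2 =
  \int[mu]_(t in `[0, T]) rin (W n (g t)) (W n (x t)) -
  \int[mu]_(t in `[0, T]) rnorm (fn n t) ^+ 2.
Proof.
move=> T0; rewrite (regularized_energy cS g2 x0 (rW n) T0); congr (_ + _).
have [_ i] := fl n T0.
rewrite -mulN1r -RintegralZl//; apply: eq_Rintegral => t _.
by rewrite F_norm mulN1r opprK.
Qed.

Lemma dissipation_dist m n T : 0 <= T ->
  sq_dist T (fn m) (fn n) =
  2^-1 * rnorm (W m x0 - W n x0) ^+ 2 - 2^-1 * rnorm (W m (x T) - W n (x T)) ^+ 2 +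
  \int[mu]_(t in `[0, T]) rin (W m (g t) - W n (g t)) (W m (x t) - W n (x t)).
Proof.
move=> T0; have := regularized_energy cS g2 x0 (regularizerB cS (rW m) (rW n)) T0.
have [_ i] := locally_sq_integrableB (fl m) (fl n) T0.
have -> : \int[mu]_(t in `[0, T]) rin (W1 m (x t) - W1 n (x t)) (W m (x t) - W n (x t)) =
    - sq_dist T (fn m) (fn n).
  rewrite -mulN1r -RintegralZl//; apply: eq_Rintegral => t _.
  by rewrite F_dist mulN1r opprK.
lra.
Qed.

Lemma forcing_approx_integrable n T : 0 <= T ->
  mu.-integrable (itv0 T) (EFin \o (fun t => rnorm (W n (g t) - g t))).
Proof.
move=> T0; have [mg _] := g2 T0; have [gi _] := forcing_integrable g2 (lexx 0) T0.
have mI : measurable (itv0 T) by [].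
apply: (@integrable_le _ _ _ (fun t => 2 * rnorm (g t))) => //.
- have mW := strongly_measurable_op (reg_linear (rW n)) (reg_bound (rW n)) mg.
  exact: (strongly_measurable_rnorm mI (strongly_measurableB mW mg)).
- exact: integrable_mull.
- move=> t _; rewrite ger0_norm ?rnorm_ge0//; apply: le_trans (rnormB_le _ _) _.
  by rewrite mulrDl mul1r lerD2r.
Qed.

Lemma forcing_approx T : 0 <= T ->
  \int[mu]_(t in `[0, T]) rnorm (W n (g t) - g t) @[n --> \oo] --> (0 : R).
Proof.
move=> T0; have [mg _] := g2 T0; have [gi _] := forcing_integrable g2 (lexx 0) T0.
have mI : measurable (itv0 T) by [].
have i0 : \int[mu]_(t in itv0 T) (0 : R) = 0 by rewrite Rintegral_cst// mul0r.
rewrite -[X in _ --> X]i0.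
apply: (@Rintegral_dominated_cvg _ _ (fun n t => rnorm (W n (g t) - g t)) (fun=> 0)
  (fun t => 2 * rnorm (g t))) => //.
- by move=> n; have := forcing_approx_integrable n T0 => /measurable_int/measurable_EFinP.
- exact: integrable_mull.
- move=> n t _; rewrite ger0_norm ?rnorm_ge0//; apply: le_trans (rnormB_le _ _) _.
  by rewrite mulrDl mul1r lerD2r.
Qed.

(** [2 * M] bounds [|W m x - W n x|] on [[0, T]], so the supply is controlled by the [L^1] distance
    of [W m g] and [W n g], small by dominated convergence. *)
Lemma dissipation_cauchy T e : 0 <= T -> 0 < e -> exists N, forall m n,
  (N <= m)%N -> (N <= n)%N -> sq_dist T (fn m) (fn n) <= e.
Proof.
move=> T0 e0; pose M := rnorm x0 + forcing_norm g 0 T.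
have M0 : 0 <= M by rewrite addr_ge0 ?rnorm_ge0 ?forcing_norm_ge0.
pose a n := \int[mu]_(t in itv0 T) rnorm (W n (g t) - g t).
have bnd m n : sq_dist T (fn m) (fn n) <=
    (rnorm (W m x0 - x0) ^+ 2 + rnorm (W n x0 - x0) ^+ 2) + 2 * M * (a m + a n).
  rewrite dissipation_dist// -addrA lerD//.
    rewrite -[W m x0 - W n x0](subrKA x0).
    have := sqr_rnormD_le (W m x0 - x0) (x0 - W n x0); rewrite (rnormBC x0); lra.
  have sq0 : 0 <= 2^-1 * rnorm (W m (x T) - W n (x T)) ^+ 2.
    by rewrite mulr_ge0 ?invr_ge0 ?sqr_ge0.
  apply: (@le_trans _ _ (\int[mu]_(t in itv0 T)
    rin (W m (g t) - W n (g t)) (W m (x t) - W n (x t)))); first by rewrite gerDr oppr_le0.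
  have iD : mu.-integrable (itv0 T)
      (EFin \o (fun t => rnorm (W m (g t) - g t) + rnorm (W n (g t) - g t))).
    by apply: integrable_addr => //; exact: forcing_approx_integrable.
  apply: le_trans (ler_norm _) _.
  have -> : 2 * M * (a m + a n) = \int[mu]_(t in itv0 T)
      (2 * M * (rnorm (W m (g t) - g t) + rnorm (W n (g t) - g t))).
    rewrite RintegralZl// RintegralD//; exact: forcing_approx_integrable.
  apply: Rintegral_norm_le => //.
  - have := reg_supply_integrable cS g2 x0 (regularizerB cS (rW m) (rW n)) T0.
    by move=> /measurable_int/measurable_EFinP.
  - exact: integrable_mull.
  - move=> t /=; rewrite in_itv/= => /andP[t0 tT].
    apply: le_trans (hf_le_norm hH _ _) _; rewrite mulrC ler_pM ?rnorm_ge0//.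
      apply: le_trans (rnormB_le _ _) _; rewrite mulrDl mul1r.
      have hx := trajectory_norm cS g2 x0 t0 tT.
      by rewrite lerD// (le_trans (W_norm _ _) hx).
    rewrite -[W m (g t) - W n (g t)](subrKA (g t)); apply: le_trans (rnormD _ _) _.
    by rewrite [rnorm (g t - _)]rnormBC.
have cv : rnorm (W n x0 - x0) ^+ 2 + 2 * M * a n @[n --> \oo] --> (0 : R).
  rewrite -[X in _ --> X](_ : 0 * 0 + 2 * M * 0 = 0); last by rewrite !mulr0 addr0.
  apply: cvgD; first by apply: cvgM; exact: W_cvg.
  by apply: cvgM; [exact: cvg_cst|exact: forcing_approx].
have e2 : 0 < e / 2 by rewrite divr_gt0.
have /cvgrPdist_lt/(_ _ e2)[N _ hN] := cv.
exists N => m n Nm Nn; apply: le_trans (bnd m n) _.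
have := hN m Nm; have := hN n Nn; rewrite /= !sub0r !normrN !ltr_norml.
by move=> /andP[_ h1] /andP[_ h2]; lra.
Qed.

Lemma dissipation_limit : exists D, sq_limit fn D.
Proof.
have [D [mD lD cD]] := sq_integrable_limit Vcomplete dissipation_simple_approx dissipation_cauchy.
by exists D; split.
Qed.

Lemma dissipation_energy D T : sq_limit fn D -> 0 <= T ->
  2^-1 * rnorm (x T) ^+ 2 - 2^-1 * rnorm x0 ^+ 2 =
  \int[mu]_(t in `[0, T]) rin (g t) (x t) - \int[mu]_(t in `[0, T]) rnorm (D t) ^+ 2.
Proof.
move=> hD T0.
have cn y : rnorm (W n y) @[n --> \oo] --> rnorm y.
  by apply: cvg_rnorm; apply/cvg_rnormP.
have csq y : 2^-1 * rnorm (W n y) ^+ 2 @[n --> \oo] --> 2^-1 * rnorm y ^+ 2.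
  by apply: cvgM; [exact: cvg_cst|apply: cvgM; exact: cn].
have [gi _] := forcing_integrable g2 (lexx 0) T0.
have cs : \int[mu]_(t in itv0 T) rin (W n (g t)) (W n (x t)) @[n --> \oo] -->
    \int[mu]_(t in itv0 T) rin (g t) (x t).
  apply: (@Rintegral_dominated_cvg _ _ (fun n t => rin (W n (g t)) (W n (x t))) _
    (fun t => (rnorm x0 + forcing_norm g 0 T) * rnorm (g t))) => //.
  - move=> n; have := reg_supply_integrable cS g2 x0 (rW n) T0.
    by move=> /measurable_int/measurable_EFinP.
  - exact: integrable_mull.
  - move=> n t /=; rewrite in_itv/= => /andP[t0 tT].
    apply: le_trans (hf_le_norm hH _ _) _; rewrite mulrC ler_pM ?rnorm_ge0//.
    exact: le_trans (W_norm _ _) (trajectory_norm cS g2 x0 t0 tT).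
  - move=> t _.
    have -> : (fun n => rin (W n (g t)) (W n (x t))) =
        (fun n => rin (W n (g t) - g t) (W n (x t)) + rin (W n (x t)) (g t)).
      by apply/funext => n; rewrite (hfB hH) (hfC hH (W n (x t))) subrK.
    rewrite (hfC hH (g t)) -[X in _ --> X]add0r; apply: cvgD; last first.
      by apply: (hf_cvg hH); exact: W_cvg.
    have c : rnorm (W n (g t) - g t) * rnorm (x t) @[n --> \oo] --> (0 : R).
      by rewrite -(mul0r (rnorm (x t))); apply: cvgM; [exact: W_cvg|exact: cvg_cst].
    apply: cvgR0_le c; apply: nearW => n; apply: le_trans (hf_le_norm hH _ _) _.
    by rewrite ler_wpM2l ?rnorm_ge0.
have cD : \int[mu]_(t in `[0, T]) rnorm (fn n t) ^+ 2 @[n --> \oo] -->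
    \int[mu]_(t in itv0 T) rin (g t) (x t) - (2^-1 * rnorm (x T) ^+ 2 - 2^-1 * rnorm x0 ^+ 2).
  have -> : (fun n => \int[mu]_(t in `[0, T]) rnorm (fn n t) ^+ 2) =
     (fun n => \int[mu]_(t in `[0, T]) rin (W n (g t)) (W n (x t)) -
       (2^-1 * rnorm (W n (x T)) ^+ 2 - 2^-1 * rnorm (W n x0) ^+ 2)).
    by apply/funext => n; rewrite dissipation_energy_approx// subKr.
  by apply: cvgB => //; apply: cvgB; exact: csq.
by rewrite (sq_limit_norm T0 fl hD cD) subKr.
Qed.

End fixed_forcing.

End dissipation.

Lemma linear_pack {K : pzRingType} {V W : lmodType K} (f : V -> W) :
  linear f -> exists g : {linear V -> W}, forall x, g x = f x.
Proof.
by move=> lf; exists (HB.pack_for {linear V -> W} f (GRing.isLinear.Build K V W *:%R f lf)).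
Qed.

(** * Dependence of trajectories on the data *)

Section trajectory_theory.
Context {R : realType} {H : hilbertType R} {S : R -> H -> H}.
Hypothesis cS : contraction_semigroup S.
Local Notation mu := (@lebesgue_measure R).
Local Notation aeF := (ae_filter_ringOfSetsType mu).

Lemma trajectory_ae (x0 : H) (g1 g2 : R -> H) (T t : R) :
  locally_sq_integrable g1 -> locally_sq_integrable g2 -> g1 = g2 %[ae mu in `[0, T]%classic] ->
  0 <= t -> t <= T -> trajectory (S := S) x0 g1 t = trajectory (S := S) x0 g2 t.
Proof.
move=> h1 h2 e t0 tT; congr (_ + _).
apply: ae_eq_wint (sg_forcing_dominated cS h1 (lexx 0) t0 (lexx t))
  (sg_forcing_dominated cS h2 (lexx 0) t0 (lexx t)) _.
apply: (@filterS _ _ aeF) e => s e /=; rewrite in_itv/= => /andP[s0 st].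
by rewrite e//= in_itv/= s0 (le_trans st).
Qed.

(** The forcing of a combination is given only up to equality a.e., because the representative of a
    sum of classes is chosen afresh. *)
Lemma trajectory_linear (a : R[i]) (x0 y0 : H) (g1 g2 g : R -> H) (T t : R) :
  locally_sq_integrable g1 -> locally_sq_integrable g2 -> locally_sq_integrable g ->
  g = (fun t => a *: g1 t + g2 t) %[ae mu in `[0, T]%classic] ->
  0 <= t -> t <= T -> trajectory (S := S) (a *: x0 + y0) g t =
    a *: trajectory (S := S) x0 g1 t + trajectory (S := S) y0 g2 t.
Proof.
move=> h1 h2 h3 e t0 tT; rewrite /trajectory (sg_linear cS)// scalerDr addrACA; congr (_ + _).
have d1 := sg_forcing_dominated cS h1 (lexx 0) t0 (lexx t).
have d2 := sg_forcing_dominated cS h2 (lexx 0) t0 (lexx t).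
have d3 := sg_forcing_dominated cS h3 (lexx 0) t0 (lexx t).
have da : dominated `[0, t] (fun s => a *: S (t - s) (g1 s))
    (fun s => complex.Re `|a| * rnorm (g1 s)).
  apply: (dominated_op (W := *:%R a) _ _ _ d1).
  - by move=> b u v; rewrite scalerDr !scalerA mulrC.
  - by move=> u; rewrite rnormZ.
  - by rewrite normc_def/= sqrtr_ge0.
rewrite -(wintZ a d1) -(wintD da d2).
apply: ae_eq_wint d3 (dominatedD da d2) _.
apply: (@filterS _ _ aeF) e => s e /=; rewrite in_itv/= => /andP[s0 st].
rewrite e/= ?in_itv/= ?s0 ?(le_trans st)//.
by rewrite (sg_linear cS)// subr_ge0.
Qed.

End trajectory_theory.

Section mild_solution.
Context {R : realType} {H U : hilbertType R} {A : linop H} {B : {linear U -> H}}.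
Hypothesis mA : maximal_dissipative A.
Local Notation mu := (@lebesgue_measure R).

Lemma bounded_op : bounded_near B (nbhs (0 : U)) ->
  exists2 C : R, 0 <= C & forall u, rnorm (B u) <= C * rnorm u.
Proof.
move=> /linear_boundedP[[m m'] []]; rewrite realE !lecE/= => mr hM.
have m0 : m' = 0 by case/orP: mr => /andP[/eqP].
have C0 : 0 <= Num.max 0 m by rewrite le_max lexx.
(* The bound holds for every constant strictly above [m], which may be negative. *)
exists (Num.max 0 m + 1); first by rewrite addr_ge0.
have mC : (m +i* m')%C < (Num.max 0 m + 1)%:C.
  by rewrite ltcE/= m0 eqxx/= (@le_lt_trans _ _ (Num.max 0 m)) ?ltrDl// le_max lexx orbT.
by move=> u; have := hM _ mC u; rewrite !rnormE -rmorphM/= lecR.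
Qed.

Lemma mild_solutionE (x0 : H) (u : R -> U) (t : R) :
  locally_sq_integrable (fun s => B (u s)) -> 0 <= t ->
  mild_solution A B x0 u t = trajectory (S := semigroup_of A) x0 (fun s => B (u s)) t.
Proof.
move=> h t0; congr (_ + _); have [cS _] := semigroup_ofP mA.
apply: (bochner_wint _ _ (sg_forcing_dominated cS h (lexx 0) t0 (lexx t))).
  exact: lebesgue_itvcc_fin.
exact: (sg_forcing_measurable cS h (lexx 0) t0 (lexx t)).
Qed.

Lemma dissipation_family : exists (W W1 W2 : nat -> H -> H) (C : nat -> R)
    (F : nat -> H -> graph_space A),
  [/\ forall n, regularizer (S := semigroup_of A) (W n) (W1 n) (W2 n) (C n),
      (forall n x, rnorm (W n x) <= rnorm x) /\
      (forall x, rnorm (W n x - x) @[n --> \oo] --> (0 : R)),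
      forall n, linear (F n),
      forall n x, rnorm (F n x) ^+ 2 = - rin (W1 n x) (W n x) &
      forall m n x, rnorm (F m x - F n x) ^+ 2 =
        - rin (W1 m x - W1 n x) (W m x - W n x)].
Proof.
have [cS _] := semigroup_ofP mA.
have h0 n : 0 < n.+1%:R^-1 :> R by rewrite invr_gt0.
have /choice[C hC] n := double_mean_regularizer cS (h0 n).
have [F [F1 F2 F3]] := regularizer_root mA hC.
do 5!eexists; split; [exact: hC|split|exact: F1|exact: F2|exact: F3].
- by move=> n x; exact: double_mean_norm.
- by move=> x; exact: double_mean_cvg.
Qed.

End mild_solution.

Lemma locally_sq_integrable_linear {R : realType} {V : normedModType R[i]} (a : R[i])
    (f g : R -> V) : locally_sq_integrable f -> locally_sq_integrable g ->
  locally_sq_integrable (fun t => a *: f t + g t).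
Proof.
move=> hf hg T T0; have [mf fi] := hf T T0; have [mg gi] := hg T T0.
have m := strongly_measurableD (strongly_measurableZ a mf) mg.
split => //.
apply: (@integrable_le _ _ _ (fun t => 2 * complex.Re `|a| ^+ 2 * rnorm (f t) ^+ 2 +
    2 * rnorm (g t) ^+ 2)) => //.
- by apply: measurable_funX; exact: (strongly_measurable_rnorm _ m).
- by apply: integrable_addr => //; exact: integrable_mull.
- move=> t _; rewrite ger0_norm ?sqr_ge0//; apply: le_trans (sqr_rnormD_le _ _) _.
  by rewrite rnormZ exprMn mulrA.
Qed.

Lemma locally_sq_integrable_op {R : realType} {U V : normedModType R[i]} (W : U -> V) (C : R)
    (f : R -> U) : linear W -> 0 <= C -> (forall x, rnorm (W x) <= C * rnorm x) ->
  locally_sq_integrable f -> locally_sq_integrable (fun t => W (f t)).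
Proof.
move=> Wl C0 WC hf T T0; have [mf fi] := hf T T0.
have m := strongly_measurable_op Wl WC mf; split => //.
apply: (@integrable_le _ _ _ (fun t => C ^+ 2 * rnorm (f t) ^+ 2)) => //.
- by apply: measurable_funX; exact: (strongly_measurable_rnorm _ m).
- exact: integrable_mull.
- move=> t _; rewrite ger0_norm ?sqr_ge0// -exprMn.
  by rewrite lerXn2r ?nnegrE ?mulr_ge0 ?rnorm_ge0.
Qed.

Lemma aeE_halfline {R : realType} {V : lmodType R[i]} (f g : R -> V) :
  (forall T : R, 0 <= T -> f = g %[ae lebesgue_measure in `[0, T]%classic]) ->
  f = g %[ae lebesgue_measure in `[0, +oo[%classic].
Proof.
move=> h; have := ae_foralln (fun n : nat => h n%:R (ler0n R n)).
apply: (@filterS _ _ (ae_filter_ringOfSetsType _)) => t e /=; rewrite in_itv/= andbT => t0.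
apply: (e (Num.truncn t).+1); rewrite /= in_itv/= t0/=; apply: ltW.
by rewrite -truncn_lt_nat.
Qed.

Lemma l2repr_measurable {R : realType} {V : normedModType R[i]} (I : set R) (u : L2loc I V) :
  strongly_measurable (I : set (measurableTypeR R)) (l2repr u).
Proof. by have /asboolP[] := valP (repr u). Qed.

Lemma l2repr_measurable_itv {R : realType} {V : normedModType R[i]} (T : R) (u : L2loc_pos V) :
  strongly_measurable (`[0, T]%classic : set (measurableTypeR R)) (l2repr u).
Proof. exact: strongly_measurable_sub (@subset_itv0T R T) (l2repr_measurable u). Qed.

Lemma sq_integral_ae {R : realType} {V : normedModType R[i]} (T : R) (f g : R -> V) :
  strongly_measurable (`[0, T]%classic : set (measurableTypeR R)) f ->
  strongly_measurable (`[0, T]%classic : set (measurableTypeR R)) g ->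
  f = g %[ae lebesgue_measure in `[0, T]%classic] ->
  \int[lebesgue_measure]_(t in `[0, T]) rnorm (f t) ^+ 2 =
  \int[lebesgue_measure]_(t in `[0, T]) rnorm (g t) ^+ 2.
Proof.
move=> mf mg e; apply: Rintegral_ae_eq => //.
- by apply: measurable_funX; exact: (strongly_measurable_rnorm _ mf).
- by apply: measurable_funX; exact: (strongly_measurable_rnorm _ mg).
- by apply: (@filterS _ _ (ae_filter_ringOfSetsType _)) e => t e tT; rewrite e.
Qed.

Theorem proposition1 (R : realType) (H U : hilbertType R) (A : linop H)
    (B : {linear U -> H}) :
  maximal_dissipative A -> bounded_near B (nbhs (0 : U)) ->
  exists Rop : {linear (H * L2loc_pos U)%type -> L2loc_pos (graph_space A)},
    (forall (x0 : H) (u : L2loc_pos U) (T : R), 0 < T ->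
      let x := mild_solution A B x0 (l2repr u) in
      let y := fun t => adjoint B (x t) in
      2^-1 * rnorm (x T) ^+ 2 - 2^-1 * rnorm x0 ^+ 2 =
        \int[lebesgue_measure]_(t in `[0, T])
          complex.Re (inner (l2repr u t) (y t))
        - \int[lebesgue_measure]_(t in `[0, T])
            rnorm (l2repr (Rop (x0, u)) t) ^+ 2) /\
    (forall T : R, 0 < T ->
      (forall u1 u2 : L2loc_pos U,
        l2repr u1 = l2repr u2 %[ae lebesgue_measure in `[0, T]%classic] ->
        forall x0 : H,
          l2repr (Rop (x0, u1)) = l2repr (Rop (x0, u2))
            %[ae lebesgue_measure in `[0, T]%classic]) /\
      (exists RT : {linear (H * L2 T U)%type -> L2 T (graph_space A)},
        (forall (x0 : H) (u : L2loc_pos U),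
          RT (x0, l2restr T u) = l2restr T (Rop (x0, u))) /\
        (exists M : R, forall (x0 : H) (u : L2 T U),
          l2norm (RT (x0, u)) <=
            M * Num.sqrt (rnorm x0 ^+ 2 + l2norm u ^+ 2)))).
Proof.
move=> mA bB.
have [Cb Cb0 hB] := bounded_op bB.
have [cS _] := semigroup_ofP mA.
have [W [W1 [W2 [C [F [rW [Wn Wc] Fl Fn Fd]]]]]] := dissipation_family mA.
have Vc := hf_complete (hilbert_graph mA).
pose G (u : L2loc_pos U) t := B (l2repr u t).
have Blin : linear B by exact: linearP.
have uL2 (u : L2loc_pos U) : locally_sq_integrable (l2repr u).
  exact: l2loc_locally_sq_integrable (valP (repr u)).
have G2 u : locally_sq_integrable (G u).
  exact: (locally_sq_integrable_op Blin Cb0 hB (uL2 u)).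
pose fn (p : H * L2loc_pos U) n t := F n (trajectory (S := semigroup_of A) p.1 (G p.2) t).
have fl p n : locally_sq_integrable (fn p n).
  apply: simple_approx_sq_integrable.
  exact: (dissipation_simple_approx cS rW Fl Fn p.1 (G2 p.2)).
(* [D p] is picked separately for each [p]; it becomes linear and causal in [p] only modulo equality
   a.e., by uniqueness of [L^2] limits. *)
have /choice[D hD] p : exists D, sq_limit (fn p) D.
  exact: (dissipation_limit cS Vc rW Wn Wc Fl Fn Fd p.1 (G2 p.2)).
have D2 p : D p \in @l2loc R `[0, +oo[%classic (graph_space A).
  by apply: locally_sq_integrable_l2loc; [exact: sl_measurable (hD p)|exact: sl_integrable (hD p)].
pose Rf p : L2loc_pos (graph_space A) := (\pi_(L2loc_pos (graph_space A)) (L2fun (D2 p)))%qT.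
have RE p : l2repr (Rf p) = D p %[ae lebesgue_measure in `[0, +oo[%classic].
  exact: l2repr_pi.
have RET p T : l2repr (Rf p) = D p %[ae lebesgue_measure in `[0, T]%classic].
  exact: aeE_sub (@subset_itv0T R T) (RE p).
have causal (T : R) x0 u1 u2 : 0 <= T ->
    l2repr u1 = l2repr u2 %[ae lebesgue_measure in `[0, T]%classic] ->
    l2repr (Rf (x0, u1)) = l2repr (Rf (x0, u2)) %[ae lebesgue_measure in `[0, T]%classic].
  move=> T0 e; apply: aeE_trans (RET _ T) _; apply: aeE_trans (aeE_sym (RET _ T)).
  apply: (sq_limit_unique T0 (fl _) (fl _) _ (hD _) (hD _)) => n t t0 tT.
  congr (F n _); apply: (trajectory_ae cS _ (G2 _) (G2 _) _ t0 tT).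
  by apply: (@filterS _ _ (ae_filter_ringOfSetsType _)) e => s e sT; rewrite /G e.
have Rlin : linear Rf.
  move=> a p q; apply: l2loc_eq; apply: aeE_trans (RE _) _.
  apply: aeE_trans (aeE_sym (l2repr_linear a _ _)).
  apply: (aeE_trans (g := fun t => a *: D p t + D q t)); last first.
    by apply: aeE_linear; apply: aeE_sym; exact: RE.
  apply: aeE_halfline => T T0.
  have lpq := locally_sq_integrable_linear a (sl_integrable (hD p)) (sl_integrable (hD q)).
  have lf n := locally_sq_integrable_linear a (fl p n) (fl q n).
  apply: (sq_limit_unique T0 (fl _) lf _ (hD _)
    (sq_limit_linear (fl p) (fl q) lf lpq (hD p) (hD q))) => n t t0 tT.
  rewrite /fn -Fl; congr (F n _).
  apply: (trajectory_linear cS _ _ (G2 _) (G2 _) (G2 _) _ t0 tT).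
  apply: (@filterS _ _ (ae_filter_ringOfSetsType _)) (l2repr_linear a p.2 q.2) => s e sT.
  by rewrite /G -Blin e//; exact: subset_itv0T sT.
have [Rop hR] := linear_pack Rlin.
have energy (x0 : H) u (T : R) : 0 < T ->
    2^-1 * rnorm (trajectory (S := semigroup_of A) x0 (G u) T) ^+ 2 - 2^-1 * rnorm x0 ^+ 2 =
    \int[lebesgue_measure]_(t in `[0, T])
      rin (G u t) (trajectory (S := semigroup_of A) x0 (G u) t) -
    \int[lebesgue_measure]_(t in `[0, T]) rnorm (l2repr (Rf (x0, u)) t) ^+ 2.
  move=> T0; rewrite (dissipation_energy cS rW Wn Wc Fl Fn (G2 u) (hD (x0, u)) (ltW T0)).
  congr (_ - _); apply: sq_integral_ae (aeE_sym (RET (x0, u) T)).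
    by have [] := sl_integrable (hD (x0, u)) (ltW T0).
  exact: l2repr_measurable_itv.
exists Rop; split.
  move=> x0 u T T0 /=; rewrite hR (mild_solutionE mA _ (G2 u) (ltW T0)) (energy x0 u T T0).
  congr (_ - _); apply: eq_Rintegral => t /set_mem/=; rewrite in_itv/= => /andP[t0 tT].
  by rewrite (mild_solutionE mA _ (G2 u) t0) -[RHS]/(rin _ _) (adjointE hB).
move=> T T0; have T0' := ltW T0; split.
  by move=> u1 u2 e x0; rewrite !hR; exact: causal.
(* Extension by zero is one choice of extension; causality makes the result independent of it. *)
pose RTf (p : H * L2 T U) : L2 T (graph_space A) := l2restr T (Rf (p.1, l2ext T0' p.2)).
have RTlin : linear RTf.
  move=> a p q; have l := l2ext_linear T0' a p.2 q.2.
  rewrite -[LHS]/(l2restr T (Rf (a *: p.1 + q.1, l2ext T0' (a *: p.2 + q.2)))) l.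
  have r := Rlin a (p.1, l2ext T0' p.2) (q.1, l2ext T0' q.2).
  transitivity (l2restr T (a *: Rf (p.1, l2ext T0' p.2) + Rf (q.1, l2ext T0' q.2))).
    by congr (l2restr T _); exact: r.
  exact: l2restr_linear.
have [RT hRT] := linear_pack RTlin.
exists RT; split.
  move=> x0 u; rewrite hRT hR; apply: l2loc_eq.
  apply: aeE_trans (l2restrE T _) _; apply: aeE_trans (aeE_sym (l2restrE T _)).
  apply: causal => //; apply: aeE_trans (l2ext_itv T0' _) _; exact: l2restrE.
(* With [X = |x0|], [L] the squared norm of [u] and [N] the integral of [|B u|], the bounds
   [E <= 2 X ^ 2 + 2 N ^ 2] and [N ^ 2 <= T * Cb ^ 2 * L] make [E] at most the square of this
   constant times [X ^ 2 + L]. *)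
exists (Num.sqrt (2 + 2 * T * Cb ^+ 2)) => x0 u; rewrite hRT.
pose v := l2ext T0' u; pose x := trajectory (S := semigroup_of A) x0 (G v).
have hx t : 0 <= t -> t <= T -> rnorm (x t) <= rnorm x0 + forcing_norm (G v) 0 T.
  by move=> t0 tT; exact: (trajectory_norm cS (G2 v) x0 t0 tT).
have [gi hN] := forcing_integrable (G2 v) (lexx 0) T0'.
set N := forcing_norm (G v) 0 T in hx hN.
have N0 : 0 <= N by exact: forcing_norm_ge0.
have X0 := rnorm_ge0 x0; set X := rnorm x0 in hx X0 *.
have [mv iv] := uL2 v T T0'; have [_ iG] := G2 v T T0'.
pose L := \int[lebesgue_measure]_(t in `[0, T]) rnorm (l2repr u t) ^+ 2.
have L0 : 0 <= L by apply: Rintegral_ge0 => t _; exact: sqr_ge0.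
have lu : l2norm u ^+ 2 = L by rewrite sqr_sqrtr.
have LE : \int[lebesgue_measure]_(t in `[0, T]) rnorm (l2repr v t) ^+ 2 = L.
  by apply: sq_integral_ae mv (l2repr_measurable u) _; exact: l2ext_itv.
have hNL : N ^+ 2 <= T * Cb ^+ 2 * L.
  apply: le_trans hN _; rewrite subr0 -mulrA ler_wpM2l// -LE -RintegralZl//.
  apply: le_Rintegral => //; first exact: integrable_mull.
  by move=> t _; rewrite -exprMn lerXn2r ?nnegrE ?mulr_ge0 ?rnorm_ge0//; exact: hB.
pose E := \int[lebesgue_measure]_(t in `[0, T]) rnorm (l2repr (Rf (x0, v)) t) ^+ 2.
have -> : l2norm (RTf (x0, u)) = Num.sqrt E.
  congr (Num.sqrt _).
  by apply: sq_integral_ae (l2repr_measurable _) (l2repr_measurable_itv _ _) (l2restrE T _).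
(* Dropping the final energy from the balance gives [E <= (X + N) N + X ^ 2 / 2], where [X + N]
   bounds the trajectory on [[0, T]]. *)
have hE : E <= 2 * X ^+ 2 + 2 * N ^+ 2.
  have hs : \int[lebesgue_measure]_(t in `[0, T]) rin (G v t) (x t) <= (X + N) * N.
    rewrite -[X in _ * X]/(\int[lebesgue_measure]_(t in `[0, T]) rnorm (G v t)) -RintegralZl//.
    apply: le_Rintegral => //.
    - exact: (supply_integrable cS rW Wc x0 (G2 v) T0').
    - exact: integrable_mull.
    - move=> t /=; rewrite in_itv/= => /andP[t0 tT]; apply: le_trans (ler_norm _) _.
      apply: le_trans (hf_le_norm hilbert_rin _ _) _; rewrite mulrC ler_wpM2r ?rnorm_ge0//.
      exact: hx.
  have := energy x0 v T T0; rewrite -/x -/X -/E => e.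
  have := sqr_ge0 (X - N); have := sqr_ge0 (rnorm (x T)); have := sqr_ge0 N; nra.
rewrite lu -sqrtrM; last by rewrite addr_ge0// !mulr_ge0// sqr_ge0.
apply: ler_wsqrtr; apply: le_trans hE _.
rewrite -subr_ge0 (_ : _ - _ =
  2 * (T * Cb ^+ 2 * L - N ^+ 2) + 2 * L + 2 * T * Cb ^+ 2 * X ^+ 2); last by ring.
by rewrite !addr_ge0 ?mulr_ge0 ?subr_ge0 ?sqr_ge0.
Qed.
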